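(* Let $\nu$ be a partition of a positive even integer into odd parts. Then the term of top degree (degree $|\nu|/2$ in $n$) of the expectation of $\mathbf g_\nu$ with respect to the pillowcase distribution on partitions of $n$ vanishes: $$\lim_{\substack{n\to\infty\\ n\text{ even}}}n^{-|\nu|/2}\,\langle\mathbf g_\nu\rangle_{\mathsf w_n}=0,\qquad\text{where}\quad \langle\mathbf g_\nu\rangle_{\mathsf w_n}=\frac{\sum_{\lambda}\mathsf w(\lambda)\,\mathbf g_\nu(\lambda)}{\sum_{\lambda}\mathsf w(\lambda)},$$ both sums being over all balanced partitions $\lambda$ of $n$.
   Context: For a partition $\lambda$ of $n$, $\chi^\lambda$ is the irreducible character of $S(n)$ indexed by $\lambda$, $\dim\lambda$ its dimension, $C_\eta$ the conjugacy class of cycle type $\eta$, and $\mathbf f_\eta(\lambda)=|C_\eta|\chi^\lambda(\eta)/\dim\lambda$. For $n$ even and $n\ge|\nu|$, $$\mathbf g_\nu(\lambda)=\frac{\mathbf f_{(\nu,2,2,\dots,2)}(\lambda)}{\mathbf f_{(2,2,\dots,2)}(\lambda)},\qquad \mathsf w(\lambda)=\left(\frac{\dim\lambda}{n!}\right)^2\mathbf f_{(2,2,\dots,2)}(\lambda)^4,$$ where $(\nu,2,\dots,2)$ is $\nu$ completed by parts equal to $2$ to a partition of $n$, and $(2,\dots,2)$ is the partition of $n$ with all parts equal to 2. A partition is balanced if its Young diagram can be obtained from the empty one by successively adding dominoes (pairs of adjacent cells), each intermediate shape being a Young diagram; $\mathsf w(\lambda)\neq0$ exactly when $\lambda$ is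 balanced, so $\mathbf g_\nu$ is defined on the support of $\mathsf w$. *)

(* Defs.v *)
From mathcomp Require Import all_boot all_order all_algebra all_fingroup.
From mathcomp Require Import all_field all_character.
From mathcomp Require Import boolp classical_sets filter topology normedtype.

Set Implicit Arguments.
Unset Strict Implicit.
Unset Printing Implicit Defensive.

Import GRing.Theory.
Import numFieldNormedType.Exports.

Local Open Scope ring_scope.

Definition is_partition (s : seq nat) : bool := sorted geq s && (0%N \notin s).

Definition is_partition_of (n : nat) (s : seq nat) : bool :=
  is_partition s && (sumn s == n).

(* A partition of n has at most n parts, each at most n, so it is given by
   exactly one element of this finite type. *)
Definition partn_carrier (n : nat) := n.-bseq 'I_n.+1.

Definition parts (n : nat) (s : partn_carrier n) : seq nat := map val s.

Definition symS (n : nat) : {group 'S_n} := [set: 'S_n]%G.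

(* Row and column of the entry k in the tableau of shape la filled row by row
   with 0, ..., n - 1 (la a partition of n). *)
Definition tab_row (n : nat) (la : seq nat) (k : 'I_n) : nat :=
  reshape_index la k.
Definition tab_col (n : nat) (la : seq nat) (k : 'I_n) : nat :=
  reshape_offset la k.

Definition row_group (n : nat) (la : seq nat) : {set 'S_n} :=
  [set s : 'S_n | [forall k, tab_row la (s k) == tab_row la k]].
Definition col_group (n : nat) (la : seq nat) : {set 'S_n} :=
  [set s : 'S_n | [forall k, tab_col la (s k) == tab_col la k]].

(* gring_row (regular_repr _ _ x) is the basis vector x of the group algebra. *)
Definition young_symmetrizer (n : nat) (la : seq nat) : 'rV[algC]_#|symS n| :=
  \sum_(p in row_group n la) \sum_(q in col_group n la)
    (-1) ^+ (odd_perm q) *: gring_row (regular_repr algC (symS n) (p * q)%g).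

(* The Specht module of la: the submodule of the regular representation
   generated by the Young symmetrizer. *)
Definition specht_repr (n : nat) (la : seq nat) :=
  submod_repr
    (cyclic_mx_module (regular_repr algC (symS n)) (young_symmetrizer n la)).

(* The irreducible character of S(n) indexed by la; its values are rational
   integers. *)
Definition chiS (n : nat) (la : seq nat) : 'CF(symS n) :=
  cfRepr (specht_repr n la).

Definition dimS (n : nat) (la : seq nat) : algC := chiS n la 1%g.

(* The cycle lengths of s, fixed points included, form the multiset eta; the
   order in which eta is listed does not matter. *)
Definition cycle_class (n : nat) (eta : seq nat) : {set 'S_n} :=
  [set s : 'S_n |
    perm_eq [seq #|(X : {set 'I_n})| | X <- enum (porbits s)] eta].

(* repr picks an element of the class. *)
Definition fS (n : nat) (eta la : seq nat) : algC :=
  #|cycle_class n eta|%:R * chiS n la (repr (cycle_class n eta)) / dimS n la.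

(* (nu, 2, ..., 2), meaningful for sumn nu <= n with n - sumn nu even. *)
Definition complete2 (n : nat) (nu : seq nat) : seq nat :=
  nu ++ nseq (n - sumn nu)./2 2%N.

Definition gS (n : nat) (nu la : seq nat) : algC :=
  fS n (complete2 n nu) la / fS n (nseq n./2 2%N) la.

Definition wS (n : nat) (la : seq nat) : algC :=
  (dimS n la / n`!%:R) ^+ 2 * fS n (nseq n./2 2%N) la ^+ 4.

(* The cell (i, j) lies in row i and column j, both counted from 0. *)
Definition diagram (la : seq nat) : set (nat * nat) :=
  [set c | (c.2 < nth 0 la c.1)%N]%classic.

(* d is the right or the lower neighbour of c. *)
Definition domino (c d : nat * nat) : Prop :=
  (d.1 = c.1 /\ d.2 = c.2.+1) \/ (d.1 = c.1.+1 /\ d.2 = c.2).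

Definition add_domino (mu la : seq nat) : Prop :=
  exists c d : nat * nat,
    [/\ domino c d, ~ diagram mu c, ~ diagram mu d &
        diagram la = (diagram mu `|` [set c; d])%classic].

Inductive balanced : seq nat -> Prop :=
| balanced_nil : balanced [::]
| balanced_domino (mu la : seq nat) :
    balanced mu -> is_partition la -> add_domino mu la -> balanced la.

Definition balanced_partition_of (n : nat) (la : seq nat) : bool :=
  is_partition_of n la && `[< balanced la >].

Definition pillowcase_mean (n : nat) (g : seq nat -> algC) : algC :=
  (\sum_(la : partn_carrier n | balanced_partition_of n (parts la))
     wS n (parts la) * g (parts la))
  / (\sum_(la : partn_carrier n | balanced_partition_of n (parts la))
       wS n (parts la)).

(* Main.v *)
Require Import Defs.
From mathcomp Require Import all_boot all_order all_algebra all_fingroup.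
From mathcomp Require Import all_field all_character.
From mathcomp Require Import boolp.
From mathcomp Require Import zify ring.

(** By Frobenius' formula the mean of [g_nu] is a ratio [Q_nu / Q_0], where [Q_nu]
    counts the factorizations [x1 x2 x3 x4 = 1] with [x1], [x2], [x3]
    fixed-point-free involutions and [x4] of cycle type [(nu, 2, ..., 2)], and
    [Q_0] those with [x4] a fixed-point-free involution too; restricting the sums
    to balanced partitions changes nothing, since by the Murnaghan-Nakayama rule
    the other characters vanish on fixed-point-free involutions. Fix [x1] and [x2]
    and let [h] be the inverse of [x1 x2]. A choice of [x3] counted by [Q_nu] is
    described by a ribbon graph with [m = |nu| / 2] edges, whose faces are glued to
    [2 r] of the cycles of [h], and by a choice of the kind counted by [Q_0] on the
    remaining cycles, which extends to all the cycles because cycles of equal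
    length can be paired. The edge lengths are constrained by the lengths of the
    faces, and these [2 r] linear conditions are independent because every vertex
    of the graph has odd degree: this leaves [n^(m - 2 r)] choices, and [n^r] more
    for the position of the graph relative to the paired faces. As [r >= 1] we get
    [n Q_nu <= C n^m Q_0]. *)

Set Implicit Arguments.
Unset Strict Implicit.
Unset Printing Implicit Defensive.

Import Order.TTheory GRing.Theory Num.Theory.

(** * Factorizations into fixed-point-free involutions *)

Lemma even_card_fpf (T : finType) (X : {set T}) (f : T -> T) :
  (forall x, x \in X -> [/\ f x \in X, f (f x) = x & f x != x]) -> ~~ odd #|X|.
Proof.
move cX: #|X| => n; elim/ltn_ind: n X cX => n IH X cX fX.
have [X0|[x xX]] := set_0Vmem X; first by rewrite -cX X0 cards0.
have [fxX ffx fxx] := fX x xX.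
have fxX' : f x \in X :\ x by rewrite !inE fxx.
have cX2 : #|X| = #|(X :\ x) :\ f x|.+2.
  by rewrite (cardsD1 x X) xX (cardsD1 (f x) (X :\ x)) fxX'.
rewrite -cX cX2 /= negbK; apply: (IH _ _ ((X :\ x) :\ f x)) => //.
  by rewrite -cX cX2.
move=> y; rewrite !inE => /and3P[yfx yx yX]; have [fyX ffy fyy] := fX y yX.
split=> //; rewrite fyX andbT; apply/andP; split.
  by apply: contra yx => /eqP e; rewrite -ffy e ffx.
by apply: contra yfx => /eqP e; rewrite -ffy e.
Qed.

Lemma color_pairing (T : finType) (X : {set T}) (c : T -> nat) :
  (forall l, ~~ odd #|[set x in X | c x == l]|) ->
  exists f : T -> T, forall x, x \in X ->
    [/\ f x \in X, f (f x) = x, f x != x & c (f x) = c x].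
Proof.
move cX: #|X| => n; elim/ltn_ind: n X cX => n IH X cX cev.
have [X0|[x xX]] := set_0Vmem X; first by exists id => x; rewrite X0 inE.
have [y /andP[yx yc] yX] : exists2 y, (y != x) && (c y == c x) & y \in X.
  have xC : x \in [set z in X | c z == c x] by rewrite inE xX eqxx.
  have := cev (c x); rewrite (cardsD1 x) xC /= negbK.
  have [->|[y]] := set_0Vmem ([set z in X | c z == c x] :\ x); first by rewrite cards0.
  by rewrite !inE => /and3P[yx yX yc] _; exists y; rewrite ?yx.
have cX2 : #|X| = #|(X :\ x) :\ y|.+2.
  by rewrite (cardsD1 x X) xX (cardsD1 y (X :\ x)) !inE yx yX.
have [|l|f fP] := IH #|(X :\ x) :\ y| _ ((X :\ x) :\ y) erefl.
- by rewrite -cX cX2.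
- have [e|ne] := eqVneq l (c x); last first.
    rewrite (_ : [set _ in _ | _] = [set z in X | c z == l]) ?cev //.
    apply/setP => z; rewrite !inE; have [->|zy] := eqVneq z y.
      by rewrite (eqP yc) [c x == l]eq_sym (negPf ne) !andbF.
    by have [->|zx] //= := eqVneq z x; rewrite [c x == l]eq_sym (negPf ne) !andbF.
  have := cev l; set Xl := [set _ in X | _].
  rewrite (cardsD1 x Xl) (cardsD1 y (Xl :\ x)) !inE yx yX xX (eqP yc) e eqxx /= negbK.
  congr (~~ odd _); apply: eq_card => z; rewrite !inE e.
  by do 2!case: (z == _); rewrite ?andbF.
exists (fun z => if z == x then y else if z == y then x else f z) => z zX.
have [->|zx] := eqVneq z x; first by rewrite (negPf yx) eqxx yX (eqP yc).
have [->|zy] := eqVneq z y; first by rewrite eqxx [x == y]eq_sym (negPf yx) xX (eqP yc).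
have [] := fP z; first by rewrite !inE zx zy zX.
by rewrite !inE => /and3P[/negPf-> /negPf-> ->] -> -> ->.
Qed.

Lemma order_fconnect (T : finType) (h : {perm T}) x y :
  fconnect h x y -> fingraph.order h y = fingraph.order h x.
Proof.
move=> xy; apply: eq_card => z; rewrite !inE; apply/esym.
by apply: same_connect => //; apply: fconnect_sym; apply: perm_inj.
Qed.

Section Rev.
Variables (T : finType) (h : {perm T}) (s : T -> T) (R : pred T).
Hypothesis Rh : forall x, R (h x) = R x.
Hypothesis Rs : forall x, R x -> R (s x).
Hypothesis sK : forall x, R x -> s (s x) = x.
Hypothesis sF : forall x, R x -> s x != x.
Hypothesis hsh : forall x, R x -> h (s (h x)) = s x.
Hypothesis hs : forall x, R x -> h (s x) != x.

Let hI : injective h := @perm_inj _ h.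
Let iter_hI k : injective (iter k h).
Proof. by elim: k => //= k IH x y /hI/IH. Qed.

Lemma R_iter k x : R (iter k h x) = R x.
Proof. by elim: k => //= k IH; rewrite Rh. Qed.

Lemma rev_iter k x : R x -> iter k h (s (iter k h x)) = s x.
Proof.
move=> Rx; elim: k => //= k IH; rewrite -iterS iterSr /= hsh ?R_iter //.
Qed.

Lemma rev_fconnect x y : R x -> fconnect h x y -> fconnect h (s x) (s y).
Proof.
move=> Rx /iter_findex <-; rewrite fconnect_sym // -(rev_iter (findex h x y) Rx).
exact: fconnect_iter.
Qed.

Lemma rev_R_fconnect x y : fconnect h x y -> R y = R x.
Proof. by move=> /iter_findex <-; rewrite R_iter. Qed.

Lemma rev_order_le x : R x -> fingraph.order h x <= fingraph.order h (s x).
Proof.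
move=> Rx; rewrite /fingraph.order -(card_in_imset (f := s) (D := fconnect h x)).
  apply/subset_leq_card/subsetP => _ /imsetP[y xy ->]; exact: rev_fconnect.
move=> y z /rev_R_fconnect Ry /rev_R_fconnect Rz e.
by rewrite -(sK (x := y)) ?Ry // e sK // Rz.
Qed.

Lemma rev_order x : R x -> fingraph.order h (s x) = fingraph.order h x.
Proof.
move=> Rx; apply/eqP; rewrite eqn_leq rev_order_le // andbT.
by have := rev_order_le (Rs Rx); rewrite sK.
Qed.

Lemma rev_nconnect x : R x -> ~~ fconnect h x (s x).
Proof.
move=> Rx; apply/negP => /iter_findex; set k := findex _ _ _ => sx.
have ri j (y := iter j h x) : iter j h (s y) = iter k h x by rewrite rev_iter.
have [ok|ek] := boolP (odd k); last first.
  have e : k = k./2 + k./2 by rewrite addnn even_halfK.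
  have := ri k./2; rewrite {3}e iterD => /iter_hI e2.
  by have := sF (x := iter k./2 h x); rewrite R_iter e2 eqxx => /(_ Rx).
have e : k = k./2.+1 + k./2 by rewrite addSn addnn -[LHS](odd_double_half k) ok.
have := ri k./2.+1; rewrite {3}e iterD => /iter_hI e2.
by have := hs (x := iter k./2.+1 h x); rewrite R_iter e2 -iterS eqxx => /(_ Rx).
Qed.

Lemma even_card_rev l :
  ~~ odd #|[set x | [&& froots h x, R x & fingraph.order h x == l]]|.
Proof.
apply: (even_card_fpf (f := fun x => froot h (s x))) => x; rewrite !inE.
move=> /and3P[/eqP rx Rx /eqP ox].
have c1 : fconnect h (s x) (froot h (s x)) by apply: connect_root.
have Rr := rev_R_fconnect c1; have Rsx := Rs Rx.
have c2 : fconnect h (s (s x)) (s (froot h (s x))) by apply: rev_fconnect.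
have rE a b : fconnect h a b -> froot h a = froot h b.
  by move=> ab; apply/eqP; rewrite root_connect //; exact: fconnect_sym.
split.
- rewrite roots_root; last exact: fconnect_sym.
  by rewrite Rr Rsx (order_fconnect c1) rev_order // ox eqxx.
- by rewrite -(rE _ _ c2) sK.
apply/eqP => e; have := rev_nconnect Rx; rewrite fconnect_sym //.
by rewrite -{2}e c1.
Qed.
End Rev.

Section Reglue.
Variables (T : finType) (h : {perm T}) (s : T -> T) (R : pred T).
Hypothesis Rh : forall x, R (h x) = R x.
Hypothesis Rs : forall x, R x -> R (s x).
Hypothesis sK : forall x, R x -> s (s x) = x.
Hypothesis sF : forall x, R x -> s x != x.
Hypothesis hsh : forall x, R x -> h (s (h x)) = s x.
Hypothesis hs : forall x, R x -> h (s x) != x.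
Variables (base pi : T -> T) (D : {set T}).
Hypothesis baseD : forall x, ~~ R x -> base x \in D.
Hypothesis base_conn : forall x, ~~ R x -> fconnect h (base x) x.
Hypothesis base_h : forall x, base (h x) = base x.
Hypothesis base_id : forall b, b \in D -> base b = b.
Hypothesis DR : forall b, b \in D -> ~~ R b.
Hypothesis piP : forall b, b \in D ->
  [/\ pi b \in D, pi (pi b) = b, pi b != b & fingraph.order h (pi b) = fingraph.order h b].

Let hI : injective h := @perm_inj _ h.

Definition reglue x :=
  if R x then s x
  else iter (fingraph.order h (base x) - findex h (base x) x) h (pi (base x)).

Lemma base_iter k x : base (iter k h x) = base x.
Proof. by elim: k => //= k IH; rewrite base_h. Qed.

Lemma reglueR x : R x -> reglue x = s x.
Proof. by rewrite /reglue => ->. Qed.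

Lemma reglue_iter b k : b \in D -> k < fingraph.order h b ->
  reglue (iter k h b) = iter (fingraph.order h b - k) h (pi b).
Proof.
move=> bD kb; rewrite /reglue base_iter (base_id bD) findex_iter //.
by rewrite (R_iter Rh) (negPf (DR bD)).
Qed.

Lemma reglue_base b : b \in D -> reglue b = pi b.
Proof.
move=> bD; have [_ _ _ o] := piP bD.
by rewrite (@reglue_iter b 0) ?fingraph.order_gt0 // subn0 -o iter_order.
Qed.

Variant nonR_spec x : Type :=
  NonRSpec b k of b \in D & k < fingraph.order h b & x = iter k h b.

Lemma nonRP x : ~~ R x -> nonR_spec x.
Proof.
move=> nR; exists (base x) (findex h (base x) x); first exact: baseD.
  by apply: findex_max; apply: base_conn.
by rewrite iter_findex ?base_conn.
Qed.

Lemma reglueK x : reglue (reglue x) = x.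
Proof.
have [Rx|/nonRP[b k bD kb ->]] := boolP (R x); first by rewrite !reglueR ?Rs ?sK.
have [pD pp pb o] := piP bD; rewrite reglue_iter //.
have [->|k0] := posnP k; first by rewrite subn0 -o iter_order // reglue_base.
rewrite reglue_iter ?o //; last by rewrite -subSn ?leq_subLR; lia.
by rewrite subKn ?(ltnW kb) // pp.
Qed.

Lemma base_reglue b k : b \in D -> k < fingraph.order h b -> base (reglue (iter k h b)) = pi b.
Proof. by move=> bD kb; rewrite reglue_iter // base_iter base_id //; case: (piP bD). Qed.

Lemma reglue_fpf x : reglue x != x.
Proof.
have [Rx|/nonRP[b k bD kb ->]] := boolP (R x); first by rewrite reglueR ?sF.
have [pD pp pb o] := piP bD; apply: contra pb => /eqP e.
by rewrite -(base_reglue bD kb) e base_iter base_id.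
Qed.

Lemma h_reglue_neq x : h (reglue x) != x.
Proof.
have [Rx|/nonRP[b k bD kb ->]] := boolP (R x); first by rewrite reglueR ?hs.
have [pD pp pb o] := piP bD; apply: contra pb => /eqP e.
by rewrite -(base_reglue bD kb) -base_h e base_iter base_id.
Qed.

Lemma h_reglue_h x : h (reglue (h x)) = reglue x.
Proof.
have [Rx|/nonRP[b k bD kb ->]] := boolP (R x); first by rewrite !reglueR ?Rh ?hsh.
have [pD pp pb o] := piP bD; rewrite -iterS [RHS]reglue_iter //.
have [kb1|kb1] := ltnP k.+1 (fingraph.order h b).
  by rewrite reglue_iter // -iterS -subSn.
have -> : k.+1 = fingraph.order h b by apply/eqP; rewrite eqn_leq kb kb1.
have -> : k = (fingraph.order h b).-1 by lia.
rewrite iter_order // reglue_base // -[fingraph.order h b]prednK ?fingraph.order_gt0 //=.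
by rewrite subSnn.
Qed.

End Reglue.

Section LocalStructure.
Variables (T : finType) (h s : {perm T}) (B : {set T}).
Local Notation t := (h^-1 * s)%g.
Hypothesis sK : forall x, s (s x) = x.
Hypothesis sF : forall x, s x != x.
Hypothesis tB : forall x, x \in B -> t x \in B.
Hypothesis tK : forall x, x \notin B -> t (t x) = x.
Hypothesis tF : forall x, x \notin B -> t x != x.

Let hI : injective h := @perm_inj _ h.
Let iter_hI k : injective (iter k h).
Proof. by elim: k => //= k IH x y /hI/IH. Qed.

Lemma tE x : t (h x) = s x.
Proof. by rewrite permM permK. Qed.

Lemma t_in x : (t x \in B) = (x \in B).
Proof.
have e : t @: B = B.
  apply/eqP; rewrite eqEcard card_imset ?leqnn ?andbT; last exact: perm_inj.
  by apply/subsetP => _ /imsetP[y yB ->]; apply: tB.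
apply/idP/idP => [|/tB //]; rewrite -{1}e => /imsetP[y yB /perm_inj->] //.
Qed.

Lemma hsh_out x : h x \notin B -> h (s (h x)) = s x.
Proof.
move=> hxB; have := tK hxB; rewrite tE permM => /(congr1 s); rewrite sK => <-.
by rewrite permKV.
Qed.

Lemma gap_ex b : b \in B -> exists i, (0 < i) && (iter i h b \in B).
Proof. by move=> bB; exists (fingraph.order h b); rewrite fingraph.order_gt0 iter_order. Qed.

Definition gap b : nat := if insub b is Some b' then ex_minn (gap_ex (@valP _ _ {b | b \in B} b')) else 0.

Lemma gapP b : b \in B -> [/\ 0 < gap b, gap b <= fingraph.order h b, iter (gap b) h b \in B
  & forall i, 0 < i -> i < gap b -> iter i h b \notin B].
Proof.
move=> bB; rewrite /gap insubT /=; case: ex_minnP => g /andP[g0 gB] gmin.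
split=> //; first by apply: gmin; rewrite fingraph.order_gt0 iter_order.
move=> i i0 ig; apply/negP => iB; have := gmin i; rewrite i0 iB leqNgt ig.
by move=> /(_ isT).
Qed.

Definition next b := iter (gap b) h b.
Definition opp b := t (next b).

Lemma next_in b : b \in B -> next b \in B.
Proof. by case/gapP. Qed.

Lemma opp_in b : b \in B -> opp b \in B.
Proof. by move=> bB; rewrite /opp t_in next_in. Qed.

Lemma s_iter b i : b \in B -> i < gap b -> iter i h (s (iter i h b)) = s b.
Proof.
move=> bB; elim: i => // i IH ig; have [_ _ _ no] := gapP bB.
rewrite iterSr hsh_out; last by apply: (no i.+1).
by apply: IH; apply: ltnW.
Qed.

Lemma iter_opp b : b \in B -> iter (gap b).-1 h (opp b) = s b.
Proof.
move=> bB; have [g0 _ _ _] := gapP bB.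
rewrite -(s_iter bB (i := (gap b).-1)) ?prednK //; congr (iter _ h _).
by rewrite /opp /next -{1}(prednK g0) iterS tE.
Qed.

Lemma s_iter_opp b i : b \in B -> i < gap b -> s (iter i h b) = iter ((gap b).-1 - i) h (opp b).
Proof.
move=> bB ig; apply: (@iter_hI i); rewrite s_iter // -iterD subnKC ?iter_opp //.
by rewrite -ltnS prednK // (leq_ltn_trans _ ig).
Qed.

Lemma h_s_in b : b \in B -> h (s b) \in B.
Proof. by move=> bB; rewrite -t_in tE sK. Qed.

Lemma gap_opp b : b \in B -> gap (opp b) = gap b.
Proof.
move=> bB; have [g0 _ gB no] := gapP bB; have oB := opp_in bB.
have [g0' _ gB' no'] := gapP oB.
have e : iter (gap b) h (opp b) = h (s b) by rewrite -(prednK g0) iterS iter_opp.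
apply/eqP; rewrite eqn_leq; apply/andP; split; rewrite leqNgt; apply/negP => lt.
  by have := no' _ g0 lt; rewrite e h_s_in.
have lt' : (gap b).-1 - gap (opp b) < gap b by lia.
have : iter (gap (opp b)) h (opp b) = s (iter ((gap b).-1 - gap (opp b)) h b).
  by rewrite s_iter_opp // subKn //; lia.
rewrite -tE -iterS => e2; move: gB'; rewrite e2 t_in.
by apply/negP; apply: no; lia.
Qed.

Lemma next_opp b : b \in B -> next (opp b) = h (s b).
Proof.
move=> bB; have [g0 _ _ _] := gapP bB.
by rewrite /next gap_opp // -(prednK g0) iterS iter_opp.
Qed.

Lemma oppK b : b \in B -> opp (opp b) = b.
Proof. by move=> bB; rewrite {1}/opp next_opp // tE sK. Qed.

Lemma opp_neq b : b \in B -> opp b != b.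
Proof.
move=> bB; apply/eqP => e; have [g0 _ _ no] := gapP bB.
have [og|eg] := boolP (odd (gap b)).
  have lt : (gap b)./2 < gap b by rewrite -{2}(odd_double_half (gap b)) og; lia.
  have := s_iter_opp bB lt; rewrite e (_ : (gap b).-1 - _ = (gap b)./2).
    by move=> e2; have := sF (iter (gap b)./2 h b); rewrite e2 eqxx.
  by rewrite -{1}(odd_double_half (gap b)) og; lia.
have eg2 : gap b = (gap b)./2.*2 by rewrite even_halfK.
have lt : (gap b)./2.-1 < gap b by lia.
have := s_iter_opp bB lt; rewrite e (_ : (gap b).-1 - _ = (gap b)./2); last by lia.
rewrite -tE -iterS prednK; last by lia.
have h0 : 0 < (gap b)./2 by lia.
have h1 : (gap b)./2 < gap b by lia.
by move=> e2; have := tF (no _ h0 h1); rewrite e2 eqxx.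
Qed.

Definition touched x := [exists b in B, fconnect h b x].

Lemma touched_h x : touched (h x) = touched x.
Proof. by apply: eq_existsb => b; rewrite -same_fconnect1_r. Qed.

Lemma touched_B b : b \in B -> touched b.
Proof. by move=> bB; apply/existsP; exists b; rewrite bB connect0. Qed.

Lemma touchedP x : touched x -> exists2 b, b \in B & exists2 i, i < gap b & x = iter i h b.
Proof.
case/existsP => b /andP[bB /iter_findex <-]; move: (findex _ _ _) => k.
elim/ltn_ind: k b bB => k IH b bB; have [g0 _ gB _] := gapP bB.
case: (ltnP k (gap b)) => kg; first by exists b => //; exists k.
have [|b' b'B [i ig e]] := IH (k - gap b) _ _ gB; first by lia.
by exists b' => //; exists i => //; rewrite -e -iterD subnK.
Qed.

Lemma touched_s x : touched x -> touched (s x).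
Proof.
case/touchedP => b bB [i ig ->]; rewrite s_iter_opp //.
by apply/existsP; exists (opp b); rewrite opp_in // fconnect_iter.
Qed.

Lemma untouched_s x : ~~ touched x -> ~~ touched (s x).
Proof. by apply: contra => /touched_s; rewrite sK. Qed.

Lemma untouched_hsh x : ~~ touched x -> h (s (h x)) = s x.
Proof. by move=> nx; apply: hsh_out; apply: contra nx => /touched_B; rewrite touched_h. Qed.

Lemma untouched_hs x : ~~ touched x -> h (s x) != x.
Proof.
move=> nx; have hB : x \notin B by apply: contra nx; apply: touched_B.
apply/eqP => e; have e' : h^-1%g x = s x by rewrite -{1}e permK.
by have := tF hB; rewrite permM e' sK eqxx.
Qed.

End LocalStructure.

Definition fpf_perm (T : finType) (p : {perm T}) : bool :=
  [forall x, (p (p x) == x) && (p x != x)].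

Lemma fpf_permP (T : finType) (p : {perm T}) :
  reflect ((forall x, p (p x) = x) /\ (forall x, p x != x)) (fpf_perm p).
Proof.
apply: (iffP forallP) => [h|[h1 h2] x]; last by rewrite h1 eqxx h2.
by split=> x; have /andP[/eqP] := h x.
Qed.

Definition odd_support (T : finType) (t : {perm T}) : {set T} := [set x | odd #|porbit t x|].

Definition near_fpf (T : finType) (M : nat) (t : {perm T}) : bool :=
  (#|odd_support t| == M) &&
  [forall x in ~: odd_support t, (t (t x) == x) && (t x != x)].

Definition fpf_factors (T : finType) (h : {perm T}) : {set {perm T}} :=
  [set s | fpf_perm s && fpf_perm (h^-1 * s)%g].
Definition near_factors (T : finType) (M : nat) (h : {perm T}) : {set {perm T}} :=
  [set s | fpf_perm s && near_fpf M (h^-1 * s)%g].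

(* The combinatorial type of a ribbon graph with [M] half-edges: the first return
   map [nx] (whose cycles are the faces), the vertex permutation [vx], a
   representative [rp] of each face and a pairing [pr] of these representatives. *)
Record ribbon_ok (M : nat) (nx vx rp pr : {ffun 'I_M -> 'I_M}) : Prop := RibbonOk {
  nx_inj : injective nx;
  rp_nx : forall i, rp (nx i) = rp i;
  rpK : forall i, rp (rp i) = rp i;
  nx_reach : forall i, exists k, iter k nx (rp i) = i;
  vx_odd : forall i, exists2 j, odd j & iter j vx i = i;
  edgeK : forall i, vx (nx (vx (nx i))) = i;
  edge_neq : forall i, vx (nx i) != i;
  prP : forall i, rp i = i -> [/\ rp (pr i) = pr i, pr (pr i) = i & pr i != i]
}.

(* [s] is a metric realization of the ribbon graph inside the cycles of [h]: [be]
   embeds the half-edges, [g] are the edge lengths, [pos] the positions on the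
   faces relative to the representatives, and [s'] is [s] reglued along faces. *)
Record realizes (T : finType) (M : nat) (nx vx rp pr : {ffun 'I_M -> 'I_M})
    (h s s' : {perm T}) (be : 'I_M -> T) (g pos : 'I_M -> nat) : Prop := Realizes {
  g_edge : forall i, g (vx (nx i)) = g i;
  g_le : forall i, 0 < g i <= #|T|;
  be_pos : forall i, be i = iter (pos i) h (be (rp i));
  pos_rp : forall i, rp i = i -> pos i = 0;
  pos_nx : forall i, pos i + g i = pos (nx i) + fingraph.order h (be (rp i)) * (nx i == rp i);
  s_edge : forall i k, k < g i -> s (iter k h (be i)) = iter ((g i).-1 - k) h (be (vx (nx i)));
  s_off : forall x, (forall i k, k < g i -> x <> iter k h (be i)) -> s x = s' x;
  s'_rp : forall i, rp i = i -> s' (be i) = be (pr i);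
  s'_fpf : s' \in fpf_factors h
}.

Section Decode.
Variables (T : finType) (M : nat) (nx vx rp pr : {ffun 'I_M -> 'I_M}).
Hypothesis ok : ribbon_ok nx vx rp pr.
Local Notation sg i := (vx (nx i)).

Local Open Scope ring_scope.

(* [d], the difference of two length functions with the same face perimeters, is
   orthogonal to [Y] and [Y o sg], so [Y + Y o sg = 0]; then [Y] changes sign along
   [vx], whose cycles are odd. *)
Lemma ribbon_rigid (d De Y : 'I_M -> int) :
  (forall i, d i = De (nx i) - De i) -> (forall i, d (sg i) = d i) ->
  (forall i, Y (nx i) = Y i) -> (forall i, d i + Y i + Y (sg i) = 0) ->
  (forall i, Y i = 0) /\ (forall i, d i = 0).
Proof.
move=> dE dS YN e0.
have dY : \sum_i d i * Y i = 0.
  under eq_bigr => i _ do rewrite dE mulrBl.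
  rewrite sumrB (eq_bigr (fun i => De (nx i) * Y (nx i))) => [|i _]; last by rewrite YN.
  by rewrite [X in _ - X](reindex_inj (nx_inj ok)) /= subrr.
have sgI : injective (fun i => sg i).
  exact: (@can_inj _ _ (fun i => sg i) (fun i => sg i) (edgeK ok)).
have dYs : \sum_i d i * Y (sg i) = 0.
  rewrite -[RHS]dY [RHS](reindex_inj sgI) /=; apply: eq_bigr => i _; by rewrite dS.
have S0 : \sum_i (Y i + Y (sg i)) ^+ 2 = 0.
  transitivity (\sum_i ((d i + Y i + Y (sg i)) * (Y i + Y (sg i)) - d i * Y i - d i * Y (sg i))).
    by apply: eq_bigr => i _; ring.
  rewrite !sumrB dY dYs !subr0 big1 // => i _; by rewrite e0 mul0r.
have Y0 i : Y (sg i) = - Y i.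
  have /(_ i isT)/eqP := psumr_eq0P (fun i _ => sqr_ge0 (Y i + Y (sg i))) S0.
  by rewrite sqrf_eq0 addrC addr_eq0 => /eqP.
have Yv z : Y (vx z) = - Y z.
  have [nxi _ nxK] : bijective nx by apply: injF_bij; apply: nx_inj ok.
  by rewrite -[z]nxK Y0 YN.
have Yz z : Y z = 0.
  have [j oj ej] := vx_odd ok z.
  have it k : Y (iter k vx z) = (-1) ^+ k * Y z.
    by elim: k => [|k IH]; rewrite ?expr0 ?mul1r //= Yv IH exprS mulN1r mulNr.
  have := it j; rewrite ej -signr_odd oj expr1 mulN1r => /eqP.
  by rewrite -subr_eq0 opprK -mulr2n mulrn_eq0 /= => /eqP.
by split=> // i; have := e0 i; rewrite !Yz !addr0.
Qed.

Variables (h s' s1 s2 : {perm T}) (be1 be2 : 'I_M -> T) (g1 g2 pos1 pos2 : 'I_M -> nat).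
Hypothesis r1 : realizes nx vx rp pr h s1 s' be1 g1 pos1.
Hypothesis r2 : realizes nx vx rp pr h s2 s' be2 g2 pos2.
Hypothesis be12 : forall j : 'I_M, rp j = j -> (j < pr j)%N -> be1 j = be2 j.
Variables y1 y2 : 'I_M -> nat.
Hypothesis y12 : forall i : 'I_M, (i < sg i)%N ->
  (g1 i + y1 (rp i) + y1 (rp (sg i)) = g2 i + y2 (rp i) + y2 (rp (sg i)))%N.

Lemma decode_rp j : rp j = j -> be1 j = be2 j.
Proof.
move=> rj; have [rpj prj nj] := prP ok rj.
have [lt|le] := ltnP j (pr j); first exact: be12.
have lt : (pr j < j)%N by rewrite ltn_neqAle le andbT val_eqE.
rewrite -prj -(s'_rp r1 rpj) -(s'_rp r2 rpj) (be12 rpj) ?prj //.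
Qed.

Lemma decode : s1 = s2 /\ forall j, rp j = j -> y1 j = y2 j.
Proof.
have eL i : fingraph.order h (be1 (rp i)) = fingraph.order h (be2 (rp i)).
  by rewrite decode_rp // (rpK ok).
pose d i : int := (g1 i)%:Z - (g2 i)%:Z.
pose De i : int := (pos1 i)%:Z - (pos2 i)%:Z.
pose Y i : int := (y1 (rp i))%:Z - (y2 (rp i))%:Z.
have yA i : (g1 i + y1 (rp i) + y1 (rp (sg i)) = g2 i + y2 (rp i) + y2 (rp (sg i)))%N.
  have [lt|le] := ltnP i (sg i); first exact: y12.
  have lt : (sg i < i)%N by rewrite ltn_neqAle le andbT val_eqE (edge_neq ok).
  have := y12 (i := sg i); rewrite (edgeK ok) (g_edge r1) (g_edge r2) => /(_ lt).
  lia.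
have [||||Y0 d0] := @ribbon_rigid d De Y.
- move=> i; rewrite /d /De; have := pos_nx r1 i; have := pos_nx r2 i; rewrite eL.
  move: (_ * _)%N => ?; lia.
- by move=> i; rewrite /d (g_edge r1) (g_edge r2).
- by move=> i; rewrite /Y (rp_nx ok).
- by move=> i; rewrite /d /Y; have := yA i; lia.
have eg i : g1 i = g2 i by have := d0 i; rewrite /d; lia.
have DN i : De (nx i) = De i.
  rewrite /De; have := pos_nx r1 i; have := pos_nx r2 i; rewrite eL eg.
  move: (_ * _)%N => ?; lia.
have ep i : pos1 i = pos2 i.
  have [k ek] := nx_reach ok i.
  have : De i = De (rp i).
    by rewrite -{1}ek; elim: k {ek} => //= k IH; rewrite DN.
  rewrite /De (pos_rp r1 (rpK ok i)) (pos_rp r2 (rpK ok i)); lia.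
have eb i : be1 i = be2 i.
  by rewrite (be_pos r1) (be_pos r2) ep decode_rp // (rpK ok).
split; last by move=> j rj; have := Y0 j; rewrite /Y rj; lia.
apply/permP => x.
have [[i [k [kg ->]]]|nx_] := pselect (exists i k, (k < g1 i)%N /\ x = iter k h (be1 i)).
  by rewrite (s_edge r1 kg) !eb (s_edge r2) -?eg.
rewrite (s_off r1) ?(s_off r2) // => i k kg e; apply: nx_; exists i, k.
  by rewrite eg eb.
by [].
Qed.

End Decode.

Lemma half_involution M (X : {set 'I_M}) (f : 'I_M -> 'I_M) :
  (forall x, x \in X -> [/\ f x \in X, f (f x) = x & f x != x]) ->
  #|[set x in X | x < f x]|.*2 = #|X|.
Proof.
move=> fX; rewrite -addnn -(cardsID [set x : 'I_M | x < f x] X).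
have -> : X :&: [set x : 'I_M | x < f x] = [set x in X | x < f x].
  by apply/setP => x; rewrite !inE.
congr (_ + _); rewrite -[LHS](card_in_imset (f := f)); last first.
  move=> x y; rewrite !inE => /andP[xX _] /andP[yX _] e.
  by have [_ <- _] := fX x xX; have [_ <- _] := fX y yX; rewrite e.
apply: eq_card => y; rewrite !inE; apply/imsetP/andP => [[x]|[yf yX]].
  rewrite inE => /andP[xX lt] ->; have [fxX -> _] := fX x xX.
  by rewrite fxX -leqNgt ltnW.
have [fyX ffy fyy] := fX y yX; exists (f y); rewrite ?ffy // inE fyX ffy ltn_neqAle.
by rewrite val_eqE fyy leqNgt.
Qed.

Section Count.
Variables (T : finType) (n' M : nat) (nx vx rp pr : {ffun 'I_M -> 'I_M}).
Hypothesis ok : ribbon_ok nx vx rp pr.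
Hypothesis cT : #|T| = n'.+1.
Hypothesis M0 : 0 < M.
Variable h : {perm T}.

Definition ribbon_near : {set {perm T}} :=
  [set s | `[< exists s' be g pos, realizes nx vx rp pr h s s' be g pos >] ].

(* For [s] in [ribbon_near] and [y] an arbitrary function on the faces, the pair [(s, y)] is
   determined by [s'], by the images of half of the representatives and by the
   function [g + y + y o sg] on the edges. *)
Lemma card_ribbon_near :
  #|ribbon_near| * n'.+1 <= #|fpf_factors h| * (3 * n'.+1) ^ M./2.
Proof.
pose J := [set j | rp j == j].
pose J2 := [set j in J | (j < pr j)%N].
pose E2 := [set i in [set: 'I_M] | (i < vx (nx i))%N].
have cJ : #|J2|.*2 = #|J|.
  apply: half_involution => j; rewrite !inE => /eqP rj.
  by have [e1 e2 e3] := prP ok rj; rewrite e1 eqxx e2 e3.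
have cE : #|E2|.*2 = M.
  rewrite -[RHS]card_ord -cardsT; apply: half_involution => i _.
  by rewrite inE (edgeK ok) (edge_neq ok).
have J0 : 0 < #|J2|.
  rewrite -double_gt0 cJ; apply/card_gt0P; exists (rp (Ordinal M0)).
  by rewrite inE (rpK ok).
have [x0 _] : exists x0 : T, x0 \in predT by apply/card_gt0P; rewrite cT.
have exF (s : {perm T}) : exists c : {perm T} * ('I_M -> T) * ('I_M -> nat) * ('I_M -> nat),
    s \in ribbon_near -> realizes nx vx rp pr h s c.1.1.1 c.1.1.2 c.1.2 c.2.
  have [|] := boolP (s \in ribbon_near); last by exists (s, (fun=> x0), (fun=> 0), (fun=> 0)).
  by rewrite inE => /asboolP[s' [be [g [pos r]]]]; exists (s', be, g, pos).
have [C CP] := choice exF.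
pose Yset := [set y : {ffun 'I_M -> 'I_n'.+1} | y \in pffun_on ord0 (mem J) predT].
pose Wset := [set w : {ffun 'I_M -> T} | w \in pffun_on x0 (mem J2) predT].
pose Vset := [set v : {ffun 'I_M -> 'I_(3 * n').+3} | v \in pffun_on ord0 (mem E2) predT].
pose F (p : {perm T} * {ffun 'I_M -> 'I_n'.+1}) :=
  (((C p.1).1.1.1, [ffun j => if j \in J2 then (C p.1).1.1.2 j else x0]),
   [ffun i => if i \in E2 then
      inord ((C p.1).1.2 i + p.2 (rp i) + p.2 (rp (vx (nx i)))) else ord0 : 'I_(3 * n').+3]).
have cY : #|Yset| = n'.+1 ^ #|J| by rewrite cardsE card_pffun_on card_ord.
have cW : #|Wset| = n'.+1 ^ #|J2| by rewrite cardsE card_pffun_on cT.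
have cV : #|Vset| = (3 * n').+3 ^ M./2.
  by rewrite cardsE card_pffun_on card_ord; congr (_ ^ _); rewrite -[RHS](congr1 half cE) doubleK.
have FI : {in setX ribbon_near Yset &, injective F}.
  move=> [s1 y1] [s2 y2]; rewrite !in_setX /= => /andP[s1R y1Y] /andP[s2R y2Y].
  rewrite /F /= => -[es eb ev].
  have r1 := CP _ s1R; have r2 := CP _ s2R; rewrite -es in r2.
  have be12 (j : 'I_M) : rp j = j -> j < pr j -> (C s1).1.1.2 j = (C s2).1.1.2 j.
    move=> rj lt; have := congr1 (fun w : {ffun 'I_M -> T} => w j) eb.
    by rewrite !ffunE !inE rj eqxx lt.
  have y12 (i : 'I_M) : i < vx (nx i) ->
      (C s1).1.2 i + y1 (rp i) + y1 (rp (vx (nx i))) =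
      (C s2).1.2 i + y2 (rp i) + y2 (rp (vx (nx i))).
    move=> lt; have := congr1 (fun w : {ffun 'I_M -> 'I_(3 * n').+3} => val (w i)) ev.
    have b1 := g_le r1 i; have b2 := g_le r2 i; rewrite cT in b1 b2.
    have u1 := ltn_ord (y1 (rp i)); have u2 := ltn_ord (y2 (rp i)).
    have u3 := ltn_ord (y1 (rp (vx (nx i)))); have u4 := ltn_ord (y2 (rp (vx (nx i)))).
    case/andP: b1 => _ b1; case/andP: b2 => _ b2.
    have aux a b c : a <= n'.+1 -> b < n'.+1 -> c < n'.+1 -> a + b + c < (3 * n').+3 by lia.
    by rewrite !ffunE !inE lt /= !inordK //; apply: aux.
  have [s12 {}y12] := decode ok r1 r2 be12 (y1 := fun j => y1 j) (y2 := fun j => y2 j) y12.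
  congr (_, _) => //; apply/ffunP => j.
  have [rj|rj] := eqVneq (rp j) j; first by apply/val_inj/y12.
  have out y : y \in Yset -> y j = ord0.
    by rewrite in_set => /pffun_onP[/supportP h0 _]; apply: h0; rewrite inE.
  by rewrite !out.
have : #|F @: setX ribbon_near Yset| <= #|setX (setX (fpf_factors h) Wset) Vset|.
  apply/subset_leq_card/subsetP => _ /imsetP[[s y] sy ->].
  move: sy; rewrite !in_setX /= => /andP[sR yY].
  have r := CP _ sR; rewrite (s'_fpf r) /F /= !in_set.
  apply/andP; split; apply/pffun_onP; split=> //; apply/supportP => j /negPf jn.
    by rewrite ffunE jn.
  by rewrite ffunE jn.
rewrite card_in_imset // !cardsX cY cW cV -cJ -addnn expnD.
rewrite [3 * n'.+1]mulnS (_ : (3 * n').+3 = 3 + 3 * n') // => le.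
have nP : n'.+1 <= n'.+1 ^ #|J2| by rewrite -{1}(expn1 n'.+1) leq_pexp2l.
have aux (N A n P V : nat) : 0 < n <= P -> N * (P * P) <= A * P * V -> N * n <= A * V.
  move=> /andP[n0 nP'] le'; have P0 : 0 < P by apply: leq_trans nP'.
  rewrite -(leq_pmul2r P0); apply: leq_trans _ (leq_trans le' _); last by rewrite mulnAC.
  by rewrite -mulnA leq_mul2l leq_mul2r nP' !orbT.
by apply: aux le; rewrite nP.
Qed.
End Count.

Section Existence.
Variables (T : finType) (h a s : {perm T}).
Local Notation t := (h^-1 * s)%g.
Local Notation B := (odd_support t).
Local Notation M := #|odd_support t|.
Hypothesis aA : a \in fpf_factors h.
Hypothesis sK : forall x, s (s x) = x.
Hypothesis sF : forall x, s x != x.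
Hypothesis tK : forall x, x \notin B -> t (t x) = x.
Hypothesis tF : forall x, x \notin B -> t x != x.
Variable b0 : T.
Hypothesis b0B : b0 \in B.

Let hI : injective h := @perm_inj _ h.

Lemma odd_support_stable x : x \in B -> t x \in B.
Proof.
rewrite !inE => xB; rewrite (_ : porbit t (t x) = porbit t x) //.
by apply/eqP; rewrite eq_porbit_mem; exact: (mem_porbit t 1 x).
Qed.
Let tB := odd_support_stable.

Let be (i : 'I_M) : T := enum_val i.
Let idx (x : T) : 'I_M := enum_rank_in b0B x.
Let beB i : be i \in B. Proof. exact: enum_valP. Qed.
Let idxK x : x \in B -> be (idx x) = x. Proof. exact: enum_rankK_in. Qed.
Let beK i : idx (be i) = i. Proof. exact: enum_valK_in. Qed.
Let beI : injective be. Proof. exact: enum_val_inj. Qed.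

Definition ex_nx : {ffun 'I_M -> 'I_M} := [ffun i => idx (next h B (be i))].
Definition ex_vx : {ffun 'I_M -> 'I_M} := [ffun i => idx (t (be i))].
Definition ex_rp : {ffun 'I_M -> 'I_M} :=
  [ffun i => odflt i [pick j | fconnect h (be i) (be j)]].

Lemma be_nx i : be (ex_nx i) = next h B (be i).
Proof. by rewrite ffunE idxK // next_in. Qed.

Lemma be_vx i : be (ex_vx i) = t (be i).
Proof. by rewrite ffunE idxK // tB. Qed.

Lemma be_edge i : be (ex_vx (ex_nx i)) = opp h s B (be i).
Proof. by rewrite be_vx be_nx. Qed.

Lemma rp_conn i : fconnect h (be (ex_rp i)) (be i).
Proof.
rewrite ffunE fconnect_sym //; case: pickP => [j //|/(_ i)].
by rewrite connect0.
Qed.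

Lemma rp_eq i j : fconnect h (be i) (be j) -> ex_rp i = ex_rp j.
Proof.
move=> ij; rewrite !ffunE.
rewrite (eq_pick (Q := fun l => fconnect h (be j) (be l))); last first.
  by move=> l; apply: same_connect ij _; exact: fconnect_sym.
by case: pickP => // /(_ j); rewrite connect0.
Qed.

Definition ex_pos (i : 'I_M) : nat := findex h (be (ex_rp i)) (be i).

Lemma ex_rp_nx i : ex_rp (ex_nx i) = ex_rp i.
Proof. by apply/esym/rp_eq; rewrite be_nx; apply: fconnect_iter. Qed.

Lemma ex_rpK i : ex_rp (ex_rp i) = ex_rp i.
Proof. by apply: rp_eq; apply: rp_conn. Qed.

Lemma ex_nx_inj : injective ex_nx.
Proof.
move=> i j e; apply: beI; rewrite -(oppK sK tB tK (beB i)) -(oppK sK tB tK (beB j)).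
by rewrite -[opp h s B (be i)]be_edge e be_edge.
Qed.

Lemma ex_pos_nx i : ex_pos i + gap h B (be i) =
  ex_pos (ex_nx i) + fingraph.order h (be (ex_rp i)) * (ex_nx i == ex_rp i).
Proof.
have [g0 _ gB no] := gapP h (beB i).
set b := be (ex_rp i); set L := fingraph.order h b; set g := gap h B (be i) in g0 gB no *.
have pL : ex_pos i < L by apply: findex_max; apply: rp_conn.
have pE : iter (ex_pos i) h b = be i by apply: iter_findex; apply: rp_conn.
have nE : iter (ex_pos i + g) h b = be (ex_nx i).
  by rewrite be_nx addnC iterD pE.
have posn : ex_pos (ex_nx i) = findex h b (be (ex_nx i)) by rewrite /ex_pos ex_rp_nx.
have le : ex_pos i + g <= L.
  rewrite leqNgt; apply/negP => lt.
  have := no (L - ex_pos i) _ _; rewrite -pE -iterD subnK ?(ltnW pL) //.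
  rewrite iter_order // beB => h'; have := h' _ _; rewrite subn_gt0 pL ltn_subLR ?(ltnW pL) //.
  by rewrite lt => /(_ isT isT).
have [e|ne] := eqVneq (ex_pos i + g) L.
  have eb : be (ex_nx i) = b by rewrite -nE e iter_order.
  by rewrite posn eb findex0 (beI eb) eqxx muln1 e.
have lt : ex_pos i + g < L by rewrite ltn_neqAle ne.
have pn : ex_pos (ex_nx i) = ex_pos i + g by rewrite posn -nE findex_iter.
case: eqP => [e|_]; last by rewrite muln0 addn0 pn.
by move: pn; rewrite posn e findex0; lia.
Qed.

Lemma ex_pos_rp i : ex_rp i = i -> ex_pos i = 0.
Proof. by move=> e; rewrite /ex_pos e findex0. Qed.

Lemma ex_nx_reach i : exists k, iter k ex_nx (ex_rp i) = i.
Proof.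
move: {2}(ex_pos i) (erefl (ex_pos i)) => p; elim/ltn_ind: p i => p IH i pi.
have [e|ne] := eqVneq (ex_rp i) i; first by exists 0.
have [nxi _ nxK] : bijective ex_nx by apply: injF_bij; apply: ex_nx_inj.
have := ex_pos_nx (nxi i); rewrite nxK -(ex_rp_nx (nxi i)) nxK eq_sym (negPf ne) muln0 addn0.
have [g0 _ _ _] := gapP h (beB (nxi i)); move=> e.
have [|k ek] := IH (ex_pos (nxi i)) _ (nxi i) erefl; first by rewrite -pi -e; lia.
by exists k.+1; rewrite iterS -(ex_rp_nx (nxi i)) nxK in ek *; rewrite ek nxK.
Qed.

Lemma ex_vx_odd i : exists2 j, odd j & iter j ex_vx i = i.
Proof.
exists #|porbit t (be i)|; first by have := beB i; rewrite inE.
apply: beI; have it k : be (iter k ex_vx i) = iter k t (be i).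
  by elim: k => //= k IH; rewrite be_vx IH.
by rewrite it iter_porbit.
Qed.

Lemma ex_edgeK i : ex_vx (ex_nx (ex_vx (ex_nx i))) = i.
Proof. by apply: beI; rewrite !be_edge (oppK sK tB tK). Qed.

Lemma ex_edge_neq i : ex_vx (ex_nx i) != i.
Proof. by rewrite -(inj_eq beI) be_edge (opp_neq sK sF tK tF). Qed.

Let nc : forall x y, froot h x = froot h y -> fconnect h x y.
Proof. by move=> x y /eqP; rewrite root_connect //; exact: fconnect_sym. Qed.

Lemma ex_pairing : exists f : 'I_M -> 'I_M, forall j, j \in [set j | ex_rp j == j] ->
  [/\ f j \in [set j | ex_rp j == j], f (f j) = j, f j != j &
      fingraph.order h (be (f j)) = fingraph.order h (be j)].
Proof.
apply: (color_pairing (c := fun j => fingraph.order h (be j))) => l.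
pose X := [set x | froots h x & fingraph.order h x == l].
have eX : ~~ odd #|X|.
  move: aA; rewrite inE => /andP[/fpf_permP[aK aF] /fpf_permP[taK taF]].
  have un x : ~~ touched h set0 x by apply/existsP => -[b]; rewrite inE.
  have := @even_card_rev T h a predT (fun _ => erefl) (fun _ => id)
     (fun x _ => aK x) (fun x _ => aF x) _ _ l.
  move=> ev; rewrite (_ : X = [set x | [&& froots h x, true & fingraph.order h x == l]]) //.
  apply: ev => x _.
    by apply: (untouched_hsh (B := set0) aK) => // y _; apply: taK.
  by apply: (untouched_hs (B := set0) aK) => // y _; apply: taF.
have eU : ~~ odd #|X :\: [set x | touched h B x]|.
  have := @even_card_rev T h s (fun x => ~~ touched h B x) _ _
     (fun x _ => sK x) (fun x _ => sF x) _ _ l => ev.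
  rewrite (_ : _ :\: _ = [set x | [&& froots h x, ~~ touched h B x & fingraph.order h x == l]]).
    apply: ev => x; first by rewrite touched_h.
    - exact: (untouched_s sK tB tK).
    - exact: (untouched_hsh sK tK).
    - exact: (untouched_hs sK tF).
  by apply/setP => x; rewrite !inE; case: (touched h B x); rewrite ?andbF.
have eT : ~~ odd #|X :&: [set x | touched h B x]|.
  by move: eX; rewrite -(cardsID [set x | touched h B x] X) oddD (negPf eU) addbF.
rewrite -(card_in_imset (f := fun j => froot h (be j))); last first.
  move=> i j; rewrite !inE => /andP[/eqP ri _] /andP[/eqP rj _] /nc /rp_eq.
  by rewrite ri rj.
rewrite (_ : [set _ | _ in _] = X :&: [set x | touched h B x]) //.
apply/setP => x; rewrite !inE; apply/imsetP/andP => [[j]|[/andP[rx ox] tx]].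
  rewrite !inE => /andP[rj oj] ->; have cr : fconnect h (be j) (froot h (be j)).
    exact: connect_root.
  rewrite roots_root ?(order_fconnect cr) ?oj; last exact: fconnect_sym.
  by split=> //; apply/existsP; exists (be j); rewrite beB.
have [b bB [i _ e]] := touchedP tx; pose j := ex_rp (idx b).
have cj : fconnect h (be j) x.
  by apply: connect_trans (rp_conn _) _; rewrite idxK // e fconnect_iter.
exists j; first by rewrite !inE ex_rpK eqxx -(order_fconnect cj).
by rewrite -{1}(eqP rx); apply/esym/eqP; rewrite root_connect //; exact: fconnect_sym.
Qed.

Lemma near_realizes : exists nx vx rp pr : {ffun 'I_M -> 'I_M},
  ribbon_ok nx vx rp pr /\ s \in ribbon_near nx vx rp pr h.
Proof.
have [f fP] := ex_pairing.
exists ex_nx, ex_vx, ex_rp, [ffun j => f j]; split.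
  split=> [|||||||i ri].
  - exact: ex_nx_inj.
  - exact: ex_rp_nx.
  - exact: ex_rpK.
  - exact: ex_nx_reach.
  - exact: ex_vx_odd.
  - exact: ex_edgeK.
  - exact: ex_edge_neq.
  have := fP i; rewrite !inE ri eqxx !ffunE => /(_ isT)[/eqP e1 e2 e3 _].
  by split=> //; rewrite -[RHS]e1 ffunE.
rewrite inE; apply/asboolP.
pose R x := ~~ touched h B x.
pose D := [set be j | j in [set j | ex_rp j == j]].
pose bs x := if [pick i | fconnect h (be i) x] is Some i then be (ex_rp i) else b0.
pose pi b := be (f (idx b)).
have Rh x : R (h x) = R x by rewrite /R touched_h.
have Rs x : R x -> R (s x) by exact: (untouched_s sK tB tK).
have hsh x : R x -> h (s (h x)) = s x by exact: (untouched_hsh sK tK).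
have hs x : R x -> h (s x) != x by exact: (untouched_hs sK tF).
have bsP x : ~~ R x -> bs x \in D /\ fconnect h (bs x) x.
  rewrite /R negbK => /existsP[b /andP[bB bx]]; rewrite /bs; case: pickP => [i ix|/(_ (idx b))].
    split; last exact: connect_trans (rp_conn i) ix.
    by apply/imsetP; exists (ex_rp i) => //; rewrite inE ex_rpK.
  by rewrite idxK // bx.
have bsh x : bs (h x) = bs x.
  by rewrite /bs; congr (if _ is Some i then _ else _); apply: eq_pick => i; rewrite -same_fconnect1_r.
have bsD b : b \in D -> bs b = b.
  move=> /imsetP[j]; rewrite inE => /eqP rj ->; rewrite /bs; case: pickP => [i /rp_eq ->|/(_ j)].
    by rewrite rj.
  by rewrite connect0.
have DR b : b \in D -> ~~ R b.
  by move=> /imsetP[j _ ->]; rewrite /R negbK touched_B.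
have piP b : b \in D -> [/\ pi b \in D, pi (pi b) = b, pi b != b
    & fingraph.order h (pi b) = fingraph.order h b].
  move=> /imsetP[j jJ ->]; have [f1 f2 f3 f4] := fP j jJ; rewrite /pi !beK f2 f4 (inj_eq beI).
  by split=> //; apply: imset_f.
have r0K := reglueK Rh Rs (fun x _ => sK x) (fun x nR => (bsP x nR).1)
  (fun x nR => (bsP x nR).2) bsh bsD DR piP.
have r0F := reglue_fpf Rh (fun x _ => sF x) (fun x nR => (bsP x nR).1)
  (fun x nR => (bsP x nR).2) bsh bsD DR piP.
have r0h := h_reglue_neq Rh hs (fun x nR => (bsP x nR).1)
  (fun x nR => (bsP x nR).2) bsh bsD DR piP.
have r0hh := h_reglue_h Rh hsh (fun x nR => (bsP x nR).1)
  (fun x nR => (bsP x nR).2) bsh bsD DR piP.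
set r0 := reglue h s R bs pi in r0K r0F r0h r0hh.
pose s' : {perm T} := perm (can_inj r0K).
have s'E x : s' x = r0 x by rewrite permE.
exists s', be, (fun i => gap h B (be i)), ex_pos; split.
- by move=> i; rewrite be_edge (gap_opp sK tB tK).
- move=> i; have [g0 gL _ _] := gapP h (beB i); rewrite g0 /=.
  by apply: leq_trans gL _; apply: max_card.
- by move=> i; rewrite iter_findex // rp_conn.
- exact: ex_pos_rp.
- exact: ex_pos_nx.
- by move=> i k kg; rewrite (s_iter_opp sK tK) // be_edge.
- move=> x nx; rewrite s'E /r0 reglueR //; apply/negP => /touchedP[b bB [i ig e]].
  by apply: (nx (idx b) i); rewrite idxK.
- move=> i ri; have iJ : i \in [set j | ex_rp j == j] by rewrite inE ri.
  rewrite s'E /r0 (reglue_base s Rh bsh bsD DR piP) /pi ?beK ?ffunE //; exact: imset_f.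
rewrite inE; apply/andP; split; apply/fpf_permP; split=> x; rewrite ?permM ?s'E //.
  by rewrite -[in LHS](r0hh (h^-1%g x)) permK permKV r0K.
apply/eqP => e; have := r0h x; rewrite -{1}e.
by rewrite r0K permKV eqxx.
Qed.

End Existence.

Lemma card_near_factors (T : finType) (M : nat) (h : {perm T}) :
  0 < M -> fpf_factors h != set0 ->
  #|near_factors M h| * #|T| <= (M ^ M) ^ 4 * (3 * #|T|) ^ M./2 * #|fpf_factors h|.
Proof.
move=> M0 /set0Pn[a aA]; have [->|[s0 _]] := set_0Vmem (near_factors M h).
  by rewrite cards0.
case cT : #|T| => [|n']; first by rewrite muln0.
pose X := {ffun 'I_M -> 'I_M}.
pose N (q : X * X * X * X) := ribbon_near q.1.1.1 q.1.1.2 q.1.2 q.2 h.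
pose P (q : X * X * X * X) := `[< ribbon_ok q.1.1.1 q.1.1.2 q.1.2 q.2 >].
have cov : near_factors M h \subset \bigcup_(q | P q) N q.
  apply/subsetP => s; rewrite inE => /andP[/fpf_permP[sK sF] /andP[/eqP cB /forallP tP]].
  have tK x : x \notin odd_support (h^-1 * s)%g -> (h^-1 * s)%g ((h^-1 * s)%g x) = x.
    by move=> xB; have := tP x; rewrite !inE in xB *; rewrite xB => /andP[/eqP].
  have tF x : x \notin odd_support (h^-1 * s)%g -> (h^-1 * s)%g x != x.
    by move=> xB; have := tP x; rewrite !inE in xB *; rewrite xB => /andP[].
  have /card_gt0P[b0 b0B] : 0 < #|odd_support (h^-1 * s)%g| by rewrite cB.
  have [nx [vx [rp [pr [ok sN]]]]] := near_realizes aA sK sF tK tF b0B.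
  move: (#|_|) cB nx vx rp pr ok sN => M' e; subst M' => nx vx rp pr ok sN.
  by apply/bigcupP; exists (nx, vx, rp, pr); [apply/asboolP|].
have le1 : #|near_factors M h| <= \sum_(q | P q) #|N q|.
  apply: leq_trans (subset_leq_card cov) _.
  elim/big_rec2: _ => [|q m U _ le]; first by rewrite cards0.
  by apply: leq_trans (leq_card_setU _ _) _; rewrite leq_add2l.
apply: leq_trans (leq_mul le1 (leqnn _)) _; rewrite big_distrl /=.
apply: (@leq_trans (\sum_(q | P q) #|fpf_factors h| * (3 * n'.+1) ^ M./2)).
  by apply: leq_sum => q /asboolP ok; apply: card_ribbon_near.
rewrite sum_nat_const -mulnA [X in _ <= _ * X]mulnC leq_mul2r; apply/orP; right.
apply: leq_trans (max_card _) _.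
by rewrite !card_prod !card_ffun !card_ord !expnS expn0 muln1 !mulnA.
Qed.

(** * Specht modules *)

Lemma card_inj_lt (T : finType) (S : {set T}) (f : T -> nat) m :
  {in S &, injective f} -> (forall x, x \in S -> f x < m) -> #|S| <= m.
Proof.
move=> fI fm; case: m fm => [|m] fm.
  by rewrite leqn0 cards_eq0; apply/set0Pn => -[x /fm].
rewrite -[m.+1]card_ord.
apply: (@leq_card_in _ _ (fun x => inord (f x))) => x y xS yS /(congr1 val).
by rewrite /= !inordK ?fm //; apply: fI.
Qed.

Lemma sum_inj_ge (T : finType) (S : {set T}) (f : T -> nat) :
  {in S &, injective f} ->
  \sum_(j < #|S|) j <= \sum_(x in S) f x /\
  (\sum_(j < #|S|) j = \sum_(x in S) f x -> forall x, x \in S -> f x < #|S|).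
Proof.
move cS: #|S| => m; elim: m S cS => [|m IH] S cS fI.
  split=> [|_ x xS]; first by rewrite big_ord0.
  by move/cards0_eq: cS xS => ->; rewrite inE.
have /set0Pn[x0 x0S] : S != set0 by rewrite -cards_eq0 cS.
have [x xS xmax] : exists2 x, x \in S & forall y, y \in S -> f y <= f x.
  by case: (arg_maxnP f x0S) => x xS h; exists x.
have fx : m <= f x.
  by rewrite -ltnS -cS; apply: (card_inj_lt fI) => y /xmax; rewrite ltnS.
have cS' : #|S :\ x| = m by move: (cardsD1 x S); rewrite xS cS => -[].
have [|le _] := IH _ cS'.
  by move=> y z /setD1P[_ yS] /setD1P[_ zS]; apply: fI.
rewrite big_ord_recr /= (big_setD1 x xS) /=; split; first by (rewrite addnC; exact: leq_add).
move=> e y yS; rewrite ltnS (leq_trans (xmax y yS)) //.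
by rewrite -(leq_add2r (\sum_(i in S :\ x) f i)) -e addnC leq_add2l.
Qed.

Section Tableau.
Variables (n : nat) (la : seq nat).
Hypothesis laP : is_partition_of n la.
Local Notation row := (@tab_row n la).
Local Notation col := (@tab_col n la).

Lemma sumn_la : sumn la = n.
Proof. by case/andP: laP => _ /eqP. Qed.

Lemma tab_row_size k : row k < size la.
Proof. by apply: reshape_indexP; rewrite sumn_la. Qed.

Lemma tab_col_lt k : col k < nth 0 la (row k).
Proof. by apply: reshape_offsetP; rewrite sumn_la. Qed.

Lemma tab_col_ltn k : col k < n.
Proof. by apply: leq_ltn_trans (ltn_ord k); apply: leq_subr. Qed.

Lemma tab_inj k k' : row k = row k' -> col k = col k' -> k = k'.
Proof.
move=> er ec; apply: val_inj; rewrite /= -(reshape_indexK la k).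
by rewrite -(reshape_indexK la k'); congr flatten_index.
Qed.

Lemma tab_cell r c : c < nth 0 la r -> exists2 k, row k = r & col k = c.
Proof.
move=> h; have lt := flatten_indexP h; rewrite sumn_la in lt.
exists (Ordinal lt); [exact: flatten_indexKl | exact: flatten_indexKr].
Qed.

Lemma nth_part_mono i j : i <= j -> nth 0 la j <= nth 0 la i.
Proof.
case/andP: laP => /andP[so _] _ ij.
have [jl|jl] := ltnP j (size la); last by rewrite nth_default.
have geqT : transitive geq by move=> a b c /= ba ac; apply: leq_trans ba.
by apply: (sorted_leq_nth geqT leqnn 0 so); rewrite ?inE // (leq_ltn_trans ij).
Qed.

Definition tab_colset c := [set k | col k == c].

Lemma tab_row_inj_col c : {in tab_colset c &, injective row}.
Proof.
by move=> k k'; rewrite !inE => /eqP ck /eqP ck' e; apply: tab_inj; rewrite // ck ck'.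
Qed.

Lemma tab_row_lt_colset k : row k < #|tab_colset (col k)|.
Proof.
have ex (r : 'I_(row k).+1) : {k' | (row k' == r) && (col k' == col k)}.
  apply: sigW; have [|k' e e'] := @tab_cell r (col k); last first.
    by exists k'; rewrite e e' !eqxx.
  apply: leq_trans (tab_col_lt k) _; apply: nth_part_mono.
  by rewrite -ltnS.
rewrite -[(row k).+1]card_ord -(@card_imset _ _ (fun r => sval (ex r))).
  apply/subset_leq_card/subsetP => _ /imsetP[r _ ->].
  by rewrite inE; case: (ex r) => k' /= /andP[].
move=> r r'; case: (ex r) => a /= /andP[/eqP ar _].
case: (ex r') => b /= /andP[/eqP br _] e; by apply: val_inj; rewrite /= -ar e.
Qed.

Lemma tab_colset_cell c r :
  r < #|tab_colset c| -> exists2 k, row k = r & col k = c.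
Proof.
set m := #|_| => rm.
have h k : k \in tab_colset c -> row k < m.
  by move=> kc; have := tab_row_lt_colset k; move: (kc); rewrite inE => /eqP ->.
pose g k : 'I_m := insubd (Ordinal rm) (row k).
have gI : {in tab_colset c &, injective g}.
  move=> x y xc yc /(congr1 val); rewrite !val_insubd !h //.
  by move=> e; apply: (tab_row_inj_col xc yc).
have : Ordinal rm \in [set g k | k in tab_colset c].
  suff -> : [set g k | k in tab_colset c] = [set: 'I_m] by rewrite inE.
  by apply/eqP; rewrite eqEcard subsetT cardsT card_ord card_in_imset //=.
case/imsetP => k kc /(congr1 val); rewrite val_insubd h //= => ->; exists k => //.
by apply/eqP; move: kc; rewrite inE.
Qed.

Lemma sum_tab_col (F : 'I_n -> nat) :
  \sum_k F k = \sum_(c < n) \sum_(k in tab_colset c) F k.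
Proof.
rewrite (partition_big (fun k => Ordinal (tab_col_ltn k)) predT) //=.
by apply: eq_bigr => c _; apply: eq_bigl => k; rewrite inE -val_eqE.
Qed.

Lemma tab_fill (f : 'I_n -> nat) :
  (forall k k', col k = col k' -> f k = f k' -> k = k') ->
  \sum_k row k <= \sum_k f k /\
  (\sum_k row k = \sum_k f k ->
     exists2 q, q \in col_group n la & forall k, f k = row (q k)).
Proof.
move=> fI; have fI' c : {in tab_colset c &, injective f}.
  by move=> x y; rewrite !inE => /eqP xc /eqP yc; apply: fI; rewrite xc yc.
have rE c : \sum_(k in tab_colset c) row k = \sum_(j < #|tab_colset c|) j.
  set m := #|_|.
  case: (posnP m) => [m0|m0].
    by move/cards0_eq: (m0) => ->; rewrite big_set0 m0 big_ord0.
  have h k : k \in tab_colset c -> row k < m.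
    by move=> kc; have := tab_row_lt_colset k; move: (kc); rewrite inE => /eqP ->.
  pose g k : 'I_m := insubd (Ordinal m0) (row k).
  have gI : {in tab_colset c &, injective g}.
    move=> x y xc yc /(congr1 val); rewrite !val_insubd !h //.
    by move=> e; apply: (tab_row_inj_col xc yc).
  have -> : \sum_(j < m) j = \sum_(j in [set g k | k in tab_colset c]) (j : nat).
    apply: eq_bigl => j; suff -> : [set g k | k in tab_colset c] = [set: 'I_m] by rewrite inE.
    by apply/eqP; rewrite eqEcard subsetT cardsT card_ord card_in_imset //=.
  rewrite big_imset //=; apply: eq_bigr => k kc; by rewrite val_insubd h.
have le c : \sum_(k in tab_colset c) row k <= \sum_(k in tab_colset c) f k.
  by rewrite rE; case: (sum_inj_ge (fI' c)).
rewrite (sum_tab_col row) (sum_tab_col f); split=> [|e]; first exact: leq_sum.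
have ec (c : 'I_n) : \sum_(k in tab_colset c) row k = \sum_(k in tab_colset c) f k.
  have := @leqif_sum _ (xpredT : pred 'I_n) _ _ _ (fun i _ => leqif_eq (le (val i))).
  by case=> _ /=; rewrite e eqxx => /esym/forall_inP/(_ c isT)/eqP.
have flt k : f k < #|tab_colset (col k)|.
  have [_] := sum_inj_ge (fI' (col k)); rewrite -rE (ec (Ordinal (tab_col_ltn k))).
  by move=> /(_ erefl) h; apply: h; rewrite inE.
have ex k : {k' | (row k' == f k) && (col k' == col k)}.
  by apply: sigW; have [k' e1 e2] := tab_colset_cell (flt k); exists k'; rewrite e1 e2 !eqxx.
pose q0 k := sval (ex k).
have q0P k : row (q0 k) = f k /\ col (q0 k) = col k.
  by rewrite /q0; case: (ex k) => /= k' /andP[/eqP-> /eqP->].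
have qI : injective q0.
  move=> k k' e0; have [r1 c1] := q0P k; have [r2 c2] := q0P k'.
  by apply: fI; rewrite -?c1 -?c2 -?r1 -?r2 e0.
exists (perm qI); last by move=> k; rewrite permE; case: (q0P k).
by rewrite inE; apply/forallP => k; rewrite permE; case: (q0P k) => _ ->.
Qed.

Lemma row_col_group_trivial p :
  p \in row_group n la -> p \in col_group n la -> p = 1%g.
Proof.
rewrite !inE => /forallP r /forallP c; apply/permP => k; rewrite perm1.
by apply: tab_inj; apply/eqP.
Qed.

Lemma tab_row_fiber (i : nat) : #|[set k | row k == i]| = nth 0 la i.
Proof.
have [il|il] := ltnP i (size la); last first.
  rewrite nth_default // (_ : [set k | _] = set0) ?cards0 //; apply/setP => k.
  by rewrite !inE; apply/negP => /eqP e; have := tab_row_size k; rewrite e ltnNge il.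
apply/eqP; rewrite eqn_leq; apply/andP; split.
  apply: (@card_inj_lt _ _ col) => [k k'|k]; rewrite !inE => /eqP rk.
    by move=> /eqP rk' ce; apply: tab_inj; rewrite // rk.
  by have := tab_col_lt k; rewrite rk.
have ex (c : 'I_(nth 0 la i)) : {k | (row k == i) && (col k == c)}.
  by apply: sigW; have [k' e1 e2] := tab_cell (ltn_ord c); exists k'; rewrite e1 e2 !eqxx.
rewrite -[nth 0 la i]card_ord -(@card_imset _ _ (fun c => sval (ex c))).
  apply/subset_leq_card/subsetP => _ /imsetP[c _ ->].
  by rewrite inE; case: (ex c) => k' /= /andP[].
move=> r r'; case: (ex r) => a /= /andP[_ /eqP ar].
case: (ex r') => b /= /andP[_ /eqP br] e; by apply: val_inj; rewrite /= -ar e.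
Qed.

End Tableau.

Local Open Scope ring_scope.

Lemma mxtrace_sq0 (F : fieldType) n (L : 'M[F]_n) : L *m L = 0 -> \tr L = 0.
Proof.
move=> L0; rewrite -[L]mulmx_base mxtrace_mulC.
suff -> : row_base L *m col_base L = 0 by rewrite mxtrace0.
apply: (row_full_inj (col_base_full L)); rewrite mulmx0.
apply: (row_free_inj (row_base_free L)); rewrite mul0mx.
by rewrite mulmxA mulmx_base -mulmxA mulmx_base.
Qed.

Lemma mxtrace_submod_repr (F : fieldType) (gT : finGroupType) (G : {group gT})
    n (rG : mx_representation F G n) (U L : 'M[F]_n) (Umod : mxmodule rG U)
    (k : F) g :
  (L :=: U)%MS -> L *m L = k *: L -> k != 0 -> g \in G ->
  \tr (submod_repr Umod g) = k^-1 * \tr (L *m rG g).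
Proof.
move=> LU LL k0 Gg.
pose B := val_submod (1%:M : 'M_(\rank U)).
have BU : (B :=: U)%MS by apply: val_submod1.
have [X LX] : exists X, L = X *m B by apply/submxP; rewrite LU BU.
have [Y BY] : exists Y, B = Y *m L by apply/submxP; rewrite LU BU.
have BL : B *m L = k *: B by rewrite BY -mulmxA LL -scalemxAr.
have BX : B *m X = k%:M.
  apply: (@val_submod_inj _ _ U); rewrite val_submodE -/B -mulmxA -LX BL.
  by rewrite [RHS]val_submodE -/B mul_scalar_mx.
have SB : B *m rG g = submod_repr Umod g *m B.
  by rewrite -[RHS]val_submodE -[submod_repr Umod g]mul1mx val_submodJ.
have -> : \tr (L *m rG g) = \tr (submod_repr Umod g *m k%:M).
  by rewrite LX -(mulmxA X B) (mxtrace_mulC X) SB -(mulmxA _ B X) BX.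
by rewrite mul_mx_scalar mxtraceZ mulrA mulVf // mul1r.
Qed.

Section Specht.
Variables (n : nat) (la : seq nat).
Hypothesis laP : is_partition_of n la.
Local Notation row := (@tab_row n la).
Local Notation col := (@tab_col n la).
Local Notation R := (row_group n la).
Local Notation C := (col_group n la).
Local Notation G := (symS n).
Local Notation aG := (regular_repr algC (symS n)).
Local Notation sg q := ((-1) ^+ (odd_perm q) : algC).

Lemma row_groupP (p : 'S_n) : reflect (forall k, row (p k) = row k) (p \in R).
Proof. by rewrite inE; apply: (iffP forallP) => h k; apply/eqP. Qed.

Lemma col_groupP (p : 'S_n) : reflect (forall k, col (p k) = col k) (p \in C).
Proof. by rewrite inE; apply: (iffP forallP) => h k; apply/eqP. Qed.

Lemma row_groupM p q : p \in R -> q \in R -> (p * q)%g \in R.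
Proof. by move=> /row_groupP hp /row_groupP hq; apply/row_groupP => k; rewrite permM hq. Qed.

Lemma col_groupM p q : p \in C -> q \in C -> (p * q)%g \in C.
Proof. by move=> /col_groupP hp /col_groupP hq; apply/col_groupP => k; rewrite permM hq. Qed.

Lemma row_groupV p : p \in R -> (p^-1)%g \in R.
Proof. by move=> /row_groupP hp; apply/row_groupP => k; rewrite -{2}(permKV p k) hp. Qed.

Lemma col_groupV p : p \in C -> (p^-1)%g \in C.
Proof. by move=> /col_groupP hp; apply/col_groupP => k; rewrite -{2}(permKV p k) hp. Qed.

Lemma row_group1 : 1%g \in R.
Proof. by apply/row_groupP => k; rewrite perm1. Qed.

Lemma col_group1 : 1%g \in C.
Proof. by apply/col_groupP => k; rewrite perm1. Qed.

Lemma tperm_col a b : col a = col b -> tperm a b \in C.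
Proof. by move=> e; apply/col_groupP => k; case: tpermP => [->|->|]. Qed.

Lemma tperm_row a b : row a = row b -> tperm a b \in R.
Proof. by move=> e; apply/row_groupP => k; case: tpermP => [->|->|]. Qed.

Lemma signM (p q : 'S_n) : sg (p * q)%g = sg p * sg q.
Proof. by rewrite odd_permM signr_addb. Qed.

Lemma signK (p : 'S_n) : sg p * sg p = 1.
Proof. by rewrite -signr_addb addbb. Qed.

Definition row_sum : 'M[algC]_#|G| := \sum_(p in R) aG p.
Definition col_sum : 'M[algC]_#|G| := \sum_(q in C) sg q *: aG q.
Definition young_mx := row_sum *m col_sum.
Local Notation A := young_mx.

Definition young_coef (x : 'S_n) : algC :=
  \sum_(p in R) \sum_(q in C) sg q * (p * q == x)%g%:R.
Local Notation c := young_coef.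

Lemma aGM x y : aG x *m aG y = aG (x * y)%g.
Proof. by rewrite repr_mxM ?inE. Qed.

Lemma young_mxE : A = \sum_x c x *: aG x.
Proof.
rewrite /young_mx mulmx_suml.
transitivity (\sum_(p in R) \sum_(q in C) sg q *: aG (p * q)%g).
  apply: eq_bigr => p _; rewrite mulmx_sumr; apply: eq_bigr => q _.
  by rewrite -scalemxAr aGM.
transitivity (\sum_x \sum_(p in R) \sum_(q in C) (sg q * (p * q == x)%g%:R) *: aG x);
  last first.
  apply: eq_bigr => x _; rewrite scaler_suml; apply: eq_bigr => p _.
  by rewrite scaler_suml.
rewrite [RHS]exchange_big /=; apply: eq_bigr => p _.
rewrite [RHS]exchange_big /=; apply: eq_bigr => q _.
rewrite (bigD1 (p * q)%g) //= eqxx mulr1 big1 ?addr0 // => x.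
by rewrite eq_sym => /negPf->; rewrite mulr0 scale0r.
Qed.

Lemma young_symmetrizerE : young_symmetrizer n la = gring_row A.
Proof.
rewrite /young_symmetrizer /young_mx mulmx_suml linear_sum /=.
apply: eq_bigr => p _; rewrite mulmx_sumr linear_sum /=; apply: eq_bigr => q _.
by rewrite -scalemxAr aGM linearZ.
Qed.

Lemma row_sumM p : p \in R -> row_sum *m aG p = row_sum.
Proof.
move=> pR; rewrite /row_sum mulmx_suml [RHS](reindex_inj (mulIg p)) /=.
apply: eq_big => [q|q _]; last by rewrite aGM.
apply/idP/idP => h; first exact: row_groupM.
by rewrite -[q](mulgK p) row_groupM ?row_groupV.
Qed.

Lemma col_sumM q : q \in C -> aG q *m col_sum = sg q *: col_sum.
Proof.
move=> qC; rewrite /col_sum mulmx_sumr [in RHS](reindex_inj (mulgI q)) /= scaler_sumr.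
apply: eq_big => [p|p _].
  apply/idP/idP => h; first exact: col_groupM.
  by rewrite -[p](mulKg q) col_groupM ?col_groupV.
by rewrite -scalemxAr aGM scalerA signM mulrA signK mul1r.
Qed.

(* von Neumann's lemma *)
Lemma young_sandwich y : exists k, row_sum *m aG y *m col_sum = k *: A.
Proof.
have [/existsP[a /existsP[b /and3P[nab /eqP cab /eqP rab]]]|h] :=
    boolP [exists a, exists b, [&& a != b, col a == col b
                                 & row ((y^-1)%g a) == row ((y^-1)%g b)]].
  exists 0; rewrite scale0r.
  set M := (X in X = _); suff /eqP : M = - M.
    by rewrite -addr_eq0 -mulr2n -scaler_nat scaler_eq0 pnatr_eq0 => /eqP.
  have tE : (tperm ((y^-1)%g a) ((y^-1)%g b) * y = y * tperm a b)%g.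
    by rewrite -tpermJ conjgE invgK mulgA mulgKV.
  rewrite {1}/M -(row_sumM (tperm_row rab)) -(mulmxA row_sum) aGM tE.
  rewrite -aGM mulmxA -[X in X = _]mulmxA (col_sumM (tperm_col cab)).
  by rewrite odd_tperm nab expr1 scaleN1r mulmxN.
have fI a b : col a = col b -> row ((y^-1)%g a) = row ((y^-1)%g b) -> a = b.
  move=> cab rab; apply/eqP; apply: contraNT h => nab.
  by apply/existsP; exists a; apply/existsP; exists b; rewrite nab cab rab !eqxx.
have [_] := tab_fill laP fI; rewrite [in X in X -> _](reindex_inj (@perm_inj _ y^-1%g)) /=.
case=> // q qC yq.
have pR : (q^-1 * y^-1)%g \in R.
  by apply/row_groupP => k; rewrite permM yq permKV.
have -> : y = ((q^-1 * y^-1)^-1 * q^-1)%g by rewrite invMg !invgK mulgK.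
rewrite -aGM mulmxA row_sumM ?row_groupV // -mulmxA col_sumM ?col_groupV //.
by rewrite -scalemxAr; eexists.
Qed.

Definition coef1 (M : 'M[algC]_#|G|) : algC := M (gring_index G 1%g) (gring_index G 1%g).

Lemma gring_index_inj (x y : 'S_n) : gring_index G x = gring_index G y -> x = y.
Proof. by move/(congr1 enum_val); rewrite !gring_indexK ?inE. Qed.

Lemma aG_entry x y z : aG x (gring_index G y) (gring_index G z) = (y * x == z)%g%:R.
Proof.
rewrite mxE gring_indexK ?inE // mxE eqxx /= eq_sym.
by case: (y * x =P z)%g => [->|ne]; rewrite ?eqxx //; case: eqP => // /gring_index_inj.
Qed.

Lemma young_mx_entry x y : A (gring_index G x) (gring_index G y) = c (x^-1 * y)%g.
Proof.
rewrite young_mxE summxE (bigD1 (x^-1 * y)%g) //= mxE aG_entry mulKVg eqxx mulr1.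
rewrite big1 ?addr0 // => z zn; rewrite mxE aG_entry.
by case: ((x * z)%g =P y) zn => [<-|_]; rewrite ?mulKg ?eqxx ?mulr0.
Qed.

Lemma young_coef1 : c 1%g = 1.
Proof.
rewrite /young_coef (bigD1 1%g) ?row_group1 //= (bigD1 1%g) ?col_group1 //=.
rewrite mulg1 eqxx odd_perm1 mulr1 !big1 ?addr0 // => [p /andP[pR p1]|q /andP[qC q1]].
  rewrite big1 // => q qC; case: eqP => [e|]; rewrite ?mulr0 //.
  case/negP: p1; apply/eqP/(@row_col_group_trivial n la) => //.
  by rewrite (_ : p = q^-1)%g ?col_groupV //; apply/eqP; rewrite eq_mulgV1 invgK e.
by rewrite mul1g (negPf q1) mulr0.
Qed.

Lemma coef1_young_mx : coef1 A = 1.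
Proof. by rewrite /coef1 young_mx_entry mulVg young_coef1. Qed.

Lemma young_mx_sandwich x : A *m aG x *m A = coef1 (A *m aG x *m A) *: A.
Proof.
suff [k ->] : exists k, A *m aG x *m A = k *: A.
  by congr (_ *: _); rewrite /coef1 mxE -/(coef1 A) coef1_young_mx mulr1.
have [k hk] := choice young_sandwich.
exists (\sum_(q in C) \sum_(p in R) sg q * k (q * x * p)%g).
have gen (X Y : 'M_#|G|) : X *m (col_sum *m aG x *m row_sum) *m Y =
    \sum_(q in C) \sum_(p in R) sg q *: (X *m aG (q * x * p)%g *m Y).
  rewrite /col_sum !mulmx_suml mulmx_sumr mulmx_suml; apply: eq_bigr => q _.
  rewrite /row_sum mulmx_sumr mulmx_sumr mulmx_suml; apply: eq_bigr => p _.
  by rewrite -!scalemxAl -scalemxAr -scalemxAl !aGM.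
have -> : A *m aG x *m A = row_sum *m (col_sum *m aG x *m row_sum) *m col_sum.
  by rewrite /young_mx !mulmxA.
rewrite gen.
rewrite scaler_suml; apply: eq_bigr => q _; rewrite scaler_suml.
by apply: eq_bigr => p _; rewrite hk scalerA.
Qed.

Definition young_kappa : algC :=
  \sum_(q in C) \sum_(p in R) \sum_(q' in C) sg (q * q')%g * (q * p * q' \in R)%g%:R.
Local Notation kappa := young_kappa.

Lemma young_mx_sq : A *m A = kappa *: A.
Proof.
have := young_mx_sandwich 1; rewrite repr_mx1 mulmx1 => ->; congr (_ *: _).
have cE x : coef1 (aG x) = (x == 1%g)%:R by rewrite /coef1 aG_entry mul1g.
have -> : A *m A = \sum_(q in C) \sum_(p in R) \sum_(q' in C) \sum_(p0 in R)
    sg (q * q')%g *: aG (p0 * (q * p * q'))%g.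
  have gen (X Y : 'M_#|G|) : X *m (col_sum *m row_sum *m Y) =
      \sum_(q in C) \sum_(p in R) sg q *: (X *m aG (q * p)%g *m Y).
    rewrite /col_sum !mulmx_suml mulmx_sumr; apply: eq_bigr => q _.
    rewrite /row_sum mulmx_sumr mulmx_suml mulmx_sumr; apply: eq_bigr => p _.
    by rewrite -!scalemxAl -scalemxAr aGM mulmxA.
  have -> : A *m A = row_sum *m (col_sum *m row_sum *m col_sum).
    by rewrite /young_mx !mulmxA.
  rewrite gen; apply: eq_bigr => q _; apply: eq_bigr => p _.
  rewrite /col_sum mulmx_sumr scaler_sumr; apply: eq_bigr => q' _.
  rewrite /row_sum !mulmx_suml !scaler_sumr; apply: eq_bigr => p0 _.
  by rewrite -scalemxAr scalerA -signM !aGM !mulgA.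
rewrite /coef1 summxE; apply: eq_bigr => q _; rewrite summxE; apply: eq_bigr => p _.
rewrite summxE; apply: eq_bigr => q' _; rewrite summxE.
have [h|h] := boolP ((q * p * q')%g \in R).
  rewrite (bigD1 (q * p * q')^-1%g) ?row_groupV //= mxE -/(coef1 _) cE mulVg eqxx.
  rewrite mulr1 big1 ?addr0 // => p0 /andP[_ ne]; rewrite mxE -/(coef1 _) cE.
  case: eqP => [e|]; rewrite ?mulr0 //; case/eqP: ne.
  by apply: (mulIg (q * p * q')%g); rewrite e mulVg.
rewrite mulr0 big1 // => p0 p0R; rewrite mxE -/(coef1 _) cE.
case: eqP => [e|]; rewrite ?mulr0 //; case/negP: h.
rewrite (_ : (q * p * q')%g = (p0^-1)%g) ?row_groupV //.
by apply: (mulgI p0); rewrite e mulgV.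
Qed.

(* Left multiplication by the Young symmetrizer: [kappa] times a projection onto
   the Specht module. *)
Definition young_left : 'M[algC]_#|G| :=
  \matrix_i (young_symmetrizer n la *m aG (enum_val i)).
Local Notation L := young_left.

Lemma row_young_left x : gring_row (aG x) *m L = young_symmetrizer n la *m aG x.
Proof. by rewrite /gring_row rowK gring_indexK ?inE // mul1g -rowE rowK gring_indexK ?inE. Qed.

Lemma young_left_entry x y : L (gring_index G x) (gring_index G y) = c (y * x^-1)%g.
Proof.
rewrite mxE gring_indexK ?inE // young_symmetrizerE -gring_row_mul mxE.
rewrite young_mxE mulmx_suml summxE (bigD1 (y * x^-1)%g) //= -scalemxAl aGM mulgKV.
rewrite mxE aG_entry mul1g eqxx mulr1 big1 ?addr0 // => z zn.
rewrite -scalemxAl aGM mxE aG_entry mul1g.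
by case: ((z * x)%g =P y) zn => [<-|_]; rewrite ?mulgK ?eqxx ?mulr0.
Qed.

Lemma young_left_mul M : 
   L *m M = \matrix_i (gring_row (A *m aG (enum_val i) *m M)).
Proof.
apply/row_matrixP => i; rewrite row_mul rowK rowK young_symmetrizerE.
by rewrite -gring_row_mul -gring_row_mul.
Qed.

Lemma gring_row_young_left (a : 'S_n -> algC) :
  gring_row (\sum_x a x *: aG x) *m L = gring_row (A *m (\sum_x a x *: aG x)).
Proof.
rewrite linear_sum mulmx_suml mulmx_sumr linear_sum; apply: eq_bigr => x _.
by rewrite linearZ -scalemxAl row_young_left young_symmetrizerE -gring_row_mul -scalemxAr linearZ.
Qed.

Lemma young_left_sq : L *m L = kappa *: L.
Proof.
apply/row_matrixP => i; rewrite row_mul rowK linearZ /= rowK young_symmetrizerE.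
rewrite -gring_row_mul.
have -> : A *m aG (enum_val i) = \sum_x c (x * (enum_val i)^-1)%g *: aG x.
  rewrite {1}young_mxE mulmx_suml (reindex_inj (mulIg (enum_val i)^-1%g)) /=.
  by apply: eq_bigr => x _; rewrite -scalemxAl aGM mulgKV.
rewrite gring_row_young_left.
have <- : A *m aG (enum_val i) = \sum_x c (x * (enum_val i)^-1)%g *: aG x.
  rewrite {1}young_mxE mulmx_suml (reindex_inj (mulIg (enum_val i)^-1%g)) /=.
  by apply: eq_bigr => x _; rewrite -scalemxAl aGM mulgKV.
by rewrite mulmxA young_mx_sq -scalemxAl linearZ.
Qed.

Lemma mxtrace_gring (M : 'M[algC]_#|G|) :
  \tr M = \sum_x M (gring_index G x) (gring_index G x).
Proof.
rewrite /mxtrace (reindex (gring_index G)) /=; last first.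
  by apply: onW_bij; exists enum_val; [move=> x; rewrite gring_indexK ?inE|exact: gring_valK].
by [].
Qed.

Lemma young_kappa_neq0 : kappa != 0.
Proof.
apply/eqP => k0; have := mxtrace_sq0 (L := L); rewrite young_left_sq k0 scale0r.
move=> /(_ erefl); rewrite mxtrace_gring.
under eq_bigr => x _ do rewrite young_left_entry mulgV young_coef1.
rewrite sumr_const => /eqP; rewrite pnatr_eq0 => /eqP/card0_eq/(_ 1%g).
by rewrite inE.
Qed.

Lemma young_left_eqmx :
  (L :=: cyclic_mx aG (young_symmetrizer n la))%MS.
Proof.
apply/eqmxP/andP; split.
  apply/row_subP => i; rewrite rowK; apply/cyclic_mxP.
  exists (aG (enum_val i)); last by [].
  by apply: envelop_mx_id; rewrite inE.
apply/row_subP => i.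
have /cyclic_mxP[M /envelop_mxP[a ->] ->] := row_sub i (cyclic_mx aG (young_symmetrizer n la)).
rewrite mulmx_sumr; apply: summx_sub => x _; rewrite -scalemxAr.
by rewrite -row_young_left scalemx_sub // submxMl.
Qed.

Lemma chiS_tr g : chiS n la g = kappa^-1 * \tr (L *m aG g).
Proof.
rewrite /chiS cfunE inE mulr1n.
by rewrite (mxtrace_submod_repr _ young_left_eqmx young_left_sq young_kappa_neq0) ?inE.
Qed.

Lemma chiSE g : chiS n la g = kappa^-1 * \sum_x c (x * g^-1 * x^-1)%g.
Proof.
rewrite chiS_tr; congr (_ * _); rewrite mxtrace_gring; apply: eq_bigr => x _.
rewrite mxE (bigD1 (gring_index G (x * g^-1))%g) //= young_left_entry.
rewrite aG_entry mulgKV eqxx mulr1 big1 ?addr0 // => i ne.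
rewrite -[i]gring_valK aG_entry; case: eqP => [e|]; rewrite ?mulr0 //.
by case/eqP: ne; rewrite -e mulgK gring_valK.
Qed.

Lemma sum_chiS (f : 'S_n -> algC) :
  (forall g x, f (x^-1 * g * x)%g = f g) ->
  \sum_g f g * chiS n la g = n`!%:R / kappa * \sum_g c g * f g^-1%g.
Proof.
move=> fJ; under eq_bigr => g _ do rewrite chiSE mulrCA.
rewrite -mulr_sumr -[n`!%:R / _]mulrC -mulrA; congr (_ * _).
under eq_bigr => g _ do rewrite mulr_sumr.
rewrite exchange_big /= -card_Sn -sum1_card natr_sum mulr_suml.
apply: eq_big => [x|x _]; first by rewrite inE.
rewrite mul1r (reindex_inj invg_inj) /=.
rewrite (reindex_inj (conjg_inj x)) /=.
apply: eq_bigr => g _; rewrite invgK -conjVg !conjgE mulgA fJ mulrC; congr (c _ * _).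
by rewrite !mulgA mulgV mul1g mulgK.
Qed.

Lemma chiSJ (g x : 'S_n) : chiS n la (x^-1 * g * x)%g = chiS n la g.
Proof. by rewrite -mulgA -conjgE cfunJ ?inE. Qed.

Lemma sum_chiS_norm : \sum_g chiS n la g * chiS n la g^-1%g = n`!%:R.
Proof.
under eq_bigr => g _ do rewrite mulrC.
rewrite (@sum_chiS (fun g => chiS n la g^-1%g)); last first.
  by move=> g x; rewrite -[RHS](chiSJ _ x) !invMg invgK mulgA.
suff -> : \sum_g c g * chiS n la (g^-1)^-1%g = kappa.
  by rewrite mulfVK ?young_kappa_neq0.
transitivity (kappa^-1 * \tr (L *m A)).
  rewrite young_mxE mulmx_sumr raddf_sum mulr_sumr; apply: eq_bigr => g _.
  by rewrite /= invgK chiS_tr mulrCA -scalemxAr mxtraceZ.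
suff -> : \tr (L *m A) = kappa * kappa by rewrite mulKf ?young_kappa_neq0.
have <- : coef1 (A *m A *m A) = kappa * kappa.
  rewrite young_mx_sq -scalemxAl young_mx_sq scalerA /coef1 mxE -/(coef1 _).
  by rewrite coef1_young_mx mulr1.
have -> : A *m A *m A = \sum_x c x *: (A *m aG x *m A).
  rewrite {2}young_mxE mulmx_sumr mulmx_suml; apply: eq_bigr => x _.
  by rewrite -scalemxAr -scalemxAl.
rewrite mxtrace_gring /coef1 summxE; apply: eq_bigr => x _; rewrite [RHS]mxE -/(coef1 _).
rewrite young_left_mul mxE gring_indexK ?inE // mxE {1}young_mx_sandwich mxE mulrC.
by rewrite young_mx_entry invg1 mul1g.
Qed.

End Specht.

(** * Frobenius' character formula *)

Lemma sum_mul_perm_lt k (w : 'S_k) : w != 1%g ->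
  (\sum_(i < k) i * w i < \sum_(i < k) i * i)%N.
Proof.
move=> w1.
have e2 : (\sum_(i < k) (w i) ^ 2 = \sum_(i < k) i * i)%N.
  by rewrite [RHS](reindex_inj (@perm_inj _ w)); apply: eq_bigr.
have e1 : (\sum_(i < k) i ^ 2 = \sum_(i < k) i * i)%N by apply: eq_bigr.
have [] := @leqif_sum _ (xpredT : pred 'I_k) _ _ _ (fun i _ => nat_Cauchy i (w i)).
rewrite -big_distrr big_split /= e1 e2 addnn -mul2n leq_mul2l eqn_mul2l /= => le eqf.
rewrite ltn_neqAle le andbT eqf.
apply: contra w1 => /forall_inP h; apply/eqP/permP => i; rewrite perm1.
by apply: val_inj; rewrite /= -(eqP (h i isT)).
Qed.

Definition fiber_card (X T : finType) (f : {ffun X -> T}) (t : T) : nat :=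
  #|[set x | f x == t]|.

Lemma sum_fiber_card (X T : finType) (f : {ffun X -> T}) (F : T -> nat) :
  (\sum_t F t * fiber_card f t = \sum_x F (f x))%N.
Proof.
rewrite [RHS](partition_big f predT) //=; apply: eq_bigr => t _.
rewrite /fiber_card -sum1_card big_distrr /=; by apply: eq_big => x; rewrite inE // => /eqP->; rewrite muln1.
Qed.

Definition staircase (k : nat) (i : 'I_k) : nat := (k.-1 - i)%N.

(* [alt_coef g v] is the coefficient of [x^g] in the product of [x^v] with the
   Vandermonde alternant, of leading monomial [x^staircase]. *)
Definition alt_coef (k : nat) (g v : 'I_k -> nat) : algC :=
  \sum_(w : 'S_k) (-1) ^+ odd_perm w * [forall i, g i == v i + staircase (w i)]%N%:R.

(* Frobenius' formula: the coefficient of [x^g] in the product of the alternant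
   with the power sums attached to the cycles of [s]. *)
Definition frob (n k : nat) (g : 'I_k -> nat) (s : 'S_n) : algC :=
  \sum_(f : {ffun 'I_n -> 'I_k} | [forall x, f (s x) == f x]) alt_coef g (fiber_card f).

Definition perm_char (n k : nat) (b : 'I_k -> nat) (s : 'S_n) : algC :=
  #|[set f : {ffun 'I_n -> 'I_k} | [forall x, f (s x) == f x]
                                & [forall i, fiber_card f i == b i]]|%:R.

Lemma fiber_card_perm n (T : finType) (f : {ffun 'I_n -> T}) (s : 'S_n) :
  fiber_card [ffun x => f (s x)] =1 fiber_card f.
Proof.
move=> t; rewrite /fiber_card -(card_preimset [set x | f x == t] (@perm_inj _ s)).
by apply: eq_card => x; rewrite !inE ffunE.
Qed.

Lemma perm_charE n k b (s : 'S_n) : @perm_char n k b s =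
  \sum_(f : {ffun 'I_n -> 'I_k} | [forall i, fiber_card f i == b i])
     [forall x, f (s x) == f x]%:R.
Proof.
rewrite /perm_char -sum1_card natr_sum big_mkcond [RHS]big_mkcond /=.
by apply: eq_bigr => f _; rewrite inE; do 2!case: [forall _, _].
Qed.

Lemma perm_charJ n k b (g x : 'S_n) :
  @perm_char n k b (x^-1 * g * x)%g = perm_char b g.
Proof.
rewrite !perm_charE (reindex_inj (h := fun f : {ffun 'I_n -> 'I_k} => [ffun y => f (x^-1%g y)])).
  apply: eq_big => [f|f _].
    by apply: eq_forallb => i; rewrite fiber_card_perm.
  congr ((nat_of_bool _)%:R); apply/forallP/forallP => h y.
    by have := h (x y); rewrite !ffunE !permM !permK.
  by rewrite !ffunE !permM permK; apply: h.
move=> f f' e; apply/ffunP => y; have := congr1 (fun h : {ffun 'I_n -> 'I_k} => h (x y)) e.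
by rewrite !ffunE permK.
Qed.

Lemma perm_charV n k b (g : 'S_n) : @perm_char n k b (g^-1)%g = perm_char b g.
Proof.
rewrite !perm_charE; apply: eq_bigr => f _; congr ((nat_of_bool _)%:R); apply/forallP/forallP => h y.
  by have := h (g y); rewrite permK eq_sym.
by have := h (g^-1%g y); rewrite permKV eq_sym.
Qed.

Lemma frobE n k g (s : 'S_n) : @frob n k g s =
  \sum_(w : 'S_k | [forall i, staircase (w i) <= g i]%N)
     (-1) ^+ odd_perm w * perm_char (fun i => g i - staircase (w i))%N s.
Proof.
rewrite /frob /alt_coef exchange_big /= [RHS]big_mkcond /=; apply: eq_bigr => w _.
case: ifPn => [/forallP le|].
  rewrite perm_charE mulr_sumr big_mkcond [RHS]big_mkcond /=; apply: eq_bigr => f _.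
  have -> : [forall i, fiber_card f i == (g i - staircase (w i))%N] =
            [forall i, g i == (fiber_card f i + staircase (w i))%N].
    by apply: eq_forallb => i; have := le i; lia.
  by do 2!case: [forall _, _]; rewrite ?mulr0.
rewrite negb_forall => /existsP[i]; rewrite -ltnNge => lt.
rewrite big1 // => f _; case: forallP => [/(_ i)/eqP e|]; rewrite ?mulr0 //.
by move: lt; rewrite e ltnNge leq_addl.
Qed.

Section FrobSpecht.
Variables (n : nat) (la : seq nat).
Hypothesis laP : is_partition_of n la.
Variable k : nat.
Hypothesis la_k : (size la <= k)%N.
Local Notation row := (@tab_row n la).
Local Notation col := (@tab_col n la).
Local Notation R := (row_group n la).
Local Notation C := (col_group n la).
Local Notation c := (@young_coef n la).
Local Notation kappa := (@young_kappa n la).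
Local Notation sg q := ((-1) ^+ (odd_perm q) : algC).

Definition stab_coef (f : {ffun 'I_n -> 'I_k}) : algC :=
  \sum_(p in R) \sum_(q in C) sg q * [forall x, f ((p * q)%g x) == f x]%:R.

Lemma sum_chiS_perm_char b :
  \sum_s perm_char b s * chiS n la s =
    n`!%:R / kappa * \sum_(f | [forall i, fiber_card f i == b i]) stab_coef f.
Proof.
rewrite (sum_chiS laP); last by move=> g x; apply: perm_charJ.
congr (_ * _); under eq_bigr => g _ do rewrite perm_charV perm_charE mulr_sumr.
rewrite exchange_big /=; apply: eq_bigr => f _.
rewrite /young_coef /stab_coef.
under eq_bigr => g _ do rewrite mulr_suml.
rewrite exchange_big /=; apply: eq_bigr => p _.
under eq_bigr => g _ do rewrite mulr_suml.
rewrite exchange_big /=; apply: eq_bigr => q _.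
rewrite (bigD1 (p * q)%g) //= eqxx mulr1 big1 ?addr0 // => g.
by rewrite eq_sym => /negPf->; rewrite mulr0 mul0r.
Qed.

Lemma stab_coef_eq0 (f : {ffun 'I_n -> 'I_k}) a b :
  a != b -> col a = col b -> f a = f b -> stab_coef f = 0.
Proof.
move=> nab cab fab; rewrite /stab_coef big1 // => p _.
set S := (X in X = _); suff /eqP : S = - S.
  by rewrite -addr_eq0 -mulr2n mulrn_eq0 => /eqP.
have tC := tperm_col cab.
rewrite {1}/S (reindex_inj (mulIg (tperm a b))) /= -sumrN; apply: eq_big => [q|q _].
  apply/idP/idP => h; last exact: col_groupM.
  by rewrite -(mulgK (tperm a b) q) col_groupM // col_groupV.
rewrite signM odd_tperm nab expr1 mulrN1 mulNr; congr (- (_ * (nat_of_bool _)%:R)).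
apply: eq_forallb => x; rewrite mulgA permM; congr (_ == _).
by case: tpermP => [->|->|].
Qed.

Lemma sum_row_nth : (\sum_x row x = \sum_(i < k) i * nth 0%N la i)%N.
Proof.
have lt x : (row x < k)%N by apply: leq_trans la_k; apply: tab_row_size.
pose f := [ffun x => Ordinal (lt x)].
transitivity (\sum_x val (f x))%N; first by apply: eq_bigr => x _; rewrite ffunE.
rewrite -(sum_fiber_card f val); apply: eq_bigr => i _; congr (_ * _)%N.
rewrite -(tab_row_fiber laP); apply: eq_card => x; rewrite !inE ffunE.
by rewrite -val_eqE.
Qed.

Lemma stab_coef_sum_lt (f : {ffun 'I_n -> 'I_k}) :
  (\sum_x f x < \sum_x row x)%N -> stab_coef f = 0.
Proof.
have [/existsP[a /existsP[b /and3P[nab /eqP cab /eqP fab]]] _|h lt] :=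
    boolP [exists a, exists b, [&& a != b, col a == col b & f a == f b]].
  exact: stab_coef_eq0 nab cab fab.
have [|le _] := tab_fill laP (f := fun x => f x); last by rewrite leqNgt lt in le.
move=> a b cab fab; apply/eqP; apply: contraNT h => nab.
by apply/existsP; exists a; apply/existsP; exists b; rewrite nab cab (val_inj fab) !eqxx.
Qed.

Lemma sum_stab_coef :
  \sum_(f : {ffun 'I_n -> 'I_k} | [forall i, fiber_card f i == nth 0%N la i]) stab_coef f
    = kappa.
Proof.
have lt x : (row x < k)%N by apply: leq_trans la_k; apply: tab_row_size.
pose F (q : 'S_n) := [ffun x => Ordinal (lt (q x))].
have FI : {in C &, injective F}.
  move=> q q' /col_groupP qC /col_groupP qC' e; apply/permP => x.
  apply: (@tab_inj n la); last by rewrite qC qC'.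
  by have := congr1 (fun h : {ffun 'I_n -> 'I_k} => val (h x)) e; rewrite !ffunE.
have FW q : [forall i, fiber_card (F q) i == nth 0%N la i].
  apply/forallP => i; rewrite -(tab_row_fiber laP).
  rewrite -(card_preimset [set x | row x == i] (@perm_inj _ q)); apply/eqP.
  by apply: eq_card => x; rewrite !inE ffunE -val_eqE.
rewrite (bigID (mem (F @: C))) /= [X in _ + X]big1 ?addr0; last first.
  move=> f /andP[/forallP fw fC].
  have [/existsP[a /existsP[b /and3P[nab /eqP cab /eqP fab]]]|h] :=
      boolP [exists a, exists b, [&& a != b, col a == col b & f a == f b]].
    exact: stab_coef_eq0 nab cab fab.
  have [|_] := tab_fill laP (f := fun x => f x).
    move=> a b cab fab; apply/eqP; apply: contraNT h => nab.
    by apply/existsP; exists a; apply/existsP; exists b; rewrite nab cab (val_inj fab) !eqxx.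
  case.
    rewrite sum_row_nth -(sum_fiber_card f val); apply: eq_bigr => i _.
    by rewrite (eqP (fw i)).
  move=> q qC fq; case/negP: fC; apply/imsetP; exists q => //.
  by apply/ffunP => x; rewrite ffunE; apply: val_inj; rewrite /= -fq.
rewrite (eq_bigl (mem (F @: C))) => [|f]; last first.
  by rewrite andb_idl // => /imsetP[q _ ->].
rewrite big_imset //= /young_kappa.
rewrite (reindex_inj invg_inj) /=; apply: eq_big => [q|q qC].
  by apply/idP/idP => h; [rewrite -(invgK q)|]; apply: col_groupV.
rewrite /stab_coef; apply: eq_bigr => p _.
rewrite (reindex_inj (mulIg q)) /=; apply: eq_big => [q'|q' _].
  apply/idP/idP => h; last first.
    by apply: col_groupM => //; rewrite -(invgK q) col_groupV.
  by rewrite -(mulgK q q') col_groupM.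
rewrite !signM mulrC [sg q * _]mulrC mulrC; congr (_ * (nat_of_bool _)%:R).
apply/forallP/row_groupP => h x; last first.
  rewrite !ffunE -val_eqE /=; apply/eqP; have := h (q^-1%g x).
  by rewrite !permM permKV permK.
have := h (q x); rewrite !ffunE -val_eqE /= => /eqP.
by rewrite !permM !permK.
Qed.

Definition beta_set (la : seq nat) (i : 'I_k) : nat := (nth 0 la i + staircase i)%N.

Lemma sum_frob_chiS : \sum_s frob (beta_set la) s * chiS n la s = n`!%:R.
Proof.
under eq_bigr => s _ do rewrite frobE mulr_suml.
rewrite exchange_big /= (bigD1 1%g) /=; last first.
  by apply/forallP => i; rewrite perm1 leq_addl.
rewrite odd_perm1 expr0 [X in _ + X]big1 => [|w /andP[/forallP le w1]].
  under eq_bigr => s _ do rewrite mul1r.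
  rewrite sum_chiS_perm_char addr0.
  rewrite (eq_bigl (fun f : {ffun 'I_n -> 'I_k} =>
            [forall i, fiber_card f i == nth 0%N la i])); last first.
    by move=> f; apply: eq_forallb => i; rewrite perm1 addnK.
  by rewrite sum_stab_coef mulfVK // young_kappa_neq0.
under eq_bigr => s _ do rewrite -mulrA.
rewrite -mulr_sumr sum_chiS_perm_char big1 ?mulr0 // => f /forallP fw.
apply: stab_coef_sum_lt.
rewrite -(sum_fiber_card f val) sum_row_nth.
have := sum_mul_perm_lt w1.
have : (\sum_(i < k) i * fiber_card f i + \sum_(i < k) i * i =
        \sum_(i < k) i * nth 0 la i + \sum_(i < k) i * w i)%N.
  rewrite -!big_split; apply: eq_bigr => i _ /=; rewrite -!mulnDr; congr (_ * _)%N.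
  rewrite (eqP (fw i)) /beta_set /staircase.
  have := le i; rewrite /beta_set /staircase; have := ltn_ord i; have := ltn_ord (w i).
  lia.
set a := (\sum_(i < k) i * fiber_card f i)%N; set b := (\sum_(i < k) i * w i)%N.
rewrite -/a; move: a b => a b; lia.
Qed.

End FrobSpecht.

Lemma fiber_card_perm_ex n (T : finType) (f f' : {ffun 'I_n -> T}) :
  fiber_card f =1 fiber_card f' -> exists s : 'S_n, forall x, f x = f' (s x).
Proof.
move=> e; have cE (h : {ffun 'I_n -> T}) t : count_mem t (mktuple h) = fiber_card h t.
  rewrite /fiber_card /= count_map -sum1_count big_enum_cond /= -sum1_card.
  by apply: eq_bigl => x; rewrite inE.
have /tuple_permP[s hs] : perm_eq (mktuple f) (mktuple f').
  by apply/allP => t _ /=; rewrite !cE e.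
exists s => x; have /val_inj e2 := hs.
by have := congr1 (fun l => tnth l x) e2; rewrite !tnth_mktuple.
Qed.

Lemma fiber_card_ex n (T : finType) (A : T -> nat) :
  (\sum_t A t)%N = n -> exists f : {ffun 'I_n -> T}, fiber_card f =1 A.
Proof.
move=> An; pose l := flatten [seq nseq (A t) t | t <- enum T].
have sl : size l == n.
  rewrite size_flatten /shape -map_comp sumnE big_map big_enum /= -An.
  by apply/eqP/eq_bigr => t _; rewrite size_nseq.
exists [ffun i => tnth (Tuple sl) i] => t.
have <- : count_mem t l = A t.
  rewrite count_flatten -map_comp sumnE big_map big_enum /= (bigD1 t) //=.
  rewrite count_nseq /= eqxx mul1n big1 ?addn0 // => t' /negPf ne.
  by rewrite count_nseq /= ne.
have -> : count_mem t l = count_mem t (map (tnth (Tuple sl)) (enum 'I_n)).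
  by rewrite map_tnth_enum.
rewrite /fiber_card count_map -sum1_count big_enum_cond /= -sum1_card.
by apply: eq_bigl => i; rewrite !inE ffunE.
Qed.

Lemma sum_card_stab n (T : finType) (A : T -> nat) : (\sum_t A t)%N = n ->
  (\sum_(f : {ffun 'I_n -> T} | [forall t, fiber_card f t == A t])
      #|[set s : 'S_n | [forall x, f (s x) == f x]]| = n`!)%N.
Proof.
move=> /fiber_card_ex[f0 f0A].
rewrite -card_Sn -sum1_card (partition_big (fun s : 'S_n => [ffun x => f0 (s x)])
  (fun f => [forall t, fiber_card f t == A t])) /=; last first.
  by move=> s _; apply/forallP => t; rewrite fiber_card_perm f0A.
apply: eq_bigr => f /forallP fA.
have [s fs] : exists s : 'S_n, forall x, f x = f0 (s x).
  by apply: fiber_card_perm_ex => t; rewrite (eqP (fA t)) f0A.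
rewrite -sum1_card [RHS](reindex_inj (mulIg s)) /=; apply: eq_bigl => g; rewrite !inE /=.
apply/forallP/eqP => [h|/ffunP h x].
  by apply/ffunP => x; rewrite ffunE permM -fs (eqP (h x)).
by have := h x; rewrite ffunE permM -fs => ->.
Qed.

Section BigFfunOrd.
Variables (R : zmodType) (X : finType) (l : nat).

Definition ffun_cons (x : X) (a : {ffun 'I_l -> X}) : {ffun 'I_l.+1 -> X} :=
  [ffun j => oapp a x (unlift ord0 j)].

Lemma ffun_cons0 x a : ffun_cons x a ord0 = x.
Proof. by rewrite ffunE unlift_none. Qed.

Lemma ffun_consS x a j : ffun_cons x a (lift ord0 j) = a j.
Proof. by rewrite ffunE liftK. Qed.

Lemma big_ffun_cons (P : pred {ffun 'I_l.+1 -> X}) (E : {ffun 'I_l.+1 -> X} -> R) :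
  \sum_(a | P a) E a = \sum_x \sum_(a | P (ffun_cons x a)) E (ffun_cons x a).
Proof.
rewrite pair_big_dep /= (reindex (fun p => ffun_cons p.1 p.2)) //=.
apply: onW_bij; exists (fun a : {ffun 'I_l.+1 -> X} => (a ord0, [ffun j => a (lift ord0 j)])).
  move=> [x a] /=; rewrite ffun_cons0; congr (_, _); apply/ffunP => j.
  by rewrite ffunE ffun_consS.
move=> a; apply/ffunP => j /=; rewrite ffunE.
by case: unliftP => [j' ->|->] //=; rewrite ffunE.
Qed.
End BigFfunOrd.

Lemma alt_coefD k (g u v : 'I_k -> nat) :
  alt_coef g (fun i => u i + v i)%N =
    if [forall i, u i <= g i]%N then alt_coef (fun i => g i - u i)%N v else 0.
Proof.
case: ifPn => [/forallP le|].
  apply: eq_bigr => w _; congr (_ * (nat_of_bool _)%:R); apply: eq_forallb => i.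
  by have := le i; lia.
rewrite negb_forall => /existsP[i lt]; apply: big1 => w _.
case: forallP => [/(_ i)/eqP e|]; rewrite ?mulr0 //.
by case/negP: lt; rewrite e -addnA leq_addr.
Qed.

Lemma alt_coef_perm k (g v : 'I_k -> nat) (t : 'S_k) :
  alt_coef (g \o t) (v \o t) = (-1) ^+ odd_perm t * alt_coef g v.
Proof.
rewrite /alt_coef mulr_sumr (reindex_inj (mulgI t)) /=; apply: eq_bigr => w _.
rewrite odd_permM signr_addb -mulrA; congr (_ * (_ * (nat_of_bool _)%:R)).
apply/forallP/forallP => h i; last by rewrite /= permM; apply: h.
by have := h (t^-1%g i); rewrite /= permM permKV.
Qed.

Lemma sum_nat_perm k (t : 'S_k) (F : 'I_k -> nat) :
  (\sum_i F (t i) = \sum_i F i)%N.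
Proof. by rewrite [RHS](reindex_inj (@perm_inj _ t)). Qed.

Section Pieri.
Variables (k' M : nat).
Local Notation k := k'.+1.

(* The coefficient of [x^g] in the product of the Vandermonde alternant with the
   complete symmetric functions of degrees [b]. *)
Fixpoint hom_coef (b : seq nat) (g : 'I_k -> nat) : algC :=
  if b is b0 :: b' then
    \sum_(u : {ffun 'I_k -> 'I_M} | (\sum_i u i == b0)%N && [forall i, u i <= g i]%N)
       hom_coef b' (fun i => g i - u i)%N
  else alt_coef g (fun => 0%N).

Lemma hom_coefE l (b : 'I_l -> nat) g :
  \sum_(a : {ffun 'I_l -> {ffun 'I_k -> 'I_M}} | [forall j, \sum_i a j i == b j]%N)
     alt_coef g (fun i => \sum_j a j i)%N = hom_coef [seq b j | j <- enum 'I_l] g.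
Proof.
elim: l b g => [|l IH] b g.
  rewrite (eq_bigl xpredT) => [|a]; last by apply/forallP => -[].
  rewrite enum_ord0 /= (eq_bigr (fun=> alt_coef g (fun=> 0%N))) => [|a _]; last first.
    by congr alt_coef; apply/funext => i; rewrite big_ord0.
  by rewrite sumr_const card_ffun card_ord expn0.
rewrite big_ffun_cons enum_ordSl /= -map_comp [RHS]big_mkcond; apply: eq_bigr => u _.
under [LHS]eq_bigl => a.
  rewrite (_ : [forall j, _] = (\sum_i u i == b ord0)%N &&
      [forall j, \sum_i a j i == b (lift ord0 j)]%N); first over.
  apply/forallP/andP => [h|[h0 /forallP h] j].
    split; first by have := h ord0; rewrite ffun_cons0.
    by apply/forallP => j; have := h (lift ord0 j); rewrite ffun_consS.
  by case: (unliftP ord0 j) => [j' ->|->]; rewrite ?ffun_consS ?ffun_cons0.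
have [_|_] := boolP (_ == _)%N; last by rewrite big_pred0.
rewrite -IH /=.
have aE (a : {ffun 'I_l -> {ffun 'I_k -> 'I_M}}) :
    alt_coef g (fun i => \sum_j ffun_cons u a j i)%N =
    if [forall i, u i <= g i]%N then
      alt_coef (fun i => g i - u i)%N (fun i => \sum_j a j i)%N else 0.
  rewrite -alt_coefD; congr alt_coef; apply/funext => i.
  by rewrite big_ord_recl ffun_cons0; congr addn; apply: eq_bigr => j _; rewrite ffun_consS.
by under eq_bigr => a _ do rewrite aE; case: ifP => // _; rewrite big1.
Qed.

Lemma hom_coef_perm b g (t : 'S_k) :
  hom_coef b (g \o t) = (-1) ^+ odd_perm t * hom_coef b g.
Proof.
elim: b g => [|b0 b IH] g /=; first exact: (alt_coef_perm g (fun=> 0%N)).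
rewrite mulr_sumr.
rewrite (reindex_inj (h := fun u : {ffun 'I_k -> 'I_M} => [ffun y => u (t y)])).
  apply: eq_big => [u|u _].
    congr (_ && _).
      rewrite [in RHS](reindex_inj (@perm_inj _ t)); congr (_ == _).
      by apply: eq_bigr => i _; rewrite ffunE.
    apply/forallP/forallP => h i; last by rewrite ffunE; apply: h.
    by have := h (t^-1%g i); rewrite ffunE /= permKV.
  rewrite -IH; congr hom_coef; apply/funext => i; by rewrite /= ffunE.
move=> f f' e; apply/ffunP => y.
have := congr1 (fun h : {ffun 'I_k -> 'I_M} => h (t^-1%g y)) e.
by rewrite !ffunE permKV.
Qed.

Variable la : nat -> nat.
Hypothesis la_noninc : forall i, (la i.+1 <= la i)%N.
Local Notation g := (fun i : 'I_k => la i + staircase i)%N.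

Lemma la_noninc_le i j : (i <= j)%N -> (la j <= la i)%N.
Proof.
move=> /subnKC <-; elim: (j - i)%N => [|m IH]; first by rewrite addn0.
by rewrite addnS (leq_trans (la_noninc _)).
Qed.

Variable b0 : nat.
Hypothesis b0M : (b0 < M)%N.

Let valid (u : {ffun 'I_k -> 'I_M}) := (\sum_i u i == b0)%N && [forall i, u i <= g i]%N.
(* The skew shape removed by [u] fails to be a horizontal strip at row [j]. *)
Let viol (u : {ffun 'I_k -> 'I_M}) (j : nat) : bool :=
  (j.+1 < k)%N && (g (inord j) - u (inord j) <= g (inord j.+1))%N.
Let bad u := has (viol u) (iota 0 k).
Let first u := find (viol u) (iota 0 k).
Let swap j (u : {ffun 'I_k -> 'I_M}) : {ffun 'I_k -> 'I_M} :=
  let t := tperm (inord j) (inord j.+1) in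
  [ffun i => insubd (u i) (g i - (g (t i) - u (t i)))%N].
Let phi u := if valid u && bad u then swap (first u) u else u.

Lemma pieri_swapE j u (t := tperm (inord j : 'I_k) (inord j.+1)) :
  valid u -> viol u j -> forall i, (swap j u i = g i - (g (t i) - u (t i)) :> nat)%N /\
    (g (t i) - u (t i) <= g i)%N.
Proof.
move=> /andP[/eqP su /forallP ug] /andP[jk vj].
have jk' : (j < k)%N by apply: ltnW.
have hle i : (g (t i) - u (t i) <= g i)%N.
  rewrite /t; case: tpermP => [->|->|_ _]; rewrite ?leq_subr //.
  apply: leq_trans (leq_subr _ _) _; rewrite /staircase !inordK //.
  by apply: leq_add; [exact: la_noninc | apply: leq_sub2l].
have sw : (\sum_i (g i - (g (t i) - u (t i))) = b0)%N.
  apply/eqP; rewrite -(eqn_add2r (\sum_i (g (t i) - u (t i)))) -big_split /=.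
  rewrite (eq_bigr g) => [|i _]; last by rewrite subnK.
  rewrite -su (sum_nat_perm t (fun i => g i - u i)%N).
  by rewrite -big_split /=; apply/eqP/eq_bigr => i _; rewrite subnKC.
move=> i; split=> //; rewrite ffunE val_insubd -/t.
rewrite (_ : (_ < M)%N) //; apply: leq_ltn_trans b0M; rewrite -[X in (_ <= X)%N]sw.
by rewrite (bigD1 i) //= leq_addr.
Qed.

Lemma pieri_swap j u (t := tperm (inord j : 'I_k) (inord j.+1)) :
  valid u -> viol u j -> forall i, (g i - swap j u i = g (t i) - u (t i))%N.
Proof. by move=> vu vj i; have [-> le] := pieri_swapE vu vj i; rewrite subKn. Qed.

Lemma pieri_swap_valid j u : valid u -> viol u j -> valid (swap j u).
Proof.
move=> vu vj; have h := pieri_swap vu vj; have h2 := pieri_swapE vu vj.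
case/andP: vu => /eqP su /forallP ug.
have ug' i : (swap j u i <= g i)%N by have [-> _] := h2 i; apply: leq_subr.
apply/andP; split; last by apply/forallP.
rewrite -su -(eqn_add2r (\sum_i (g i - swap j u i))) -big_split /=.
rewrite (eq_bigr g) => [|i _]; last by rewrite subnKC.
rewrite [X in (_ == _ + X)%N](eq_bigr _ (fun i _ => h i)).
rewrite (sum_nat_perm _ (fun i => g i - u i)%N).
by rewrite -big_split /=; apply/eqP/esym/eq_bigr => i _; rewrite subnKC.
Qed.

Lemma pieri_swap_viol j u : valid u -> viol u j -> viol (swap j u) j.
Proof.
move=> vu vj; rewrite /viol pieri_swap // tpermL; case/andP: vj => -> _ /=.
exact: leq_subr.
Qed.

Lemma pieri_swap_viol_lt j u i : (i < j)%N -> valid u -> viol u j ->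
  viol (swap j u) i = viol u i.
Proof.
move=> ij vu vj; rewrite /viol pieri_swap // tpermD //; case/andP: vj => jk _.
  apply/eqP => /(congr1 val); rewrite /= !inordK; lia.
apply/eqP => /(congr1 val); rewrite /= !inordK; lia.
Qed.

Lemma pieri_first u : bad u -> viol u (first u).
Proof.
move=> bu; have := nth_find 0%N bu; rewrite nth_iota //.
by move: bu; rewrite /bad has_find size_iota.
Qed.

Lemma pieri_swap_first u : valid u -> bad u -> bad (swap (first u) u) /\
  first (swap (first u) u) = first u.
Proof.
move=> vu bu; have vf := pieri_first bu; have := pieri_swap_viol vu vf.
set u' := swap _ _; set j := first u => vj.
have jk : (j < k)%N by move: bu; rewrite /bad has_find size_iota.
have bu' : bad u' by apply/hasP; exists j => //; rewrite mem_iota.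
have j'k : (first u' < k)%N by move: bu'; rewrite /bad has_find size_iota.
split=> //; apply/eqP; rewrite eqn_leq; apply/andP; split; rewrite leqNgt; apply/negP => lt.
  by have := before_find 0%N lt; rewrite nth_iota // add0n vj.
have := before_find 0%N lt; rewrite nth_iota // add0n.
by rewrite -(pieri_swap_viol_lt lt vu vf) pieri_first.
Qed.

Lemma pieri_phiK : involutive phi.
Proof.
move=> u; rewrite {2}/phi; case: ifPn => [/andP[vu bu]|h]; last by rewrite /phi (negPf h).
have vf := pieri_first bu; have [b' f'] := pieri_swap_first vu bu.
have v' := pieri_swap_valid vu vf; have vf' := pieri_swap_viol vu vf.
rewrite /phi v' b' /= f'; apply/ffunP => i; apply: val_inj => /=.
have [-> _] := pieri_swapE v' vf' i.
rewrite (pieri_swap vu vf) tpermK subKn //.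
by case/andP: vu => _ /forallP.
Qed.

(* Exchanging two consecutive beta-numbers at the first violation is a
   sign-reversing involution. *)
Lemma pieri_bad b : \sum_(u | valid u && bad u) hom_coef b (fun i => g i - u i)%N = 0.
Proof.
set S := LHS; suff /eqP : S = - S.
  by rewrite -addr_eq0 -mulr2n mulrn_eq0 => /eqP.
rewrite {1}/S (reindex_inj (inv_inj pieri_phiK)) /= -sumrN; apply: eq_big => [u|u].
  rewrite {1 2}/phi; case: ifPn => [/andP[vu bu]|/negPf //].
  by have [-> _] := pieri_swap_first vu bu; rewrite (pieri_swap_valid vu (pieri_first bu)).
rewrite /phi; case: ifP => [/andP[vu bu] _|h]; last by rewrite h.
have vf := pieri_first bu; set t := tperm (inord (first u) : 'I_k) (inord (first u).+1).
have -> : (fun i => g i - swap (first u) u i)%N = (fun i => g i - u i)%N \o t.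
  by apply/funext => i; rewrite /= (pieri_swap vu vf).
rewrite hom_coef_perm odd_tperm (_ : _ != _) ?expr1 ?mulN1r //.
have /andP[lt _] := vf.
by apply/eqP => /(congr1 val); rewrite /= !inordK //; lia.
Qed.

Hypothesis la_k : la k = 0%N.

Lemma pieri_good u : valid u -> ~~ bad u ->
  (forall i : 'I_k, u i <= la i - la i.+1)%N.
Proof.
move=> /andP[_ /forallP ug] /hasPn nb i.
have [ik|ik] := ltnP i.+1 k; last first.
  have -> : i.+1 = k by apply/eqP; rewrite eqn_leq ik ltn_ord.
  rewrite la_k subn0; have := ug i; rewrite /staircase; have := ltn_ord i; lia.
have := nb i; rewrite mem_iota ltn_ord => /(_ isT).
rewrite /viol ik /= inord_val inordK // /staircase /= inordK //.
have := ug i; rewrite /staircase /=; have := la_noninc i; lia.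
Qed.

Lemma sum_la_diff : (\sum_(i < k) (la i - la i.+1) = la 0)%N.
Proof.
suff h m : (\sum_(i < m) (la i - la i.+1) + la m = la 0)%N by rewrite -(h k) la_k addn0.
elim: m => [|m IH]; first by rewrite big_ord0.
by rewrite big_ord_recr /= -IH -addnA subnK.
Qed.

Lemma hom_coef_gt b : (la 0 < b0)%N -> hom_coef (b0 :: b) g = 0.
Proof.
move=> lt /=; rewrite -/valid (bigID bad) /= pieri_bad add0r big1 // => u /andP[vu bu].
have [/andP[/eqP su _] h] := (vu, pieri_good vu bu).
have : (\sum_i u i <= \sum_(i < k) (la i - la i.+1))%N by apply: leq_sum.
by rewrite su sum_la_diff leqNgt lt.
Qed.

Lemma hom_coef_eq b : la 0 = b0 ->
  hom_coef (b0 :: b) g = hom_coef b (fun i : 'I_k => la i.+1 + staircase i)%N.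
Proof.
move=> e /=; rewrite -/valid (bigID bad) /= pieri_bad add0r.
have M0 : (0 < M)%N by apply: leq_ltn_trans b0M.
pose u0 : {ffun 'I_k -> 'I_M} := [ffun i : 'I_k => insubd (Ordinal M0) (la i - la i.+1)%N].
have u0E i : u0 i = (la i - la i.+1)%N :> nat.
  rewrite ffunE val_insubd (_ : (_ < M)%N) //; apply: leq_ltn_trans b0M.
  by rewrite -e (leq_trans (leq_subr _ _)) // la_noninc_le.
have vu0 : valid u0.
  apply/andP; split; first by rewrite (eq_bigr _ (fun i _ => u0E i)) sum_la_diff e.
  by apply/forallP => i; rewrite u0E; apply: leq_trans (leq_subr _ _) (leq_addr _ _).
have nu0 : ~~ bad u0.
  apply/hasPn => j; rewrite mem_iota => /andP[_ jk]; rewrite /viol.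
  apply/negP => /andP[jk1]; rewrite u0E /staircase !inordK //.
  have := la_noninc j; lia.
rewrite (bigD1 u0) /=; last by rewrite nu0 andbT; exact: vu0.
rewrite [X in _ + X]big1 ?addr0 => [|u /andP[/andP[vu bu] /eqP ne]].
  congr hom_coef; apply/funext => i; rewrite u0E; have := la_noninc i; lia.
case: ne; have h := pieri_good vu bu; have /andP[/eqP su _] := vu.
have [_] := @leqif_sum _ (xpredT : pred 'I_k) _ _ _ (fun i _ => leqif_eq (h i)).
rewrite su sum_la_diff e eqxx => /esym/forall_inP hh.
by apply/ffunP => i; apply: val_inj; rewrite /= u0E (eqP (hh i isT)).
Qed.

End Pieri.

Section FrobNorm.
Variables (k' M : nat).
Local Notation k := k'.+1.

Lemma hom_coef_mkseq (la : nat -> nat) m r :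
  (forall i, la i.+1 <= la i)%N -> la k = 0%N -> (la 0 < M)%N ->
  hom_coef M (mkseq la m ++ r) (fun i : 'I_k => la i + staircase i)%N =
  hom_coef M r (fun i : 'I_k => la (m + i) + staircase i)%N.
Proof.
elim: m la => [|m IH] la la_ni la_k laM //.
have -> : mkseq la m.+1 ++ r = la 0 :: (mkseq (fun i => la i.+1) m ++ r).
  by rewrite /mkseq /= (iotaDl 1 0) -map_comp.
rewrite (hom_coef_eq (la := la)) // (IH (fun i => la i.+1)) //.
  by apply/eqP; rewrite -leqn0 -[X in (_ <= X)%N]la_k.
by apply: leq_ltn_trans laM.
Qed.

Lemma alt_coef_staircase : alt_coef (@staircase k) (fun=> 0%N) = 1.
Proof.
rewrite /alt_coef (bigD1 1%g) //= odd_perm1 big1 => [|w w1].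
  by case: forallP => [|[]] //; rewrite ?addr0 ?mulr1 // => i; rewrite perm1.
case: forallP => [h|]; rewrite ?mulr0 //; case/eqP: w1; apply/permP => i.
rewrite perm1; apply: val_inj; have := eqP (h i); rewrite /staircase /=.
by have := ltn_ord i; have := ltn_ord (w i); lia.
Qed.

End FrobNorm.

Lemma sum_frob_norm n k' (la : seq nat) (g := @beta_set k'.+1 la) :
  is_partition_of n la -> (size la <= k'.+1)%N ->
  \sum_(s : 'S_n) frob g s * frob g s = n`!%:R.
Proof.
set k := k'.+1 => laP lak.
have sum_la : (\sum_(j < k) nth 0 la j = n)%N.
  rewrite -(sumn_la laP) sumnE (big_nth 0%N) big_mkord (big_ord_widen k _ lak).
  rewrite [RHS]big_mkcond; apply: eq_bigr => j _; case: ltnP => // h.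
  by rewrite nth_default.
pose X := {ffun 'I_k -> {ffun 'I_k -> 'I_n.+1}}.
pose F1 (F : {ffun 'I_n -> 'I_k * 'I_k}) := [ffun x => (F x).1].
pose F2 (F : {ffun 'I_n -> 'I_k * 'I_k}) := [ffun x => (F x).2].
transitivity (\sum_(F : {ffun 'I_n -> 'I_k * 'I_k})
   alt_coef g (fiber_card (F1 F)) * alt_coef g (fiber_card (F2 F)) *
   #|[set s : 'S_n | [forall x, F (s x) == F x]]|%:R).
  transitivity (\sum_(s : 'S_n) \sum_(F : {ffun 'I_n -> 'I_k * 'I_k} | [forall x, F (s x) == F x])
     alt_coef g (fiber_card (F1 F)) * alt_coef g (fiber_card (F2 F))).
    apply: eq_bigr => s _; rewrite /frob mulr_suml.
    under eq_bigr => f _ do rewrite mulr_sumr.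
    rewrite pair_big /= (reindex (fun F => (F1 F, F2 F))) /=.
      apply: eq_bigl => F; apply/andP/forallP => [[/forallP h1 /forallP h2] x|h].
        have := h1 x; have := h2 x; rewrite !ffunE => /eqP e2 /eqP e1.
        by rewrite [F (s x)]surjective_pairing [F x]surjective_pairing e1 e2.
      by split; apply/forallP => x; rewrite !ffunE (eqP (h x)).
    apply: onW_bij;
      exists (fun p : {ffun 'I_n -> 'I_k} * {ffun 'I_n -> 'I_k} => [ffun x => (p.1 x, p.2 x)]).
      by move=> F; apply/ffunP => x; rewrite !ffunE -surjective_pairing.
    by move=> [f1 f2]; congr (_, _); apply/ffunP => x; rewrite !ffunE.
  under eq_bigr => s _ do rewrite big_mkcond.
  rewrite exchange_big /=; apply: eq_bigr => F _; rewrite -big_mkcond /= sumr_const.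
  by rewrite mulr_natr; congr (_ *+ _); apply: eq_card => s; rewrite inE.
pose A (F : {ffun 'I_n -> 'I_k * 'I_k}) : X := [ffun j => [ffun i => inord (fiber_card F (i, j))]].
have AE F i j : A F j i = fiber_card F (i, j) :> nat.
  by rewrite !ffunE inordK // ltnS -[X in (_ <= X)%N]card_ord max_card.
have A1 F i : fiber_card (F1 F) i = (\sum_j A F j i)%N.
  under eq_bigr => j _ do rewrite AE.
  rewrite /fiber_card -sum1_card (partition_big (fun x => (F x).2) predT) //=.
  apply: eq_bigr => j _; rewrite -sum1_card; apply: eq_bigl => x.
  by rewrite !inE ffunE -pair_eqE.
have A2 F j : fiber_card (F2 F) j = (\sum_i A F j i)%N.
  under eq_bigr => i _ do rewrite AE.
  rewrite /fiber_card -sum1_card (partition_big (fun x => (F x).1) predT) //=.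
  apply: eq_bigr => i _; rewrite -sum1_card; apply: eq_bigl => x.
  by rewrite !inE ffunE -pair_eqE /pair_eq /= andbC.
have AA F : (\sum_j \sum_i A F j i = n)%N.
  rewrite -(eq_bigr _ (fun j _ => A2 F j)) -[RHS](card_ord n) -sum1_card.
  rewrite (partition_big (F2 F) predT) //=; apply: eq_bigr => j _.
  by rewrite /fiber_card -sum1_card; apply: eq_bigl => x; rewrite inE.
rewrite (partition_big A (fun a => \sum_j \sum_i a j i == n)%N) /=; last first.
  by move=> F _; rewrite AA.
transitivity (n`!%:R * \sum_(a : X | (\sum_j \sum_i a j i == n)%N)
   alt_coef g (fun i => \sum_j a j i)%N * alt_coef g (fun j => \sum_i a j i)%N).
  rewrite mulr_sumr; apply: eq_bigr => a /eqP an.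
  rewrite -(@sum_card_stab n ('I_k * 'I_k)%type (fun p => a p.2 p.1)); last first.
    by apply: etrans an; rewrite exchange_big pair_bigA /=; apply: eq_bigr => -[i j].
  rewrite natr_sum mulr_suml; apply: eq_big => [F|F /eqP e].
    apply/eqP/forallP => [<- [i j]|h]; first by rewrite AE.
    apply/ffunP => j; apply/ffunP => i; apply: val_inj.
    by rewrite /= AE (eqP (h (i, j))).
  rewrite mulrC; congr (_ * (_ * _)); congr alt_coef; apply/funext => i.
    by rewrite A1 e.
  by rewrite A2 e.
rewrite -[RHS]mulr1; congr (_ * _).
transitivity (\sum_(v : 'S_k) (-1) ^+ odd_perm v *
  \sum_(a : X | [forall j, g j == \sum_i a j i + staircase (v j)]%N)
     alt_coef g (fun i => \sum_j a j i)%N).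
  under eq_bigr => a _ do rewrite {2}/alt_coef mulr_sumr.
  rewrite exchange_big /=; apply: eq_bigr => v _; rewrite mulr_sumr.
  rewrite big_mkcond [RHS]big_mkcond /=; apply: eq_bigr => a _.
  case: forallP => [h|]; last by rewrite !mulr0; case: ifP.
  rewrite mulr1 ifT 1?mulrC //.
  have := sum_nat_perm v (@staircase k); have := sum_la.
  rewrite /g /beta_set -(eqn_add2r (\sum_j staircase (v j))) -big_split /=.
  by rewrite -(eq_bigr _ (fun j _ => eqP (h j))) /g /beta_set big_split /= => -> ->.
pose b (v : 'S_k) j := (g j - staircase (v j))%N.
have innerE (v : 'S_k) : \sum_(a : X | [forall j, g j == \sum_i a j i + staircase (v j)]%N)
     alt_coef g (fun i => \sum_j a j i)%N =
   if [forall j, staircase (v j) <= g j]%N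
   then hom_coef n.+1 [seq b v j | j <- enum 'I_k] g else 0.
  case: ifPn => [/forallP le|].
    rewrite -hom_coefE; apply: eq_bigl => a; apply: eq_forallb => j.
    by rewrite /b; move: (\sum_i a j i)%N (le j) => S; lia.
  rewrite negb_forall => /existsP[j lt]; rewrite big_pred0 // => a.
  apply/negP => /forallP/(_ j)/eqP e; case/negP: lt; by rewrite e leq_addl.
have bn (v : 'S_k) : (forall j, staircase (v j) <= g j)%N -> (\sum_j b v j = n)%N.
  move=> le; apply/eqP; rewrite -(eqn_add2r (\sum_j staircase (v j))) -big_split /=.
  rewrite (eq_bigr g) => [|j _]; last by rewrite /b subnK.
  by rewrite /g /beta_set big_split /= sum_la sum_nat_perm.
have la_ni i : (nth 0 la i.+1 <= nth 0 la i)%N by apply: (nth_part_mono laP).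
have la_k : nth 0%N la k = 0%N by rewrite nth_default.
have la_n i : (nth 0 la i <= n)%N.
  have [il|il] := ltnP i (size la); last by rewrite nth_default.
  rewrite -(sumn_la laP) sumnE (big_nth 0%N) big_mkord (bigD1 (Ordinal il)) //=.
  exact: leq_addr.
rewrite (bigD1 1%g) //= odd_perm1 mul1r innerE ifT; last first.
  by apply/forallP => j; rewrite perm1 /g /beta_set leq_addl.
have -> : [seq b 1%g j | j <- enum 'I_k] = mkseq (nth 0%N la) k ++ [::].
  rewrite cats0 /mkseq -val_enum_ord -map_comp; apply: eq_map => j /=.
  by rewrite /b perm1 /g /beta_set addnK.
rewrite (hom_coef_mkseq (la := nth 0%N la)) //= ?ltnS //.
rewrite (_ : (fun i => _) = @staircase k) ?alt_coef_staircase; last first.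
  by apply/funext => i; rewrite nth_default // (leq_trans lak) // leq_addr.
rewrite big1 ?addr0 // => v v1; rewrite innerE.
case: ifP => [/forallP le|]; last by rewrite mulr0.
have exj : exists m, (m < k)%N && (v (inord m) != inord m).
  move: v1; apply: contraNP => h; apply/eqP/permP => i; rewrite perm1.
  apply/eqP; apply: contra_notT h => vi; exists i; by rewrite ltn_ord inord_val.
have [m /andP[mk vm] mmin] := ex_minnP exj.
have vfix i : (i < m)%N -> v (inord i) = inord i.
  move=> im; apply/eqP; apply: contraT => vi; have := mmin i.
  by rewrite vi (ltn_trans im) // leqNgt im => /(_ isT).
have vgt : (m < v (inord m))%N.
  rewrite ltn_neqAle; apply/andP; split.
    by apply: contra vm => /eqP e; apply/eqP/val_inj; rewrite /= inordK.
  rewrite leqNgt; apply/negP => lt; have := vfix _ lt; rewrite inord_val.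
  by move=> /perm_inj e; case/eqP: vm.
have -> : [seq b v j | j <- enum 'I_k] = mkseq (nth 0%N la) m ++
    b v (inord m) :: drop m.+1 [seq b v j | j <- enum 'I_k].
  set l := map _ _; have sl : size l = k by rewrite size_map size_enum_ord.
  have ln i : (i < k)%N -> nth 0%N l i = b v (inord i).
    move=> ik; rewrite (nth_map ord0) ?size_enum_ord //; congr (b v _).
    by apply: val_inj; rewrite /= nth_enum_ord // inordK.
  rewrite -[LHS](cat_take_drop m) (drop_nth 0%N) ?sl // ln //; congr (_ ++ _).
  apply: (@eq_from_nth _ 0%N); first by rewrite size_take sl mk size_mkseq.
  rewrite size_take sl mk => i im; rewrite nth_take // nth_mkseq // ln ?(ltn_trans im) //.
  by rewrite /b vfix // /g /beta_set addnK inordK // (ltn_trans im).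
rewrite (hom_coef_mkseq (la := nth 0%N la)) ?ltnS //.
rewrite (hom_coef_gt (la := fun i => nth 0%N la (m + i))) ?mulr0 //.
- by move=> i; rewrite addnS.
- by rewrite ltnS -(bn _ le) (bigD1 (inord m)) //= leq_addr.
- by rewrite nth_default // (leq_trans lak) // leq_addl.
rewrite addn0 /b /g /beta_set /staircase inordK //.
by have := ltn_ord (v (inord m)); lia.
Qed.

Lemma frobV n k g (s : 'S_n) : @frob n k g s^-1%g = frob g s.
Proof. by rewrite !frobE; apply: eq_bigr => w _; rewrite perm_charV. Qed.

Lemma conj_frob n k g (s : 'S_n) : (@frob n k g s)^* = frob g s.
Proof.
rewrite /frob rmorph_sum; apply: eq_bigr => f _; rewrite /alt_coef rmorph_sum.
by apply: eq_bigr => w _; rewrite rmorphM rmorphXn rmorphN1 rmorph_nat.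
Qed.

Lemma chiS_char n la : chiS n la \is a character.
Proof. exact: cfRepr_char. Qed.

Lemma chiSV n la s : chiS n la s^-1%g = (chiS n la s)^*.
Proof. by rewrite char_inv ?chiS_char. Qed.

Section ChiFrob.
Variables (n k' : nat) (la : seq nat).
Local Notation k := k'.+1.
Hypothesis laP : is_partition_of n la.
Hypothesis la_k : (size la <= k)%N.

(* Both sides have norm 1 and their inner product is 1. *)
Lemma chiS_frob s : chiS n la s = frob (@beta_set k la) s.
Proof.
set g := beta_set la; pose d s := frob g s - chiS n la s.
have e1 := sum_frob_chiS laP la_k; have e2 := sum_chiS_norm laP.
have e3 := sum_frob_norm laP la_k.
suff d0 : \sum_s d s * (d s)^* = 0.
  have /(_ s isT)/eqP := psumr_eq0P (fun s _ => mul_conjC_ge0 (d s)) d0.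
  by rewrite mul_conjC_eq0 subr_eq0 => /eqP.
have e4 : \sum_s frob g s * (chiS n la s)^* = n`!%:R.
  rewrite -e1 [RHS](reindex_inj invg_inj); apply: eq_bigr => t _.
  by rewrite frobV chiSV.
transitivity (\sum_(s : 'S_n) frob g s * frob g s - \sum_(s : 'S_n) frob g s * chiS n la s
   - \sum_(s : 'S_n) frob g s * (chiS n la s)^*
   + \sum_(s : 'S_n) chiS n la s * chiS n la s^-1%g).
  rewrite -!sumrB -big_split /=; apply: eq_bigr => t _.
  rewrite /d rmorphB /= conj_frob chiSV.
  by move: (frob g t) (chiS n la t) => x y; ring.
rewrite e1 e2 e3 e4; by rewrite subrr sub0r addNr.
Qed.

Lemma chiS_irr : chiS n la \in irr (symS n).
Proof.
rewrite irrEchar chiS_char cfdotE; apply/eqP.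
rewrite cardsT card_Sn; under eq_bigr => s _ do rewrite -chiSV.
rewrite big_mkcond; under eq_bigr => s _ do rewrite inE.
by rewrite (sum_chiS_norm laP) mulVf // pnatr_eq0 -lt0n fact_gt0.
Qed.

End ChiFrob.

Lemma stab_coef_le_eq0 n la k (f : {ffun 'I_n -> 'I_k}) :
  is_partition_of n la ->
  (\sum_x f x <= \sum_x @tab_row n la x)%N ->
  ~~ [forall i, fiber_card f i == nth 0 la i]%N -> stab_coef la f = 0.
Proof.
move=> laP le nw.
have [/existsP[a /existsP[b /and3P[nab /eqP cab /eqP fab]]]|h] :=
    boolP [exists a, exists b, [&& a != b, @tab_col n la a == @tab_col n la b & f a == f b]].
  exact: stab_coef_eq0 nab cab fab.
have [|le' eq'] := tab_fill laP (f := fun x => f x).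
  move=> a b cab fab; apply/eqP; apply: contraNT h => nab.
  by apply/existsP; exists a; apply/existsP; exists b; rewrite nab cab (val_inj fab) !eqxx.
have [|q qC fq] := eq'; first by apply/eqP; rewrite eqn_leq le' le.
case/negP: nw; apply/forallP => i; rewrite -(tab_row_fiber laP).
rewrite -(card_preimset [set x | tab_row la x == i] (@perm_inj _ q)); apply/eqP.
by apply: eq_card => x; rewrite !inE -val_eqE /= fq.
Qed.

Lemma is_partition_nth_inj la mu : is_partition la -> is_partition mu ->
  nth 0%N la =1 nth 0%N mu -> la = mu.
Proof.
have aux l m : is_partition m -> nth 0%N l =1 nth 0%N m -> (size m <= size l)%N.
  move=> /andP[_ m0] e; rewrite leqNgt; apply/negP => lt; case/negP: m0.
  have := e (size l); rewrite nth_default // => ->; exact: mem_nth.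
move=> lP mP e; have sz : size la = size mu.
  by apply/eqP; rewrite eqn_leq (aux la mu) // andbT; apply: aux => // i; rewrite e.
by apply: (@eq_from_nth _ 0%N) => // i _; apply: e.
Qed.

Lemma chiS_inj n (la mu : seq nat) : is_partition_of n la -> is_partition_of n mu ->
  chiS n la = chiS n mu -> la = mu.
Proof.
pose k := (maxn (size la) (size mu)).+1.
suff main (l m : seq nat) : is_partition_of n l -> is_partition_of n m ->
    (size l <= k)%N -> (size m <= k)%N ->
    (\sum_(i < k) i * nth 0 m i <= \sum_(i < k) i * nth 0 l i)%N ->
    chiS n l = chiS n m -> l = m.
  move=> lP mP e; have sl : (size la <= k)%N by rewrite leqW // leq_maxl.
  have sm : (size mu <= k)%N by rewrite leqW // leq_maxr.
  case: (leqP (\sum_(i < k) i * nth 0 mu i) (\sum_(i < k) i * nth 0 la i))%N.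
    by move=> le; apply: main le e.
  by move=> /ltnW le; apply/esym; apply: main le (esym e).
move=> lP mP sl sm le e; have /andP[lp _] := lP; have /andP[mp _] := mP.
apply: is_partition_nth_inj => //.
move=> i; apply/eqP; apply: contraT => ne.
have := sum_frob_chiS mP sm; rewrite -e => /eqP; rewrite eq_sym.
under eq_bigr => s _ do rewrite frobE mulr_suml.
rewrite exchange_big /= big1 => [|w /forallP lew].
  by rewrite pnatr_eq0 eqn0Ngt fact_gt0.
under eq_bigr => s _ do rewrite -mulrA.
rewrite -mulr_sumr sum_chiS_perm_char // big1 ?mulr0 // => f /forallP fw.
have fs : (\sum_x f x + \sum_(i < k) i * i =
        \sum_(i < k) i * nth 0 m i + \sum_(i < k) i * w i)%N.
  rewrite -(sum_fiber_card f val) -!big_split; apply: eq_bigr => j _ /=.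
  rewrite -!mulnDr; congr (_ * _)%N.
  rewrite (eqP (fw j)) /beta_set /staircase.
  have := lew j; rewrite /beta_set /staircase; have := ltn_ord j; have := ltn_ord (w j).
  lia.
have wle : (\sum_(i < k) i * w i <= \sum_(i < k) i * i)%N.
  case: (eqVneq w 1%g) => [->|w1]; last exact: ltnW (sum_mul_perm_lt w1).
  by apply/eq_leq/eq_bigr => j _; rewrite perm1.
case: (eqVneq w 1%g) => [w1|w1]; last first.
  apply: stab_coef_sum_lt => //; rewrite (sum_row_nth lP sl).
  have := sum_mul_perm_lt w1; move: fs le wle.
  by do 5!move: (\sum_(_ < _) _)%N => ?; lia.
apply: stab_coef_le_eq0 => //.
  rewrite (sum_row_nth lP sl); move: fs le wle.
  by do 5!move: (\sum_(_ < _) _)%N => ?; lia.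
case: (ltnP i k) => ik; last by move: ne; rewrite !nth_default // (leq_trans _ ik).
apply/negP => /forallP/(_ (Ordinal ik)); rewrite (eqP (fw _)) w1 perm1 /beta_set addnK /=.
by rewrite eq_sym (negPf ne).
Qed.

Definition strip0 (s : seq nat) : seq nat := [seq x <- s | 0 < x]%N.

Lemma nth_strip0 s i : sorted geq s -> nth 0%N (strip0 s) i = nth 0%N s i.
Proof.
have geqT : transitive geq by move=> a b c /= ba ac; apply: leq_trans ba.
elim: s i => [|x s IH] i //= sx; have ss := path_sorted sx.
have [x0|x0] := posnP x; last by case: i => [|i] //=; apply: IH.
have s0 : all (eq_op^~ 0%N) s.
  move: sx; rewrite path_sortedE // => /andP[/allP h _].
  by apply/allP => y ys; have := h y ys; rewrite /= x0 leqn0.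
rewrite /strip0 (eq_in_filter (a2 := pred0)) ?filter_pred0 ?nth_nil.
  case: i => [|i] /=; first by rewrite x0.
  have [il|il] := ltnP i (size s); last by rewrite nth_default.
  by apply/esym/eqP; apply: (allP s0); apply: mem_nth.
by move=> y ys; have /eqP -> := allP s0 y ys.
Qed.

Lemma strip0_partition s : sorted geq s -> is_partition (strip0 s).
Proof.
move=> so; apply/andP; split; last by rewrite mem_filter.
by apply: sorted_filter so; move=> a b c /= ba ac; apply: leq_trans ba.
Qed.

Lemma sumn_strip0 s : sumn (strip0 s) = sumn s.
Proof. by elim: s => //= x s IH; case: posnP => [->|_] //=; rewrite IH. Qed.

Section Complete.
Variable n' : nat.
Local Notation n := n'.+1.
Local Notation G := (symS n).
Variable i : Iirr G.
Hypothesis iN : forall la, is_partition_of n la -> 'chi_i != chiS n la.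

Lemma frob_orth la : is_partition_of n la ->
  \sum_s frob (@beta_set n la) s * ('chi_i s)^* = 0.
Proof.
move=> laP; have laP' := laP; case/andP: laP' => la_part /eqP la_sum.
have lak : (size la <= n)%N.
  rewrite -la_sum; have /andP[_ la0] := la_part; elim: la la0 {laP la_part la_sum} => //= x s IH.
  rewrite inE negb_or eq_sym -lt0n => /andP[x0 /IH le]; lia.
have /irrP[j hj] := chiS_irr laP.
have := cfdot_irr j i; rewrite -hj cfdotE.
have -> : (j == i) = false by apply/negP => /eqP e; case/eqP: (iN laP); rewrite hj e.
move=> /eqP; rewrite mulf_eq0 invr_eq0 cardsT card_Sn pnatr_eq0 eqn0Ngt fact_gt0 /=.
move=> /eqP e; rewrite -[RHS]e; apply: eq_big => [s|s _]; first by rewrite inE.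
by rewrite (chiS_frob laP lak).
Qed.

Lemma perm_char_swap (b : 'I_n -> nat) (t : 'S_n) (s : 'S_n) :
  perm_char (fun x => b (t x)) s = perm_char b s.
Proof.
rewrite !perm_charE.
rewrite [RHS](reindex_inj (h := fun f : {ffun 'I_n -> 'I_n} => [ffun y => t (f y)])) /=.
  apply: eq_big => [f|f _].
    apply/forallP/forallP => h x.
      have := h (t^-1%g x); rewrite permKV => /eqP <-; apply/eqP.
      by apply: eq_card => y; rewrite !inE ffunE -[in RHS](inj_eq (@perm_inj _ t)) permKV.
    have := h (t x) => /eqP <-; apply/eqP.
    by apply: eq_card => y; rewrite !inE ffunE (inj_eq (@perm_inj _ t)).
  congr ((nat_of_bool _)%:R); apply: eq_forallb => x.
  by rewrite !ffunE (inj_eq (@perm_inj _ t)).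
move=> f f' e; apply/ffunP => y.
by have := congr1 (fun h : {ffun 'I_n -> 'I_n} => h y) e; rewrite !ffunE => /perm_inj.
Qed.

(* Induction on [sum_j j b_j]: sorting [b] decreases it, and if [b] is a partition,
   then [perm_char b] differs from [frob] by terms for which it is smaller. *)
Lemma perm_char_orth (b : 'I_n -> nat) : (\sum_j b j)%N = n ->
  \sum_s perm_char b s * ('chi_i s)^* = 0.
Proof.
move: {2}(\sum_(j < n) j * b j)%N (leqnn (\sum_(j < n) j * b j)%N) => m.
elim/ltn_ind: m b => m IH b le bn.
have IHs (b' : 'I_n -> nat) : (\sum_j b' j)%N = n ->
    (\sum_(j < n) j * b' j < \sum_(j < n) j * b j)%N -> \sum_s perm_char b' s * ('chi_i s)^* = 0.
  by move=> bn' lt; apply: (IH (\sum_(j < n) j * b' j)%N) => //; apply: leq_trans le.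
have [/existsP[j /andP[jn jlt]]|sb] :=
    boolP [exists j : 'I_n, (j.+1 < n)%N && (b j < b (inord j.+1))%N].
  pose t := tperm j (inord j.+1).
  under eq_bigr => s _ do rewrite -(perm_char_swap b t).
  apply: IHs; first by rewrite (sum_nat_perm t b).
  have j1 : (inord j.+1 : 'I_n) = j.+1 :> nat by rewrite inordK.
  have nj : inord j.+1 != j by rewrite -val_eqE /= j1; lia.
  rewrite (bigD1 j) // (bigD1 (inord j.+1)) // [X in (_ < X)%N](bigD1 j) //.
  rewrite [X in (_ < _ + X)%N](bigD1 (inord j.+1)) // /t tpermL tpermR !addnA.
  rewrite (eq_bigr (fun x : 'I_n => x * b x)%N).
    rewrite j1; have aux (a A B S : nat) : (A < B -> a * B + (a.+1 * A + S) < a * A + a.+1 * B + S)%N by nia.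
    exact: aux.
  by move=> x /andP[/andP[_ xj] xj1]; rewrite tpermD // eq_sym.
pose l := [seq b j | j <- enum 'I_n].
have ln x : nth 0%N l x = if (x < n)%N then b (inord x) else 0%N.
  case: ltnP => xn; last by rewrite nth_default // size_map size_enum_ord.
  rewrite (nth_map ord0) ?size_enum_ord //; congr b; apply: val_inj.
  by rewrite /= nth_enum_ord // inordK.
have so : sorted geq l.
  apply/(sortedP 0%N) => x; rewrite size_map size_enum_ord => xn.
  rewrite !ln xn (ltnW xn) /=; move: sb; rewrite negb_exists => /forallP/(_ (inord x)).
  by rewrite inordK ?(ltnW xn) // xn -leqNgt.
have laP : is_partition_of n (strip0 l).
  by rewrite /is_partition_of strip0_partition //= sumn_strip0 sumnE big_map big_enum bn.
have := frob_orth laP; under eq_bigr => s _ do rewrite frobE mulr_suml.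
rewrite exchange_big /= (bigD1 1%g) /=; last by apply/forallP => x; rewrite perm1 leq_addl.
rewrite odd_perm1 [X in _ + X]big1 ?addr0 => [|w /andP[/forallP lew w1]].
  move=> e0; rewrite -[RHS]e0; apply: eq_bigr => s _; rewrite mul1r; congr (perm_char _ s * _).
  by apply/funext => x; rewrite perm1 /beta_set addnK nth_strip0 // ln ltn_ord inord_val.
under eq_bigr => s _ do rewrite -mulrA.
have gE x : beta_set (strip0 l) x = (b x + staircase x)%N.
  by rewrite /beta_set nth_strip0 // ln ltn_ord inord_val.
rewrite -mulr_sumr IHs ?mulr0 //.
  apply/eqP; rewrite -(eqn_add2r (\sum_j staircase (w j))) -big_split /=.
  rewrite (eq_bigr (fun x => b x + staircase x)%N) => [|x _]; last by rewrite subnK ?lew // gE.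
  by rewrite big_split /= bn sum_nat_perm.
have := sum_mul_perm_lt w1.
have : (\sum_(j < n) j * (beta_set (strip0 l) j - staircase (w j)) + \sum_(j < n) j * j =
        \sum_(j < n) j * b j + \sum_(j < n) j * w j)%N.
  rewrite -!big_split; apply: eq_bigr => x _ /=; rewrite -!mulnDr; congr (_ * _)%N.
  have := lew x; rewrite gE /staircase; have := ltn_ord x; have := ltn_ord (w x).
  lia.
by do 4!move: (\sum_(_ < _) _)%N => ?; lia.
Qed.

Lemma irr_chiS_absurd : False.
Proof.
have := @perm_char_orth (fun=> 1%N); rewrite sum_nat_const card_ord muln1 => /(_ erefl).
rewrite (bigD1 1%g) //= [X in _ + X]big1 ?addr0 => [|s s1].
  move/eqP; rewrite mulf_eq0 conjC_eq0 (negPf (irr1_neq0 i)) orbF pnatr_eq0 => /eqP.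
  move/cards0_eq/setP/(_ [ffun x => x]); rewrite !inE => /negbT/negP[].
  apply/andP; split; apply/forallP => x; first by rewrite perm1.
  rewrite /fiber_card (_ : [set _ | _] = [set x]) ?cards1 //; apply/setP => y.
  by rewrite !inE ffunE.
rewrite /perm_char (_ : [set _ | _ & _] = set0) ?cards0 ?mul0r //; apply/setP => f.
rewrite !inE; apply/negP => /andP[/forallP fs /forallP f1].
case/eqP: s1; apply/permP => x; rewrite perm1.
have /cards1P[y /setP e] : #|[set z | f z == f x]| == 1%N by apply: f1.
have := e x; have := e (s x); rewrite !inE eqxx fs => /esym/eqP-> /esym/eqP->.
by [].
Qed.

End Complete.

Lemma irr_chiS n (i : Iirr (symS n)) : (0 < n)%N ->
  exists2 la, is_partition_of n la & 'chi_i = chiS n la.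
Proof.
case: n i => // n' i _; apply: contrapT => h; apply: (@irr_chiS_absurd n' i) => la laP.
by apply/eqP => e; apply: h; exists la.
Qed.

Lemma parts_inj n : injective (@parts n).
Proof.
by move=> la mu /(inj_map val_inj) /val_inj.
Qed.

Lemma parts_ex n la : is_partition_of n la -> exists c : partn_carrier n, parts c = la.
Proof.
move=> /andP[/andP[_ la0] /eqP s].
have sz : (size [seq inord x : 'I_n.+1 | x <- la] <= n)%N.
  rewrite size_map -s; elim: la la0 {s} => //= x la IH.
  rewrite inE negb_or eq_sym -lt0n => /andP[x0 /IH]; lia.
exists (Bseq sz); rewrite /parts /= -map_comp -[RHS]map_id; apply/eq_in_map => x xl /=.
rewrite inordK // ltnS -s; elim: la xl {la0 s sz} => //= y la IH.
by rewrite inE => /orP[/eqP->|/IH le]; [apply: leq_addr|apply: leq_trans le _; apply: leq_addl].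
Qed.

Lemma part_size n la : is_partition_of n la -> (size la <= n)%N.
Proof. by case/parts_ex => c <-; rewrite size_map size_bseq. Qed.

Lemma sum_chiS_irr n (F : 'CF(symS n) -> algC) : (0 < n)%N ->
  \sum_(la : partn_carrier n | is_partition_of n (parts la)) F (chiS n (parts la))
    = \sum_i F 'chi[symS n]_i.
Proof.
move=> n0; pose P := [set la : partn_carrier n | is_partition_of n (parts la)].
pose h (la : partn_carrier n) := cfIirr (chiS n (parts la)).
have hE la : la \in P -> 'chi_(h la) = chiS n (parts la).
  by rewrite inE => laP; apply/cfIirrE/chiS_irr.
have hI : {in P &, injective h}.
  move=> la mu laP muP e; apply: parts_inj; move: (laP) (muP); rewrite !inE => lP mP.
  by apply: (chiS_inj lP mP); rewrite -!hE // e.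
transitivity (\sum_(i in h @: P) F 'chi_i); last first.
  apply: eq_bigl => i; apply/imsetP; have [la laP e] := irr_chiS i n0.
  have [c cE] := parts_ex laP; exists c; first by rewrite inE cE.
  by apply: irr_inj; rewrite hE ?inE ?cE.
rewrite big_imset //=; apply: eq_big => [la|la laP]; first by rewrite inE.
by rewrite hE ?inE.
Qed.

(** * Murnaghan-Nakayama rule and balanced partitions *)

(* The coefficient of [x^g] in the product of the Vandermonde alternant with the
   power sums of degrees [t 0, ..., t (l - 1)]. *)
Definition pow_coef (k l : nat) (t : 'I_l -> nat) (g : 'I_k -> nat) : algC :=
  \sum_(c : {ffun 'I_l -> 'I_k}) alt_coef g (fun i => \sum_(j | c j == i) t j)%N.

Lemma pow_coef_perm k l (t : 'I_l -> nat) (p : 'S_l) (g : 'I_k -> nat) :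
  pow_coef (fun j => t (p j)) g = pow_coef t g.
Proof.
rewrite /pow_coef (reindex_inj (h := fun c : {ffun 'I_l -> 'I_k} => [ffun y => c (p y)])) /=.
  apply: eq_bigr => c _; congr alt_coef; apply/funext => i.
  rewrite [RHS](reindex_inj (@perm_inj _ p)) /=.
  by apply: eq_bigl => j; rewrite ffunE.
move=> f f' e; apply/ffunP => y.
have := congr1 (fun h : {ffun 'I_l -> 'I_k} => h (p^-1%g y)) e.
by rewrite !ffunE permKV.
Qed.

Lemma frob_porbits n k (g : 'I_k -> nat) (s : 'S_n.+1) :
  frob g s = pow_coef (fun j : 'I_#|porbits s| => #|(enum_val j : {set 'I_n.+1})|) g.
Proof.
set P := porbits s.
have PM x : porbit s x \in P by apply: imset_f.
pose idx x : 'I_#|P| := enum_rank_in (PM ord0) (porbit s x).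
have idxK x : enum_val (idx x) = porbit s x by apply: enum_rankK_in.
have PR (j : 'I_#|P|) : porbit s (repr (enum_val j : {set 'I_n.+1})) = enum_val j.
  have : enum_val j \in porbits s := enum_valP j; rewrite {1}/porbits => /imsetP[x _ e]; rewrite e.
  apply/eqP; rewrite eq_porbit_mem; apply: (mem_repr x); exact: porbit_id.
have idxR (j : 'I_#|P|) : idx (repr (enum_val j : {set 'I_n.+1})) = j.
  by apply: enum_val_inj; rewrite idxK PR.
pose F (c : {ffun 'I_#|P| -> 'I_k}) := [ffun x => c (idx x)].
pose H (f : {ffun 'I_n.+1 -> 'I_k}) := [ffun j : 'I_#|P| => f (repr (enum_val j : {set 'I_n.+1}))].
rewrite /frob (reindex F) /=; last first.
  exists H => [c _|f]; first by apply/ffunP => j; rewrite !ffunE idxR.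
  rewrite inE => /forallP fs; apply/ffunP => x; rewrite !ffunE idxK.
  have : repr (porbit s x) \in porbit s x by apply: (mem_repr x); exact: porbit_id.
  case/porbitP => i ->; elim: i => [|i IH]; first by rewrite expg0 perm1.
  by rewrite expgSr permM (eqP (fs _)).
rewrite /pow_coef; apply: eq_big => [c|c _].
  apply/forallP => x; rewrite !ffunE; apply/eqP; congr (c _); apply: enum_val_inj.
  by rewrite !idxK; apply/eqP; rewrite eq_porbit_mem; exact: (mem_porbit s 1 x).
congr alt_coef; apply/funext => i.
rewrite /fiber_card -sum1_card (partition_big idx (fun j => c j == i)) /=.
  apply: eq_bigr => j /eqP cj; rewrite -[RHS]sum1_card; apply: eq_bigl => x.
  rewrite !inE ffunE; apply/andP/idP => [[_ /eqP <-]|xj].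
    by rewrite idxK porbit_id.
  have ij : idx x = j.
    by apply: enum_val_inj; rewrite idxK -PR; apply/eqP; rewrite eq_porbit_mem PR.
  by rewrite ij cj.
by move=> x; rewrite inE ffunE.
Qed.

Lemma frob_cycle_class n k (g : 'I_k -> nat) (eta : seq nat) (s : 'S_n.+1) :
  s \in cycle_class n.+1 eta -> frob g s = pow_coef (fun j : 'I_(size eta) => nth 0%N eta j) g.
Proof.
rewrite inE => pe; rewrite frob_porbits.
have sz : #|porbits s| = size eta by rewrite -(perm_size pe) size_map cardE.
have szl : size [seq #|(X : {set 'I_n.+1})| | X <- enum (porbits s)] == size eta.
  by rewrite (perm_size pe).
have /tuple_permP[p hp] : perm_eq (Tuple szl) (in_tuple eta) by [].
have tE (j : 'I_(size eta)) :
    nth 0%N [seq #|(X : {set 'I_n.+1})| | X <- enum (porbits s)] j = nth 0%N eta (p j).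
  by rewrite [in LHS]hp nth_mktuple (tnth_nth 0%N).
rewrite -(pow_coef_perm _ p) -(_ : (fun j : 'I_(size eta) =>
    nth 0%N [seq #|(X : {set 'I_n.+1})| | X <- enum (porbits s)] j) =
    (fun j => nth 0%N eta (p j))); last by apply/funext.
rewrite (_ : (fun j => _) = fun j : 'I_#|porbits s| =>
   nth 0%N [seq #|(X : {set 'I_n.+1})| | X <- enum (porbits s)] j); last first.
  apply/funext => j; rewrite (nth_map set0) -?cardE //.
  by rewrite (enum_val_nth set0).
move: (nth 0%N _) => f.
by move: sz; move: #|porbits s| => l ->.
Qed.

Lemma pow_coef_comp k l (t : 'I_l -> nat) (g : 'I_k -> nat) (p : 'S_k) :
  pow_coef t (g \o p) = (-1) ^+ odd_perm p * pow_coef t g.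
Proof.
rewrite /pow_coef mulr_sumr.
rewrite [RHS](reindex_inj (h := fun c : {ffun 'I_l -> 'I_k} => [ffun y => p (c y)])) /=.
  apply: eq_bigr => c _; rewrite -alt_coef_perm; congr alt_coef; apply/funext => i.
  by apply: eq_bigl => j; rewrite ffunE (inj_eq (@perm_inj _ p)).
move=> f f' e; apply/ffunP => y.
by have := congr1 (fun h : {ffun 'I_l -> 'I_k} => h y) e; rewrite !ffunE => /perm_inj.
Qed.

(* The recursive form of the Murnaghan-Nakayama rule, in terms of beta-numbers. *)
Lemma pow_coefS k l (t : 'I_l.+1 -> nat) (g : 'I_k -> nat) :
  pow_coef t g = \sum_(i | (t ord0 <= g i)%N)
    pow_coef (fun j => t (lift ord0 j)) (fun i' => g i' - (if i' == i then t ord0 else 0))%N.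
Proof.
rewrite /pow_coef big_ffun_cons [RHS]big_mkcond /=; apply: eq_bigr => i _.
have aE (c : {ffun 'I_l -> 'I_k}) :
    alt_coef g (fun i' => \sum_(j | ffun_cons i c j == i') t j)%N =
    if (t ord0 <= g i)%N then
      alt_coef (fun i' => g i' - (if i' == i then t ord0 else 0))%N
               (fun i' => \sum_(j | c j == i') t (lift ord0 j))%N else 0.
  have -> : (t ord0 <= g i)%N = [forall i', (if i' == i then t ord0 else 0) <= g i']%N.
    apply/idP/forallP => [h i'|/(_ i)]; last by rewrite eqxx.
    by case: eqP => [->|].
  rewrite -alt_coefD; congr alt_coef; apply/funext => i'.
  rewrite big_mkcond big_ord_recl ffun_cons0 eq_sym; congr addn.
  rewrite [RHS]big_mkcond; apply: eq_bigr => j _; by rewrite ffun_consS.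
by under eq_bigr => c _ do rewrite aE; case: ifP => // _; rewrite big1.
Qed.

Lemma pow_coef_repeat k l (t : 'I_l -> nat) (g : 'I_k -> nat) (i j : 'I_k) :
  i != j -> g i = g j -> pow_coef t g = 0.
Proof.
move=> ij gij; have := pow_coef_comp t g (tperm i j).
rewrite odd_tperm ij expr1 mulN1r (_ : g \o _ = g); last first.
  by apply/funext => x /=; case: tpermP => [->|->|].
by move/eqP; rewrite -addr_eq0 -mulr2n mulrn_eq0 => /eqP.
Qed.

Lemma diagram_strip0 s c : sorted geq s -> diagram (strip0 s) c = (c.2 < nth 0%N s c.1)%N.
Proof. by move=> so; rewrite /diagram /= nth_strip0. Qed.

Section Balanced.
Variable k : nat.
Local Notation mk la := (mkseq la k).
Local Notation g la := (fun i : 'I_k => la (val i) + staircase i)%N.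

Lemma sorted_mkseq (la : nat -> nat) : (forall i, la i.+1 <= la i)%N -> sorted geq (mk la).
Proof.
move=> la_ni; apply/(sortedP 0%N) => i; rewrite size_mkseq => ik.
by rewrite !nth_mkseq ?(ltnW ik) //=; apply: la_ni.
Qed.

Lemma nth_mk (la : nat -> nat) i : (forall i, k <= i -> la i = 0)%N -> nth 0%N (mk la) i = la i.
Proof.
move=> la_k; case: (ltnP i k) => ik; first by rewrite nth_mkseq.
by rewrite nth_default ?size_mkseq // la_k.
Qed.

Lemma balanced_add (la mu : nat -> nat) (c d : nat * nat) :
  (forall i, la i.+1 <= la i)%N -> (forall i, mu i.+1 <= mu i)%N ->
  (forall i, k <= i -> la i = 0)%N -> (forall i, k <= i -> mu i = 0)%N ->
  domino c d -> (forall i j, (j < la i) = (j < mu i) || ((i, j) \in [:: c; d]))%N ->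
  (mu c.1 <= c.2)%N -> (mu d.1 <= d.2)%N ->
  balanced (strip0 (mk mu)) -> balanced (strip0 (mk la)).
Proof.
move=> la_ni mu_ni la_k mu_k cd hla cmu dmu; move/balanced_domino; apply.
  by apply/strip0_partition/sorted_mkseq.
have D nu x : (forall i, nu i.+1 <= nu i)%N -> (forall i, k <= i -> nu i = 0)%N ->
    diagram (strip0 (mk nu)) x = (x.2 < nu x.1)%N.
  by move=> h1 h2; rewrite diagram_strip0 ?nth_mk //; apply: sorted_mkseq.
exists c, d; split=> //; rewrite ?D //; [by rewrite ltnNge cmu|by rewrite ltnNge dmu|].
apply/funext => -[i j]; apply/propext; rewrite D //= hla; split.
  case/orP => [h|]; first by left; rewrite D.
  by rewrite !inE => /orP[/eqP->|/eqP->]; right; [left|right].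
case=> [|[->|->]]; first by rewrite D //= => ->.
  by rewrite !inE eqxx orbT.
by rewrite !inE eqxx !orbT.
Qed.

Lemma pow_coef2_balanced N (la : nat -> nat) :
  (forall i, la i.+1 <= la i)%N -> (forall i, k <= i -> la i = 0)%N ->
  pow_coef (fun _ : 'I_N => 2%N) (g la) != 0 -> balanced (strip0 (mk la)).
Proof.
elim: N la => [|N IH] la la_ni la_k nz.
  suff h i : (i < k)%N -> la i = 0%N.
    rewrite (_ : strip0 _ = [::]); first exact: balanced_nil.
    rewrite /strip0 (eq_in_filter (a2 := pred0)) ?filter_pred0 // => x /mapP[i].
    by rewrite mem_iota => /andP[_ /h ->] ->.
  have h : alt_coef (g la) (fun=> 0%N) != 0.
    move: nz; apply: contraNN => /eqP a0; rewrite /pow_coef big1 // => c _.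
    rewrite -[RHS]a0; congr alt_coef; apply/funext => x; by rewrite big1 // => -[].
  have [w /forallP hw] : exists w : 'S_k, [forall i : 'I_k, la i + staircase i == 0 + staircase (w i)]%N.
    apply/existsP; apply: contraNT h; rewrite negb_exists => /forallP h.
    by apply/eqP/big1 => w _; rewrite (negPf (h w)) mulr0.
  move=> ik; apply/eqP; rewrite -leqn0.
  have <- : (\sum_(x < k) la x = 0)%N.
    apply/eqP; rewrite -(eqn_add2r (\sum_(x < k) staircase x)) -big_split /=.
    by rewrite (eq_bigr _ (fun x _ => eqP (hw x))) /= (sum_nat_perm w (@staircase k)).
  by rewrite (bigD1 (Ordinal ik)) //= leq_addr.
move: nz; rewrite pow_coefS => nz.
have [i /andP[gi nzi]] : exists i : 'I_k, (2 <= la i + staircase i)%N &&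
   (pow_coef (fun _ : 'I_N => 2%N)
      (fun i' => la i' + staircase i' - (if i' == i then 2 else 0))%N != 0).
  apply/existsP; apply: contraNT nz; rewrite negb_exists => /forallP h.
  by apply/eqP/big1 => i gi; have := h i; rewrite gi /= negbK => /eqP.
set g' := (fun i' : 'I_k => _) in nzi.
have lai2 (j : nat) : (i <= j)%N -> (la j <= la i)%N := @la_noninc_le la la_ni i j.
have [ca|ca] := leqP (la i.+1).+2 (la i).
  pose mu (j : nat) := if j == i :> nat then (la i - 2)%N else la j.
  have mu_ni j : (mu j.+1 <= mu j)%N.
    rewrite /mu; case: (eqVneq j.+1 (val i)) => [e|_].
      rewrite (_ : (j == i :> nat) = false) -?e; last by lia.
      by rewrite e; have := la_ni j; rewrite e; lia.
    case: eqP => [->|_]; last exact: la_ni.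
    lia.
  have mu_k j : (k <= j)%N -> mu j = 0%N.
    move=> kj; rewrite /mu (la_k j) //; case: (j =P val i) => // e; by move: kj; rewrite e leqNgt ltn_ord.
  apply: (@balanced_add la mu (val i, la i - 2)%N (val i, la i - 1)%N) => //.
  - by left; split=> //=; lia.
  - move=> a b; rewrite /mu !inE !xpair_eqE; case: eqP => [->|_] /=; last by rewrite orbF.
    lia.
  - by rewrite /mu eqxx.
  - by rewrite /mu eqxx /=; lia.
  apply: IH => //; move: nzi; congr (pow_coef _ _ != 0); apply/funext => j.
  rewrite /g' /mu -val_eqE /=; case: eqP => [->|_]; last by rewrite subn0.
  lia.
have ik : (i.+1 < k)%N.
  rewrite ltn_neqAle ltn_ord andbT; apply/eqP => e.
  have l0 : la i.+1 = 0%N by apply: la_k; rewrite e.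
  by move: ca gi e; rewrite l0 /staircase; clear; lia.
pose j := Ordinal ik.
have ij : i != j by rewrite -val_eqE /=; lia.
have g'i : g' i = (la i + staircase i - 2)%N by rewrite /g' eqxx.
have g'j : g' j = (la i.+1 + staircase j)%N by rewrite /g' eq_sym (negPf ij) subn0.
have stE : staircase i = (staircase j).+1 by rewrite /staircase /=; lia.
have [e1|e1] := eqVneq (la i) (la i.+1).+1.
  by case/eqP: nzi; apply: (@pow_coef_repeat _ _ _ _ i j) => //; rewrite g'i g'j stE e1; lia.
have {e1 ca} e1 : la i.+1 = la i by have := la_ni i; lia.
have e2 : (la i.+2 < la i)%N.
  rewrite ltn_neqAle -{2}e1 la_ni andbT; apply/eqP => e2.
  case: (ltnP i.+2 k) => i2; last first.
    move: gi; rewrite -e2 la_k // /staircase; have := ltn_ord i; lia.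
  have il : i != Ordinal i2 by rewrite -val_eqE /=; lia.
  case/eqP: nzi; apply: (@pow_coef_repeat _ _ _ _ i (Ordinal i2)) => //.
  rewrite g'i /g' eq_sym (negPf il) subn0 /= e2.
  rewrite /staircase /=; lia.
pose mu (a : nat) := if (a == i :> nat) || (a == i.+1) then (la i - 1)%N else la a.
have mu_ni a : (mu a.+1 <= mu a)%N.
  rewrite /mu eqSS; case: (eqVneq a (val i)) => [->|ai]; first by rewrite orbT.
  rewrite orbF; case: eqP => [e|_].
    case: ifP => //; have := la_ni a; rewrite e; lia.
  case: eqP => [->|_] /=; [lia | exact: la_ni].
have mu_k a : (k <= a)%N -> mu a = 0%N.
  move=> ka; rewrite /mu (la_k a) //; case: ifP => // /orP[]/eqP e; have := ltn_ord i; lia.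
apply: (@balanced_add la mu (val i, la i - 1)%N (i.+1, la i - 1)%N) => //.
- by right.
- move=> a b; rewrite /mu !inE !xpair_eqE.
  case: (eqVneq a (val i)) => [->|ai] /=; first by rewrite (_ : (i == i.+1 :> nat) = false) /=; lia.
  case: eqP => [->|_] /=; last by rewrite orbF.
  rewrite e1; lia.
- by rewrite /mu eqxx.
- by rewrite /mu eqxx orbT.
apply: IH => //.
have : pow_coef (fun _ : 'I_N => 2%N) (g' \o tperm i j) != 0.
  by rewrite pow_coef_comp mulf_eq0 signr_eq0.
congr (pow_coef _ _ != 0); apply/funext => a /=; rewrite /mu.
case: tpermP => [->|->|/eqP ai /eqP aj].
- by rewrite g'j eqxx /= e1 stE; lia.
- by rewrite g'i /= eqxx orbT stE; lia.
rewrite /g' (negPf ai) subn0; move: ai aj; rewrite -!val_eqE /= => /negPf-> /negPf->.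
by [].
Qed.
End Balanced.

Lemma chiS_cycle_class n la eta (s t : 'S_n) : (0 < n)%N -> is_partition_of n la ->
  s \in cycle_class n eta -> t \in cycle_class n eta -> chiS n la s = chiS n la t.
Proof.
case: n s t => // n s t _ laP sC tC; have lak := part_size laP.
by rewrite !(chiS_frob laP lak) (frob_cycle_class _ sC) (frob_cycle_class _ tC).
Qed.

Lemma chiS_involution_balanced n la N (s : 'S_n) : (0 < n)%N -> is_partition_of n la ->
  s \in cycle_class n (nseq N 2%N) -> chiS n la s != 0 -> balanced la.
Proof.
case: n s => // n s _ laP sC; have lak := part_size laP.
rewrite (chiS_frob laP lak) (frob_cycle_class _ sC) => nz.
have la_k i : (n.+1 <= i)%N -> nth 0%N la i = 0%N.
  by move=> ni; rewrite nth_default // (leq_trans lak).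
have /andP[/andP[_ la0] _] := laP.
have -> : la = strip0 (mkseq (nth 0%N la) n.+1).
  rewrite -(subnKC lak) /mkseq iotaD map_cat add0n /strip0 filter_cat.
  rewrite -/(mkseq (nth 0%N la) (size la)) mkseq_nth.
  rewrite (eq_in_filter (a2 := predT)) ?filter_predT => [|x xl]; last first.
    by rewrite /= lt0n; apply: contraNneq la0 => <-.
  rewrite (eq_in_filter (a2 := pred0)) ?filter_pred0 ?cats0 // => x /mapP[i].
  by rewrite mem_iota => /andP[il _] ->; rewrite nth_default.
apply: (@pow_coef2_balanced n.+1 N (nth 0%N la)) => //.
  by move=> i; apply: (nth_part_mono laP).
move: nz; rewrite size_nseq.
rewrite (_ : (fun j : 'I_N => _) = (fun=> 2%N)) //.
by apply/funext => j; rewrite nth_nseq ltn_ord.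
Qed.

(** * The pillowcase mean as a ratio of numbers of factorizations *)

Lemma cycle_class_conj n eta (s t : 'S_n) : s \in cycle_class n eta -> (s ^ t)%g \in cycle_class n eta.
Proof.
rewrite !inE; apply: perm_trans.
have tI := @perm_inj _ t.
have pE x : porbit (s ^ t) (t x) = t @: porbit s x.
  apply/setP => y; apply/porbitP/imsetP => [[i ->]|[z /porbitP[i ->] ->]].
    by exists ((s ^+ i)%g x); [apply: mem_porbit|rewrite -conjXg conjgE !permM permK].
  by exists i; rewrite -conjXg conjgE !permM permK.
have PE : porbits (s ^ t) = [set t @: (X : {set 'I_n}) | X in porbits s].
  apply/setP => X; apply/imsetP/imsetP => [[y _ ->]|[_ /imsetP[x _ ->] ->]].
    exists (porbit s (t^-1%g y)); first exact: imset_f.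
    by rewrite -pE permKV.
  by exists (t x); rewrite ?pE.
have FI : injective (fun X : {set 'I_n} => t @: X) by apply: imset_inj.
rewrite PE; have /perm_map pe : perm_eq (enum [set t @: (X : {set 'I_n}) | X in porbits s])
    [seq t @: (X : {set 'I_n}) | X : {set 'I_n} <- enum (porbits s)].
  apply: uniq_perm; [exact: enum_uniq|by rewrite map_inj_uniq ?enum_uniq|].
  by move=> Y; rewrite mem_enum; apply/imsetP/mapP => -[X XP ->]; exists X; rewrite ?mem_enum // -mem_enum.
apply: perm_trans (pe _ (fun X : {set 'I_n} => #|X|)) _; rewrite -map_comp.
by rewrite (eq_map (g := fun X : {set 'I_n} => #|X|)) => // X /=; rewrite card_imset.
Qed.

Section ClassSum.
Variables (gT : finGroupType) (G : {group gT}).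
Implicit Types K : {set gT}.

Lemma irr_class_sum (i : Iirr G) K y : K \subset G ->
  (forall x g, x \in K -> g \in G -> (x ^ g)%g \in K) -> y \in G ->
  \sum_(x in K) 'chi_i (x * y)%g = (\sum_(x in K) 'chi_i x) / 'chi_i 1%g * 'chi_i y.
Proof.
move=> KG KJ Gy; pose M := \sum_(x in K) 'Chi_i x.
have /is_scalar_mxP[a Ma] : is_scalar_mx M.
  apply: mx_abs_irr_cent_scalar 'Chi_i _ _ _; first exact/groupC/socle_irr.
  apply/centgmxP => g Gg; rewrite /M mulmx_suml mulmx_sumr.
  rewrite [RHS](reindex_inj (conjg_inj g)) /=; apply: eq_big => [x|x xK].
    apply/idP/idP => h; first exact: KJ.
    by rewrite -(conjgK g x) KJ ?groupV.
  have Gx : x \in G by rewrite (subsetP KG).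
  by rewrite -!repr_mxM ?groupJ // conjgE !mulgA mulgV mul1g.
have chiE x : x \in G -> 'chi_i x = \tr ('Chi_i x) by move=> Gx; rewrite -irrRepr cfunE Gx mulr1n.
have e (z : gT) : z \in G -> \sum_(x in K) 'chi_i (x * z)%g = a * 'chi_i z.
  move=> Gz; transitivity (\tr (M *m 'Chi_i z)).
    rewrite /M mulmx_suml raddf_sum; apply: eq_bigr => x /(subsetP KG) Gx.
    by rewrite /= -repr_mxM // chiE ?groupM.
  by rewrite Ma mul_scalar_mx mxtraceZ chiE.
rewrite e //; congr (_ * _).
have := e 1%g (group1 _); under eq_bigr => x _ do rewrite mulg1.
by move=> ->; rewrite mulfK ?irr1_neq0.
Qed.

Lemma sum_irr1 (g : gT) : \sum_i 'chi[G]_i 1%g * 'chi_i g = #|G|%:R *+ (g == 1%g).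
Proof.
by rewrite -cfRegE cfReg_sum sum_cfunE; apply: eq_bigr => i _; rewrite cfunE.
Qed.

Lemma frobenius_count4 K1 K2 K3 K4 :
  (forall K, K \in [:: K1; K2; K3; K4] -> K \subset G /\
     (forall x g, x \in K -> g \in G -> (x ^ g)%g \in K)) ->
  \sum_i 'chi[G]_i 1%g ^+ 2 * \prod_(K <- [:: K1; K2; K3; K4])
     ((\sum_(x in K) 'chi_i x) / 'chi_i 1%g) =
  #|G|%:R * (\sum_(x1 in K1) \sum_(x2 in K2)
     #|[set x3 in K3 | (x1 * x2 * x3)^-1%g \in K4]|)%:R.
Proof.
move=> KP; have sub K : K \in [:: K1; K2; K3; K4] -> forall x, x \in K -> x \in G.
  by move=> /KP[/subsetP].
have k1 : K1 \in [:: K1; K2; K3; K4] by rewrite !inE eqxx.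
have k2 : K2 \in [:: K1; K2; K3; K4] by rewrite !inE eqxx orbT.
have k3 : K3 \in [:: K1; K2; K3; K4] by rewrite !inE eqxx !orbT.
have k4 : K4 \in [:: K1; K2; K3; K4] by rewrite !inE eqxx !orbT.
transitivity (\sum_i 'chi[G]_i 1%g * \sum_(x4 in K4) \sum_(x3 in K3) \sum_(x2 in K2)
    \sum_(x1 in K1) 'chi_i (x1 * (x2 * (x3 * (x4 * 1))))%g).
  apply: eq_bigr => i _; pose om (K : {set gT}) := (\sum_(x in K) 'chi_i x) / 'chi_i 1%g.
  have st K y : K \in [:: K1; K2; K3; K4] -> y \in G ->
      \sum_(x in K) 'chi_i (x * y)%g = om K * 'chi_i y.
    by move=> /KP[KG KJ] Gy; apply: irr_class_sum.
  rewrite (eq_bigr (fun x4 => om K1 * (om K2 * (om K3 * 'chi_i (x4 * 1)%g)))) => [|x4 h4].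
    rewrite -!mulr_sumr st // !big_cons big_nil -/(om K1) -/(om K2) -/(om K3) -/(om K4).
    by do 4!move: (om _) => ?; ring.
  have G4 : x4 \in G by apply: sub h4.
  rewrite (eq_bigr (fun x3 => om K1 * (om K2 * 'chi_i (x3 * (x4 * 1))%g))) => [|x3 h3].
    by rewrite -!mulr_sumr st ?groupM.
  have G3 : x3 \in G by apply: sub h3.
  rewrite (eq_bigr (fun x2 => om K1 * 'chi_i (x2 * (x3 * (x4 * 1)))%g)) => [|x2 h2].
    by rewrite -!mulr_sumr st ?groupM.
  have G2 : x2 \in G by apply: sub h2.
  by rewrite st ?groupM.
rewrite (eq_bigr (fun i => \sum_(x4 in K4) \sum_(x3 in K3) \sum_(x2 in K2)
    \sum_(x1 in K1) 'chi[G]_i 1%g * 'chi_i (x1 * (x2 * (x3 * (x4 * 1))))%g)); last first.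
  move=> i _; rewrite mulr_sumr; apply: eq_bigr => x4 _.
  rewrite mulr_sumr; apply: eq_bigr => x3 _; rewrite mulr_sumr; apply: eq_bigr => x2 _.
  by rewrite mulr_sumr.
transitivity (\sum_(x1 in K1) \sum_(x2 in K2) \sum_(x3 in K3) \sum_(x4 in K4)
    (#|G|%:R *+ (x1 * x2 * x3 * x4 == 1)%g : algC)).
  have ex4 (F : gT -> gT -> gT -> gT -> algC) :
      \sum_(x4 in K4) \sum_(x3 in K3) \sum_(x2 in K2) \sum_(x1 in K1) F x1 x2 x3 x4 =
      \sum_(x1 in K1) \sum_(x2 in K2) \sum_(x3 in K3) \sum_(x4 in K4) F x1 x2 x3 x4.
    rewrite exchange_big [RHS]exchange_big /=.
    rewrite (eq_bigr (fun x3 => \sum_(x2 in K2) \sum_(x1 in K1) \sum_(x4 in K4) F x1 x2 x3 x4)).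
      rewrite exchange_big; apply: eq_bigr => x2 _; exact: exchange_big.
    move=> x3 _; rewrite exchange_big; apply: eq_bigr => x2 _; exact: exchange_big.
  rewrite -ex4 exchange_big; apply: eq_bigr => x4 _.
  rewrite exchange_big; apply: eq_bigr => x3 _; rewrite exchange_big; apply: eq_bigr => x2 _.
  by rewrite exchange_big; apply: eq_bigr => x1 _; rewrite sum_irr1 mulg1 !mulgA.
rewrite natr_sum mulr_sumr; apply: eq_bigr => x1 _.
rewrite natr_sum mulr_sumr; apply: eq_bigr => x2 _.
rewrite -[#|[set _ in _ | _]|]sum1_card [X in _ = _ * X]natr_sum mulr_sumr.
rewrite [RHS]big_mkcond [LHS]big_mkcond; apply: eq_bigr => x3 _.
rewrite inE; case: (x3 \in K3) => //=; rewrite mulr1.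
case: ifP => h.
  rewrite (bigD1 (x1 * x2 * x3)^-1%g) //= mulgV eqxx big1 ?addr0 // => x4 /andP[_ ne].
  case: (_ =P 1%g) => // e; case/eqP: ne; apply: (mulgI (x1 * x2 * x3)%g).
  by rewrite e mulgV.
rewrite big1 // => x4 x4K; case: eqP => // e; move/negP: h; case.
by rewrite (_ : _^-1%g = x4) //; apply: (mulgI (x1 * x2 * x3)%g); rewrite e mulgV.
Qed.
End ClassSum.

Definition fpf_class (n : nat) : {set 'S_n} := cycle_class n (nseq n./2 2%N).

Definition quad_count (n : nat) (K : {set 'S_n}) : nat :=
  (\sum_(x1 in fpf_class n) \sum_(x2 in fpf_class n)
     #|[set x3 in fpf_class n | (x1 * x2 * x3)^-1%g \in K]|)%N.

Lemma fSE n eta la : (0 < n)%N -> is_partition_of n la ->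
  fS n eta la = (\sum_(x in cycle_class n eta) chiS n la x) / chiS n la 1%g.
Proof.
move=> n0 laP; rewrite /fS /dimS; congr (_ / _).
rewrite mulr_natl -sumr_const; apply: eq_bigr => x xK.
apply: (chiS_cycle_class n0 laP (eta := eta)) => //; exact: mem_repr xK.
Qed.

Lemma sum_balanced n eta : (0 < n)%N ->
  \sum_(la : partn_carrier n | balanced_partition_of n (parts la))
     (dimS n (parts la) / n`!%:R) ^+ 2 *
       (fS n (nseq n./2 2%N) (parts la) ^+ 3 * fS n eta (parts la)) =
  (quad_count (cycle_class n eta))%:R / n`!%:R.
Proof.
move=> n0; pose om (phi : 'CF(symS n)) (K : {set 'S_n}) := (\sum_(x in K) phi x) / phi 1%g.
pose F (phi : 'CF(symS n)) := (phi 1%g / n`!%:R) ^+ 2 *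
   (om phi (fpf_class n) ^+ 3 * om phi (cycle_class n eta)).
have nf0 : n`!%:R != 0 :> algC by rewrite pnatr_eq0 -lt0n fact_gt0.
transitivity (\sum_(la : partn_carrier n | is_partition_of n (parts la)) F (chiS n (parts la))).
  rewrite big_mkcond [RHS]big_mkcond; apply: eq_bigr => la _.
  rewrite /balanced_partition_of; case laP : (is_partition_of n (parts la)) => //=.
  rewrite /F /om -!fSE //; case: asboolP => // nb.
  suff -> : fS n (nseq n./2 2%N) (parts la) = 0 by rewrite expr0n mul0r mulr0.
  rewrite fSE // big1 ?mul0r // => x xK; apply/eqP; apply: contra_notT nb => nz.
  exact: chiS_involution_balanced xK nz.
rewrite sum_chiS_irr //; pose K2 := fpf_class n.
have := @frobenius_count4 _ (symS n) K2 K2 K2 (cycle_class n eta).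
rewrite -/(quad_count _) cardsT card_Sn => h.
transitivity (n`!%:R ^- 2 * (n`!%:R * (quad_count (cycle_class n eta))%:R : algC)).
  rewrite -h => [|K].
    rewrite mulr_sumr; apply: eq_bigr => i _; rewrite !big_cons big_nil /F /om -/K2.
    by rewrite expr_div_n; ring.
  have cl e : cycle_class n e \subset symS n /\ (forall x g, x \in cycle_class n e ->
      g \in symS n -> (x ^ g)%g \in cycle_class n e).
    by split=> [|x g xK _]; [exact: subsetT|exact: cycle_class_conj].
  by rewrite !inE => /or4P[]/eqP->; apply: cl.
by field.
Qed.

Lemma pillowcase_mean_gS n nu : (0 < n)%N ->
  pillowcase_mean n (gS n nu) =
    (quad_count (cycle_class n (complete2 n nu)))%:R / (quad_count (fpf_class n))%:R.
Proof.
move=> n0; have nf0 : n`!%:R != 0 :> algC by rewrite pnatr_eq0 -lt0n fact_gt0.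
have den : \sum_(la : partn_carrier n | balanced_partition_of n (parts la)) wS n (parts la) =
    (quad_count (fpf_class n))%:R / n`!%:R.
  by rewrite -sum_balanced //; apply: eq_bigr => la _; rewrite /wS -exprSr.
have num : \sum_(la : partn_carrier n | balanced_partition_of n (parts la))
    wS n (parts la) * gS n nu (parts la) =
    (quad_count (cycle_class n (complete2 n nu)))%:R / n`!%:R.
  rewrite -sum_balanced //; apply: eq_bigr => la _; rewrite /wS /gS.
  have [->|f0] := eqVneq (fS n (nseq n./2 2%N) (parts la)) 0.
    by rewrite !expr0n !mulr0 !mul0r mulr0.
  rewrite -mulrA; congr (_ * _); rewrite exprSr -mulrA; congr (_ * _).
  by rewrite mulrCA mulfV // mulr1.
by rewrite /pillowcase_mean num den invfM invrK mulrACA mulVf // mulr1.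
Qed.

Local Close Scope ring_scope.

Lemma card_porbit_pred (T : finType) (p : {perm T}) (P : pred {set T}) :
  #|[set x | P (porbit p x)]| = \sum_(X in porbits p | P X) #|X|.
Proof.
rewrite -sum1_card (partition_big (porbit p) (fun X => (X \in porbits p) && P X)) /=.
  apply: eq_bigr => X /andP[/imsetP[y _ ->] PX]; rewrite -sum1_card; apply: eq_bigl => x.
  rewrite !inE; apply/andP/idP => [[_ /eqP <-]|]; first exact: porbit_id.
  by rewrite -eq_porbit_mem => /eqP->; rewrite PX.
by move=> x; rewrite inE => ->; rewrite imset_f.
Qed.

Lemma card_porbit2 (T : finType) (p : {perm T}) x :
  (#|porbit p x| == 2) = (p (p x) == x) && (p x != x).
Proof.
have u := uniq_traject_porbit p x; have it := iter_porbit p x.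
apply/eqP/andP => [e|[/eqP ppx px]].
  rewrite e /= in u it; rewrite it; split=> //.
  by move: u; rewrite inE andbT eq_sym.
have sub : porbit p x \subset [set x; p x].
  apply/subsetP => y /porbitP[i ->]; elim: i => [|i IH]; first by rewrite expg0 perm1 !inE eqxx.
  rewrite expgSr permM; move: IH; rewrite !inE => /orP[]/eqP->; rewrite ?eqxx ?orbT //.
  by rewrite ppx eqxx.
have := subset_leq_card sub; rewrite cards2 eq_sym px /= => le.
apply/eqP; rewrite eqn_leq le /= ltnNge; apply/negP => le1.
move: it; have := card_porbit_neq0 p x; case: (#|_|) le1 => [|[|]] //= _ _ e.
by rewrite e eqxx in px.
Qed.

Lemma fpf_class_perm n (p : 'S_n) : ~~ odd n -> (p \in fpf_class n) = fpf_perm p.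
Proof.
move=> en; rewrite inE; apply/idP/forallP => [pe x|h].
  rewrite -card_porbit2; have : #|porbit p x| \in nseq n./2 2.
    by rewrite -(perm_mem pe); apply: map_f; rewrite mem_enum imset_f.
  by rewrite mem_nseq => /andP[].
set l := map _ _; have l2 : all (pred1 2) l.
  apply/allP => _ /mapP[X + ->]; rewrite mem_enum => /imsetP[x _ ->] /=.
  by rewrite card_porbit2 h.
have /all_pred1P le := l2; rewrite [l]le.
suff -> : size l = n./2 by [].
have := card_porbit_pred p predT; rewrite cardsE card_ord -big_enum_cond /=.
have -> : \sum_(X <- enum (porbits p) | true) #|X| = sumn l by rewrite sumnE big_map.
have -> : sumn l = (size l).*2 by rewrite {1}le sumn_nseq mul2n.
by move=> e; rewrite [RHS](congr1 half e) doubleK.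
Qed.

Lemma cycle_class_near n nu (t : 'S_n) : all odd nu ->
  (t^-1)%g \in cycle_class n (complete2 n nu) -> near_fpf (sumn nu) t.
Proof.
move=> no; rewrite inE porbitsV => pe; apply/andP; split.
  rewrite /odd_support (card_porbit_pred t (fun X => odd #|X|)) -big_enum_cond /=.
  have -> : \sum_(X <- enum (porbits t) | odd #|X|) #|X| =
      sumn [seq x <- [seq #|(X : {set 'I_n})| | X <- enum (porbits t)] | odd x].
    by rewrite sumnE big_filter big_map.
  rewrite (perm_sumn (perm_filter odd pe)) /complete2 filter_cat.
  rewrite (all_filterP no) sumn_cat -[X in _ == X]addn0 eqn_add2l.
  by elim: (_./2).
apply/forall_inP => x; rewrite !inE => ox; rewrite -card_porbit2.
have : #|porbit t x| \in complete2 n nu.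
  by rewrite -(perm_mem pe); apply: map_f; rewrite mem_enum imset_f.
rewrite mem_cat => /orP[xn|]; last by rewrite mem_nseq => /andP[].
by case/negP: ox; apply: (allP no).
Qed.

Lemma quad_count_near n nu : ~~ odd n -> all odd nu -> 0 < sumn nu ->
  quad_count (cycle_class n (complete2 n nu)) * n <=
    (sumn nu ^ sumn nu) ^ 4 * (3 * n) ^ (sumn nu)./2 * quad_count (fpf_class n).
Proof.
move=> en no nu0; rewrite /quad_count big_distrl big_distrr; apply: leq_sum => x1 x1K.
rewrite big_distrl big_distrr; apply: leq_sum => x2 x2K /=.
pose h := ((x1 * x2)^-1)%g.
have [x1K' x1F] : (forall x, x1 (x1 x) = x) /\ (forall x, x1 x != x).
  by apply/fpf_permP; rewrite -fpf_class_perm.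
have [x2K' x2F] : (forall x, x2 (x2 x) = x) /\ (forall x, x2 x != x).
  by apply/fpf_permP; rewrite -fpf_class_perm.
have hs s : (h^-1 * s = x1 * x2 * s)%g by rewrite /h invgK.
have fV (p : 'S_n) : fpf_perm p -> fpf_perm (p^-1)%g.
  move/fpf_permP => [pK pF]; apply/fpf_permP; have e x : p^-1%g x = p x.
    by apply: (@perm_inj _ p); rewrite permKV pK.
  by split=> x; rewrite !e.
have x1h : x1 \in fpf_factors h.
  rewrite inE; apply/andP; split; apply/fpf_permP; split=> // x; rewrite hs !permM.
    by rewrite !x1K' x2K' x1K'.
  by apply/eqP => e; have := x2F (x1 x); rewrite -[X in X != _]x1K' e eqxx.
have := @card_near_factors _ (sumn nu) h nu0; rewrite card_ord => le.
apply: (@leq_trans (#|near_factors (sumn nu) h| * n)).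
  rewrite leq_mul2r; apply/orP; right; apply/subset_leq_card/subsetP => s.
  rewrite inE fpf_class_perm // => /andP[sF tK]; rewrite inE sF hs /=.
  exact: cycle_class_near tK.
have x1h' : fpf_factors h != set0 by apply/set0Pn; exists x1.
apply: leq_trans (le x1h') _.
rewrite leq_mul2l; apply/orP; right; apply/subset_leq_card/subsetP => s.
rewrite inE hs => /andP[sF tF]; rewrite inE !fpf_class_perm // sF /=; exact: fV.
Qed.

From mathcomp Require Import classical_sets filter topology normedtype.

Import numFieldNormedType.Exports.

Local Open Scope ring_scope.
Local Open Scope classical_set_scope.

Theorem mainTheorem8 (nu : seq nat) (nu_partition : is_partition nu)
    (nu_odd : all odd nu) (nu_gt0 : (0 < sumn nu)%N)
    (nu_even : ~~ odd (sumn nu)) :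
  (n%:R ^- (sumn nu)./2 * pillowcase_mean n (gS n nu) : algC^o)
    @[n --> within [set n | ~~ odd n] \oo] --> (0 : algC^o).
Proof.
set m := (sumn nu)./2; set C := ((sumn nu ^ sumn nu) ^ 4 * 3 ^ m)%N.
have le n : (0 < n)%N -> ~~ odd n ->
    `|n%:R ^- m * pillowcase_mean n (gS n nu)| <= C%:R / n%:R :> algC.
  move=> n0 en; rewrite pillowcase_mean_gS //.
  have := quad_count_near en nu_odd nu_gt0; rewrite -/m expnMn mulnA -/C.
  set q := quad_count _; set q0 := quad_count _ => le.
  have nR : 0 < n%:R :> algC by rewrite ltr0n.
  have mR : 0 < n%:R ^+ m :> algC by rewrite exprn_gt0.
  have [-> | q0_gt0] := posnP q0; first by rewrite invr0 !mulr0 normr0 divr_ge0.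
  have q0R : 0 < q0%:R :> algC by rewrite ltr0n.
  rewrite ger0_norm; last first.
    by apply: mulr_ge0; [rewrite invr_ge0 exprn_ge0 ?ler0n | rewrite divr_ge0 ?ler0n].
  rewrite ler_pdivlMr // mulrC mulrCA mulrC ler_pdivrMr // mulrA ler_pdivrMr //.
  by rewrite -natrX -!natrM ler_nat mulnC.
apply/cvgr0Pnorm_le => e e0; rewrite near_withinE.
have [N CN] : exists N : nat, C%:R / e < N%:R :> algC.
  by exists (Num.Def.archi_bound (C%:R / e)); apply: archi_boundP; rewrite divr_ge0 // ltW.
near=> n => /= en.
have n0 : (0 < n)%N by near: n; exact: nbhs_infty_gt.
apply: le_trans (le n n0 en) _; rewrite ler_pdivrMr ?ltr0n // mulrC -ler_pdivrMr //.
apply: le_trans (ltW CN) _; rewrite ler_nat; near: n; exact: nbhs_infty_ge.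
Unshelve. all: by end_near.
Qed.
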